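(* Let $r_0>1$ and let $X$ be an $r_0$-convex Banach function space over $\mathbf{R}^d$ with the Fatou property. Then the following are equivalent: (i) $M:X\to X$ and $M:X'\to X'$ are bounded; (ii) $\mathcal{M}:X[\ell^r]\to X[\ell^r]$ is bounded for some $1<r\le r_0$.
   Context: A Banach function space over $\mathbf{R}^d$ is a Banach space $X\subseteq L^0(\mathbf{R}^d)$ with the ideal property (if $f\in X$, $|g|\le|f|$ then $g\in X$, $\|g\|_X\le\|f\|_X$) and the saturation property (every set of positive measure contains a subset $F$ of positive measure with $\mathbf{1}_F\in X$). Köthe dual: $\|g\|_{X'}=\sup_{\|f\|_X=1}\int|fg|$. Fatou property: $0\le f_n\uparrow f$ a.e., $\sup\|f_n\|_X<\infty$ imply $f\in X$, $\|f\|_X=\sup\|f_n\|_X$. $X$ is $r$-convex if there is $C$ with $\|(\sum_{f\in\mathcal{F}}|f|^r)^{1/r}\|_X\le C(\sum_{f\in\mathcal{F}}\|f\|_X^r)^{1/r}$ for all finite $\mathcal{F}\subseteq X$. $M$ is the Hardy–Littlewood maximal operator over axis-parallel cubes. $\mathcal{Q}$ denotes the countable collection of cubes with rational corners; for $1\le r\le\infty$, $X[\ell^r]$ is the space of families $(f_Q)_{Q\in\mathcal{Q}}$ of measurable functions with $\|(f_Q)\|_{X[\ell^r]}=\|x\mapsto\|(f_Q(x))_{Q\in\mathcal{Q}}\|_{\ell^r}\|_X<\infty$; $\mathcal{M}((f_Q)_{Q\in\mathcal{Q}})=(\langle f_Q\rangle_Q\mathbf{1}_Q)_{Q\in\mathcal{Q}}$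 with $\langle f\rangle_Q=\frac1{|Q|}\int_Qf$. *)

(* Defs.v *)
From HB Require Import structures.
From mathcomp Require Import all_boot all_order all_algebra.
From mathcomp Require Import all_classical all_reals all_analysis.
Set Implicit Arguments. Unset Strict Implicit. Unset Printing Implicit Defensive.
Import Order.TTheory GRing.Theory Num.Theory.
Import numFieldNormedType.Exports.
Local Open Scope classical_set_scope.
Local Open Scope ring_scope.

(* R^d is modelled as d.-tuple R with the product (= Borel) sigma-algebra
   generated by the coordinates (library instance measure_tuple_display). *)
Notation Rd R d := (d.-tuple R).

Section defs.
Context {R : realType} {d : nat}.
Local Notation T := (Rd R d).

Definition box (a b : T) : set T :=
  [set x | forall i : 'I_d, tnth a i <= tnth x i < tnth b i].

(* Lebesgue measure on R^d: the measure of each box is its volume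
   (this characterises Lebesgue measure on the Borel sets). *)
Definition is_lebesgue (mu : {measure set T -> \bar R}) :=
  forall a b : T, (forall i, tnth a i <= tnth b i) ->
    mu (box a b) = (\prod_(i < d) (tnth b i - tnth a i))%:E.

Definition cube (a : T) (l : R) : set T :=
  [set x | forall i : 'I_d, tnth a i <= tnth x i < tnth a i + l].

Definition is_cube (Q : set T) := exists a l, 0 < l /\ Q = cube a l.

Definition Qidx := {p : d.-tuple rat * rat | 0 < p.2}.
Definition Qcube (q : Qidx) : set T :=
  cube [tuple of map (@ratr R) (sval q).1] (ratr (sval q).2).

Variable mu : {measure set T -> \bar R}.

(* average <f>_Q (extended real: +-oo or junk when f is not integrable on Q) *)
Definition avg (Q : set T) (f : T -> R) : \bar R :=
  ((\int[mu]_(y in Q) (f y)%:E) * ((fine (mu Q))^-1)%:E)%E.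

Definition HLmax (f : T -> R) : T -> \bar R :=
  fun x => ereal_sup [set avg Q (fun y => `|f y|) | Q in [set Q | is_cube Q /\ Q x]].

Record bfs := BFS {
  bX : set (T -> R);
  nrm : (T -> R) -> R;
  X_meas : forall f, bX f -> measurable_fun setT f;
  X_add : forall f g, bX f -> bX g -> bX (f \+ g);
  X_scale : forall (a : R) f, bX f -> bX (fun x => a * f x);
  X_zero : bX (fun _ => 0);
  nrm_ge0 : forall f, bX f -> 0 <= nrm f;
  nrm_eq0 : forall f, bX f -> (nrm f = 0 <-> {ae mu, forall x, f x = 0});
  nrm_scale : forall (a : R) f, bX f -> nrm (fun x => a * f x) = `|a| * nrm f;
  nrm_triangle : forall f g, bX f -> bX g -> nrm (f \+ g) <= nrm f + nrm g;
  X_complete : forall u : nat -> T -> R, (forall n, bX (u n)) ->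
    (forall e : R, 0 < e -> exists N, forall m n, (N <= m)%N -> (N <= n)%N ->
        nrm (u m \- u n) < e) ->
    exists f, bX f /\ (fun n => nrm (u n \- f)) @ \oo --> 0;
  X_ideal : forall f g : T -> R, bX f -> measurable_fun setT g ->
    {ae mu, forall x, `|g x| <= `|f x|} -> bX g /\ nrm g <= nrm f;
  X_saturation : forall E, measurable E -> (0 < mu E)%E ->
    exists F, [/\ measurable F, F `<=` E, (0 < mu F)%E & bX (\1_F : T -> R)]
}.

Definition fatou_prop (Xs : bfs) := forall (u : nat -> T -> R) (f : T -> R),
  (forall n, bX Xs (u n)) -> measurable_fun setT f ->
  {ae mu, forall x, 0 <= u 0%N x /\ (forall n, u n x <= u n.+1 x) /\
                   (fun n => u n x) @ \oo --> f x} ->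
  (exists B, forall n, nrm Xs (u n) <= B) ->
  bX Xs f /\ nrm Xs f = sup (range (fun n => nrm Xs (u n))).

Definition rconvex (Xs : bfs) (r : R) := exists C : R,
  forall s : seq (T -> R), (forall f, f \in s -> bX Xs f) ->
    nrm Xs (fun x => (\sum_(f <- s) `|f x| `^ r) `^ r^-1)
      <= C * (\sum_(f <- s) nrm Xs f `^ r) `^ r^-1.

Definition kdual_sup (Xs : bfs) (g : T -> R) : \bar R :=
  ereal_sup [set (\int[mu]_x (`|f x * g x|)%:E)%E | f in [set f | bX Xs f /\ nrm Xs f = 1]].
Definition kdual_set (Xs : bfs) : set (T -> R) :=
  [set g | measurable_fun setT g /\ (kdual_sup Xs g < +oo)%E].
Definition kdual_nrm (Xs : bfs) (g : T -> R) : R := fine (kdual_sup Xs g).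

Definition bounded_on (S : set (T -> R)) (n : (T -> R) -> R)
  (Op : (T -> R) -> T -> \bar R) := exists C : R, forall f, S f ->
    [/\ {ae mu, forall x, Op f x \is a fin_num}, S (fine \o Op f)
      & n (fine \o Op f) <= C * n f].

Definition lr_pt (r : R) (F : Qidx -> T -> \bar R) : T -> \bar R :=
  fun x => ((\esum_(q in [set: Qidx]) (`|F q x| `^ r)) `^ r^-1)%E.

Definition Xlr_mem (Xs : bfs) (r : R) (F : Qidx -> T -> \bar R) :=
  [/\ forall q, measurable_fun setT (fine \o F q),
      forall q, {ae mu, forall x, F q x \is a fin_num},
      {ae mu, forall x, lr_pt r F x \is a fin_num}
    & bX Xs (fine \o lr_pt r F)].
Definition Xlr_nrm (Xs : bfs) (r : R) (F : Qidx -> T -> \bar R) : R :=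
  nrm Xs (fine \o lr_pt r F).

Definition Mcal (F : Qidx -> T -> R) : Qidx -> T -> \bar R :=
  fun q x => (avg (Qcube q) (F q) * (\1_(Qcube q) x : R)%:E)%E.

Definition Mcal_bounded (Xs : bfs) (r : R) := exists C : R,
  forall F : Qidx -> T -> R, Xlr_mem Xs r (fun q x => (F q x)%:E) ->
    Xlr_mem Xs r (Mcal F) /\
    Xlr_nrm Xs r (Mcal F) <= C * Xlr_nrm Xs r (fun q x => (F q x)%:E).

End defs.

(* Main.v *)
(* (i) => (ii), with r = r0.  Duality with M on X' bounds h := sum_Q <g_Q>_Q 1_Q in X
   by sum_Q g_Q when the g_Q are nonnegative.  For F := |(f_Q)|_{l^r}, Hoelder's
   inequality applied to f_Q = (f_Q^r F^{1-r})^{1/r} F^{1-1/r} gives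
   |(<f_Q>_Q 1_Q)|_{l^r} <= h^{1/r} (M F)^{1-1/r} with g_Q := f_Q^r F^{1-r}, whose
   sum is F; the right-hand side is controlled in X because M is bounded on X.

   (ii) => (i).  By r-convexity and the Fatou property, X is recovered from the
   weights w in the dual ball of its r-concavification.  Separating convex sets
   (in L^2) turns the vector-valued bound into the statement that every such w has a
   companion W in that ball with <f>_Q^r w(Q) <= G int_Q f^r W for the cubes Q of a
   given finite family.  Iterating as in Rubio de Francia's algorithm gives v >= w
   with an A_r constant independent of the family, so Muckenhoupt's theorem bounds
   the maximal operator over a finite family on L^r(v) and on L^{r'}(v^{1-r'}),
   uniformly.  The first bound extrapolates to M on X.  The second one bounds on
   L^r(v), hence on X, the adjoints f |-> sum_Q <f e_Q>_Q 1_Q of the linearizations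
   sum_Q <.>_Q e_Q of M, and this is the bound for M on X'. *)
Require Import Defs.
From HB Require Import structures.
From mathcomp Require Import all_boot all_order all_algebra.
From mathcomp Require Import all_classical all_reals all_analysis.
From mathcomp Require Import measurable_realfun ring lra.
Import Order.TTheory GRing.Theory Num.Theory.
Import numFieldNormedType.Exports.
Set Implicit Arguments. Unset Strict Implicit. Unset Printing Implicit Defensive.
Local Open Scope classical_set_scope.
Local Open Scope ring_scope.

(** * Nonnegative measurable functions and their integrals *)

Section nonneg_functions.
Context {dsp : measure_display} {T : measurableType dsp} {R : realType}.
Implicit Types (f g : T -> R) (A : set T).

(** The obstacle in (ii) => (i) is that a bound for a vector-valued operator on X says nothing
    direct about weights. Working with a finite family of cubes makes the averages continuous in
    L^2, so a convex set defined by a lower bound on averages keeps a positive distance from the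
    hull of the unit ball, and projection in L^2 serves in place of Hahn-Banach or a minimax
    theorem. That distance depends on the family and on w, but the constant [G] of the weight
    inequality does not, nor does any later bound. Monotone limits along an enumeration of the
    rational cubes then recover the full maximal operators, since every cube lies in rational cubes
    of almost the same volume. Passing from r0 to a smaller r is free: the solid convex hull of the
    |f|^r is controlled in X with one constant for all 1 <= r <= r0, by Jensen's inequality. The
    value r = 1 gives the duality between X and X' needed in (i) => (ii). Doubling of the weights is
    derived from the A_r condition on a cube and its triple; hence the tested family always contains
    the triples, and one cube enclosing them all. *)

Definition nnfun f := measurable_fun setT f /\ forall x, 0 <= f x.

Lemma nnfun_ext f g : f =1 g -> nnfun f -> nnfun g.
Proof. by move=> /funext ->. Qed.

Lemma nnfunD f g : nnfun f -> nnfun g -> nnfun (fun x => f x + g x).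
Proof.
move=> [mf f0] [mg g0]; split=> [|x]; first exact: measurable_funD.
exact: addr_ge0.
Qed.

Lemma nnfunM f g : nnfun f -> nnfun g -> nnfun (fun x => f x * g x).
Proof.
move=> [mf f0] [mg g0]; split=> [|x]; first exact: measurable_funM.
exact: mulr_ge0.
Qed.

Lemma nnfun_cst (c : R) : 0 <= c -> nnfun (fun=> c).
Proof. by move=> c0; split => //; exact: measurable_cst. Qed.

Lemma nnfunZ (c : R) f : 0 <= c -> nnfun f -> nnfun (fun x => c * f x).
Proof. by move=> c0 nf; apply: nnfunM => //; exact: nnfun_cst. Qed.

Lemma nnfun_pow (p : R) f : measurable_fun setT f -> nnfun (fun x => f x `^ p).
Proof.
move=> mf; split=> [|x]; last exact: powR_ge0.
exact: (measurableT_comp (measurable_powR _) mf).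
Qed.

Lemma nnfun_norm f : measurable_fun setT f -> nnfun (fun x => `|f x|).
Proof. by move=> mf; split=> [|x //]; exact: measurableT_comp. Qed.

Lemma nnfun_indic A : measurable A -> nnfun (\1_A : T -> R).
Proof.
by move=> mA; split=> [|x]; [exact: measurable_indic|rewrite indicE].
Qed.

Lemma nnfun_sum (I : eqType) (s : seq I) (F : I -> T -> R) :
  (forall i, i \in s -> nnfun (F i)) -> nnfun (fun x => \sum_(i <- s) F i x).
Proof.
elim: s => [|i s ih] h.
  by apply: (@nnfun_ext (fun=> 0)) => [x|]; [rewrite big_nil|exact: nnfun_cst].
apply: (@nnfun_ext (fun x => F i x + \sum_(j <- s) F j x)) => [x|].
  by rewrite big_cons.
apply: nnfunD; first by apply: h; rewrite mem_head.
by apply: ih => j js; apply: h; rewrite inE js orbT.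
Qed.

Lemma nnfun_max f g : nnfun f -> nnfun g -> nnfun (fun x => Num.max (f x) (g x)).
Proof.
move=> [mf f0] [mg g0]; split=> [|x]; first exact: measurable_maxr.
by rewrite le_max f0.
Qed.

Lemma nnfun_min f g : nnfun f -> nnfun g -> nnfun (fun x => Num.min (f x) (g x)).
Proof.
move=> [mf f0] [mg g0]; split=> [|x]; first exact: measurable_minr.
by rewrite le_min f0 g0.
Qed.

Lemma nnfun_pos f : measurable_fun setT f -> nnfun (fun x => Num.max (f x) 0).
Proof.
move=> mf; split=> [|x]; first by apply: measurable_maxr.
by rewrite le_max lexx orbT.
Qed.

Lemma nnfun_bigmax (I : eqType) (s : seq I) (F : I -> T -> R) :
  (forall i, i \in s -> nnfun (F i)) ->
  nnfun (fun x => \big[Num.max/0]_(i <- s) F i x).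
Proof.
elim: s => [|i s ih] h.
  by apply: (@nnfun_ext (fun=> 0)) => [x|]; [rewrite big_nil|exact: nnfun_cst].
apply: (@nnfun_ext (fun x => Num.max (F i x) (\big[Num.max/0]_(j <- s) F j x))).
  by move=> x; rewrite big_cons.
apply: nnfun_max; first by apply: h; rewrite mem_head.
by apply: ih => j js; apply: h; rewrite inE js orbT.
Qed.

End nonneg_functions.

Section nonneg_integral.
Context {dsp : measure_display} {T : measurableType dsp} {R : realType}.
Variable mu : {measure set T -> \bar R}.
Implicit Types (f g : T -> R) (A : set T).

Definition itg f : \bar R := (\int[mu]_x (f x)%:E)%E.

Lemma itg_ext f g : f =1 g -> itg f = itg g.
Proof. by move=> /funext ->. Qed.

Lemma itg_ge0 f : nnfun f -> (0 <= itg f)%E.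
Proof. by move=> [_ f0]; apply: integral_ge0 => x _; rewrite lee_fin. Qed.

Let mE f : measurable_fun setT f -> measurable_fun setT (EFin \o f).
Proof. by move=> mf; exact/measurable_EFinP. Qed.

Lemma itgD f g : nnfun f -> nnfun g ->
  itg (fun x => f x + g x) = (itg f + itg g)%E.
Proof.
move=> [mf f0] [mg g0]; rewrite /itg -ge0_integralD//.
- by move=> x _; rewrite lee_fin.
- exact: mE.
- by move=> x _; rewrite lee_fin.
- exact: mE.
Qed.

Lemma itgZ (c : R) f : 0 <= c -> nnfun f ->
  itg (fun x => c * f x) = (c%:E * itg f)%E.
Proof.
move=> c0 [mf f0]; rewrite /itg -ge0_integralZl_EFin//.
- by move=> x _; rewrite lee_fin.
- exact: mE.
Qed.

Lemma itg0 : itg (fun=> 0) = 0%E.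
Proof. by rewrite /itg integral0. Qed.

Lemma itg_sum (I : eqType) (s : seq I) (F : I -> T -> R) :
  (forall i, i \in s -> nnfun (F i)) ->
  itg (fun x => \sum_(i <- s) F i x) = (\sum_(i <- s) itg (F i))%E.
Proof.
elim: s => [|i s ih] h.
  by rewrite big_nil -itg0; apply: itg_ext => x; rewrite big_nil.
rewrite big_cons -ih; last by move=> j js; apply: h; rewrite inE js orbT.
rewrite -itgD; first by apply: itg_ext => x; rewrite big_cons.
  by apply: h; rewrite mem_head.
by apply: nnfun_sum => j js; apply: h; rewrite inE js orbT.
Qed.

Lemma ae_le_itg f g : nnfun f -> nnfun g ->
  {ae mu, forall x, f x <= g x} -> (itg f <= itg g)%E.
Proof.
move=> [mf f0] [mg g0] fg; apply: ae_ge0_le_integral => //.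
- by move=> x _; rewrite lee_fin.
- exact: mE.
- by move=> x _; rewrite lee_fin.
- exact: mE.
- by apply: filterS fg => x + _; rewrite lee_fin.
Qed.

Lemma le_itg f g : nnfun f -> nnfun g -> (forall x, f x <= g x) ->
  (itg f <= itg g)%E.
Proof. by move=> nf ng fg; apply: ae_le_itg => //; exact: aeW. Qed.

Lemma ae_eq_itg f g : nnfun f -> nnfun g ->
  {ae mu, forall x, f x = g x} -> itg f = itg g.
Proof.
move=> nf ng fg; apply/eqP; rewrite eq_le !ae_le_itg//.
- by apply: filterS fg => x ->.
- by apply: filterS fg => x ->.
Qed.

Lemma itg_indic A : measurable A -> itg \1_A = mu A.
Proof. by move=> mA; rewrite /itg integral_indic// setIT. Qed.

Lemma itg_setE A f : measurable A ->
  (\int[mu]_(x in A) (f x)%:E)%E = itg (fun x => \1_A x * f x).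
Proof.
move=> mA; rewrite integral_mkcond; apply: eq_integral => x _.
rewrite /patch indicE; case: ifPn => _ /=; first by rewrite mul1r.
by rewrite mul0r.
Qed.

Lemma itg_lim_le (u : nat -> T -> R) f (B : \bar R) :
  (forall n, nnfun (u n)) -> nnfun f ->
  (forall x n, u n x <= u n.+1 x) -> (forall x, (u n x @[n --> \oo] --> f x)) ->
  (forall n, (itg (u n) <= B)%E) -> (itg f <= B)%E.
Proof.
move=> nu nf ndu uf uB.
have ndE x : {homo (fun n => (u n x)%:E) : n m / (n <= m)%N >-> (n <= m)%E}.
  by move=> n m nm; rewrite lee_fin; have /nondecreasing_seqP := ndu x; apply.
have H : (itg (u n) @[n --> \oo] --> itg f)%E.
  rewrite {2}/itg; under eq_integral => x _.
    rewrite -(_ : limn (fun n => (u n x)%:E) = (f x)%:E); first over.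
    by apply/cvg_lim => //; apply: cvg_EFin => //; [exact: nearW|exact: uf].
  apply: (@cvg_monotone_convergence _ _ _ mu setT _ (fun n x => (u n x)%:E)) => //.
  - by move=> n; apply: mE; case: (nu n).
  - by move=> n x _; rewrite lee_fin; case: (nu n).
move/cvg_lim: (H) => <- //; apply: lime_le; last exact: nearW.
by apply/cvg_ex; eexists; exact: H.
Qed.

Lemma itg_eq0 f : nnfun f -> itg f = 0%E -> {ae mu, forall x, f x = 0}.
Proof.
move=> [mf f0] h.
have : (\int[mu]_(x in setT) `|(EFin \o f) x| = 0)%E.
  by rewrite -h; apply: eq_integral => x _ /=; rewrite ger0_norm.
move/(ae_eq_integral_abs _ measurableT (mE mf)).
by apply: filterS => x /(_ I) [].
Qed.

Lemma itg_fin_num f : nnfun f -> (itg f < +oo)%E -> (itg f) \is a fin_num.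
Proof. by move=> nf hf; rewrite ge0_fin_numE// itg_ge0. Qed.

End nonneg_integral.

(** * The space L^2: inner product, completeness, projection on convex sets *)

Section square_integrable.
Context {dsp : measure_display} {T : measurableType dsp} {R : realType}.
Variable mu : {measure set T -> \bar R}.
Implicit Types (f g h : T -> R) (D : set (T -> R)).

Definition sqint f := measurable_fun setT f /\ (itg mu (fun x => f x ^+ 2)%R < +oo)%E.

(** Outside L^2 the product may fail to be integrable and the value is meaningless; apart from
    symmetry and positivity, the rules below assume [sqint]. *)
Definition ip f g : R := fine (itg mu (fun x => f x * g x)).

Let nnsq f : measurable_fun setT f -> nnfun (fun x => f x ^+ 2).
Proof.
by move=> mf; split=> [|x]; [exact: measurable_funX|exact: sqr_ge0].
Qed.

Let integrable_sq f : sqint f -> mu.-integrable setT (EFin \o (fun x => f x ^+ 2)).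
Proof.
move=> [mf fi]; apply/integrableP; split.
  by apply/measurable_EFinP; case: (nnsq mf).
rewrite (_ : (\int[mu]_x _)%E = itg mu (fun x => f x ^+ 2))//.
by apply: eq_integral => x _ /=; rewrite ger0_norm// sqr_ge0.
Qed.

Lemma sqint_integrableM f g : sqint f -> sqint g ->
  mu.-integrable setT (EFin \o (fun x => f x * g x)).
Proof.
move=> hf hg.
apply: (@le_integrable _ _ _ mu setT measurableT _
   (EFin \o (fun x => f x ^+ 2 + g x ^+ 2))).
- by apply/measurable_EFinP; apply: measurable_funM; [case: hf|case: hg].
- move=> x _ /=; rewrite lee_fin (ger0_norm (addr_ge0 (sqr_ge0 _) (sqr_ge0 _))).
  by rewrite ler_norml; apply/andP; split; nra.
- have := integrableD measurableT (integrable_sq hf) (integrable_sq hg).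
  by apply: eq_integrable.
Qed.

Lemma sqintD (a b : R) f g : sqint f -> sqint g ->
  sqint (fun x => a * f x + b * g x).
Proof.
move=> hf hg; split.
  apply: measurable_funD; apply: measurable_funM; try exact: measurable_cst.
    by case: hf.
  by case: hg.
have mf := hf.1; have mg := hg.1.
have nf := nnsq mf; have ng := nnsq mg.
have a0 : 0 <= 2 * a ^+ 2 by rewrite mulr_ge0// sqr_ge0.
have b0 : 0 <= 2 * b ^+ 2 by rewrite mulr_ge0// sqr_ge0.
apply: (@le_lt_trans _ _ (itg mu (fun x => (2 * a ^+ 2) * f x ^+ 2
                                   + (2 * b ^+ 2) * g x ^+ 2))).
  apply: le_itg => [||x].
  - apply: nnsq; apply: measurable_funD; apply: measurable_funM => //; exact: measurable_cst.
  - by apply: nnfunD; apply: nnfunZ.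
  - by have := sqr_ge0 (a * f x - b * g x); nra.
rewrite itgD ?itgZ//; try exact: nnfunZ.
apply: lte_add_pinfty.
  by apply: lte_mul_pinfty => //; exact: hf.2.
by apply: lte_mul_pinfty => //; exact: hg.2.
Qed.

Lemma ipC f g : ip f g = ip g f.
Proof. by congr fine; apply: itg_ext => x; rewrite mulrC. Qed.

Lemma ipDl (a b : R) f g h : sqint f -> sqint g -> sqint h ->
  ip (fun x => a * f x + b * g x) h = a * ip f h + b * ip g h.
Proof.
move=> hf hg hh; rewrite /ip.
have fh := sqint_integrableM hf hh; have gh := sqint_integrableM hg hh.
have := @RintegralD _ _ _ mu setT (fun x => a * (f x * h x)) (fun x => b * (g x * h x)) measurableT.
rewrite !RintegralZl// => <-.
- by rewrite /Rintegral; congr fine; apply: eq_integral => x _; congr EFin; ring.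
- have := integrableZl measurableT a fh; exact: eq_integrable.
- have := integrableZl measurableT b gh; exact: eq_integrable.
Qed.

Lemma ip_ge0 f : 0 <= ip f f.
Proof.
by apply: fine_ge0; apply: integral_ge0 => x _; rewrite lee_fin -expr2 sqr_ge0.
Qed.

Lemma ipE f : sqint f -> (ip f f)%:E = itg mu (fun x => f x ^+ 2).
Proof.
move=> hf; rewrite /ip fineK; first by apply: itg_ext => x; rewrite expr2.
rewrite (_ : itg mu _ = itg mu (fun x => f x ^+ 2)).
  by apply: itg_fin_num; [exact: nnsq hf.1|exact: hf.2].
by apply: itg_ext => x; rewrite expr2.
Qed.

Lemma ip_sqD (a b : R) f g : sqint f -> sqint g ->
  ip (fun x => a * f x + b * g x) (fun x => a * f x + b * g x)
  = a ^+ 2 * ip f f + 2 * a * b * ip f g + b ^+ 2 * ip g g.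
Proof.
move=> hf hg; have hfg := sqintD a b hf hg.
rewrite ipDl// !(ipC _ (fun x => _ + _)) !ipDl// (ipC g f); ring.
Qed.

End square_integrable.

Section separation.
Context {dsp : measure_display} {T : measurableType dsp} {R : realType}.
Variable mu : {measure set T -> \bar R}.
Implicit Types (f g h u : T -> R) (D U G : set (T -> R)).

(** All limits in the projection argument carry a geometric error term, so this one passage to the
    limit suffices there. *)
Lemma ler_geometricP (q x y k : R) : 0 <= q < 1 ->
  (forall n, x <= y + k * q ^+ n) -> x <= y.
Proof.
move=> /andP[q0 q1] h.
have c : (fun n => y + k * q ^+ n) @ \oo --> y + 0.
  apply: cvgD; first exact: cvg_cst.
  by apply: (@cvg_geometric _ k q); rewrite ger0_norm.
rewrite addr0 in c; rewrite -(cvg_lim _ c)//.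
by apply: limr_ge; [apply/cvg_ex; eexists; exact: c|exact: nearW].
Qed.

(** The sum of the 4^n v_n^2 has integral at most the sum of 4^n 16^-n, so it is finite almost
    everywhere and bounds each 4^n v_n^2. Such a rate gives pointwise convergence without passing to
    a subsequence. *)
Lemma sqint_fast_decay (v : nat -> T -> R) : (forall n, nnfun (v n)) ->
  (forall n, (itg mu (fun x => v n x ^+ 2)%R <= ((16^-1) ^+ n)%:E)%E) ->
  {ae mu, forall x, exists C, forall n, v n x <= C * 2^-1 ^+ n}.
Proof.
move=> nv iv.
pose S x : \bar R := (\sum_(0 <= n <oo) (4 ^+ n * v n x ^+ 2)%:E)%E.
have nw n : nnfun (fun x => 4 ^+ n * v n x ^+ 2).
  apply: nnfunZ; first exact: exprn_ge0.
  by split=> [|x]; [apply: measurable_funX; case: (nv n)|exact: sqr_ge0].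
have nv2 n : nnfun (fun x => v n x ^+ 2).
  by split=> [|x]; [apply: measurable_funX; case: (nv n)|exact: sqr_ge0].
have mw n : measurable_fun setT (fun x => (4 ^+ n * v n x ^+ 2)%:E).
  by apply/measurable_EFinP; case: (nw n).
have w0 n x : (0 <= (4 ^+ n * v n x ^+ 2)%:E)%E.
  by rewrite lee_fin; case: (nw n).
have S0 x : (0 <= S x)%E by apply: nneseries_ge0 => n _ _.
have mS : measurable_fun setT S.
  by apply: ge0_emeasurable_sum => // n x _ _; exact: w0.
have geo : (\sum_(0 <= n <oo) ((4^-1) ^+ n)%:E < +oo :> \bar R)%E.
  have cg : cvgn (series (geometric (1:R) 4^-1)).
    by apply: is_cvg_geometric_series; rewrite ger0_norm; lra.
  rewrite (_ : (fun n => _) = EFin \o series (geometric (1:R) 4^-1)); last first.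
    apply/funext => n /=; rewrite /series/= sumEFin; congr EFin.
    by apply: eq_bigr => i _; rewrite mul1r.
  by rewrite EFin_lim// ltry.
have iS : (\int[mu]_x S x < +oo)%E.
  rewrite integral_nneseries//; apply: le_lt_trans geo.
  apply: lee_nneseries => [n *|n *]; first by apply: integral_ge0.
  rewrite -/(itg mu (fun x => 4 ^+ n * v n x ^+ 2)) itgZ ?exprn_ge0//.
  apply: (@le_trans _ _ ((4 ^+ n)%:E * ((16^-1) ^+ n)%:E)%E).
    by apply: lee_wpmul2l; rewrite ?lee_fin ?exprn_ge0.
  by rewrite -EFinM lee_fin -exprMn le_eqVlt; apply/orP; left; apply/eqP; congr (_ ^+ n); lra.
have : mu.-integrable setT S.
  apply/integrableP; split=> //.
  by rewrite (eq_integral S)// => x _; rewrite gee0_abs.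
move=> /(integrable_ae measurableT); apply: filterS => x /(_ I) Sfin.
(* From (2^n v_n)^2 <= S follows 2^n v_n <= S + 1, which avoids a square root. *)
exists (fine (S x) + 1) => n.
have fS0 : 0 <= fine (S x) by exact: fine_ge0.
have h : 4 ^+ n * v n x ^+ 2 <= fine (S x).
  rewrite -lee_fin fineK//.
  apply: le_trans (nneseries_lim_ge n.+1 _); last by move=> k _ _; exact: w0.
  rewrite big_nat_recr//= leeDr//.
  by apply: sume_ge0 => k _; exact: w0.
have v0 : 0 <= v n x by case: (nv n).
have e4 : (4 : R) ^+ n = (2 ^+ n) ^+ 2 by rewrite -exprM mulnC exprM; congr (_ ^+ n); ring.
rewrite e4 -exprMn in h.
have p2 : 0 < (2 : R) ^+ n by exact: exprn_gt0.
rewrite exprVn -ler_pdivrMr ?invr_gt0// invrK.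
have : 0 <= 2 ^+ n * v n x by rewrite mulr_ge0// ltW.
nra.
Qed.

(** Riesz-Fischer with a rate: consecutive differences decay like 2^-n almost everywhere, so v_n
    converges pointwise, and Fatou's lemma carries the rate 16^-n to the limit. *)
Lemma sqint_complete (v : nat -> T -> R) : (forall n, sqint mu (v n)) ->
  (forall n m, (n <= m)%N ->
     ip mu (fun x => v n x - v m x) (fun x => v n x - v m x) <= (16^-1) ^+ n) ->
  exists z, sqint mu z /\
    forall n, ip mu (fun x => v n x - z x) (fun x => v n x - z x) <= (16^-1) ^+ n.
Proof.
move=> hv cv.
have hB f g : sqint mu f -> sqint mu g -> sqint mu (fun x => f x - g x).
  move=> hf hg; have := sqintD 1 (-1) hf hg; congr sqint.
  by apply/funext => x; rewrite mul1r mulN1r.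
have mv n : measurable_fun setT (v n) by case: (hv n).
have key : {ae mu, forall x, exists C, forall n, `|v n x - v n.+1 x| <= C * 2^-1 ^+ n}.
  apply: (@sqint_fast_decay (fun n x => `|v n x - v n.+1 x|)) => n.
    by apply: nnfun_norm; exact: measurable_funB.
  rewrite (_ : itg _ _ = (ip mu (fun x => v n x - v n.+1 x) (fun x => v n x - v n.+1 x))%:E).
    by rewrite lee_fin; exact: cv.
  rewrite ipE; last exact: hB.
  by apply: itg_ext => x; rewrite real_normK// num_real.
(* The upper limit is measurable without discarding a null set, and it is the limit wherever v_n
   converges. *)
pose z x := fine (limn_esup (fun n => (v n x)%:E)).
have mz : measurable_fun setT z.
  apply: (measurableT_comp (fine_measurable measurableT)).
  by apply: measurable_fun_limn_esup => n; apply/measurable_EFinP.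
have vz : {ae mu, forall x, v n x @[n --> \oo] --> z x}.
  apply: filterS key => x [C hC].
  have cs : cvgn (series (fun n => v n.+1 x - v n x)).
    apply: normed_cvg.
    apply: (@series_le_cvg _ _ (geometric C 2^-1)) => [n|n|n|] /=.
    - exact: normr_ge0.
    - by apply: le_trans (hC n).
    - by rewrite distrC; exact: hC.
    - by apply: is_cvg_geometric_series; rewrite ger0_norm; lra.
  have cvx : cvgn (fun n => v n x).
    have -> : (fun n => v n x) =
        (fun n => v 0%N x + series (fun n => v n.+1 x - v n x) n).
      by apply/funext => n; rewrite /series/= telescope_sumr// addrC subrK.
    by apply: is_cvgD => //; exact: is_cvg_cst.
  rewrite /z; move/cvg_ex: cvx => [l hl].
  have hlE : (v n x)%:E @[n --> \oo] --> l%:E by apply: cvg_EFin => //; exact: nearW.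
  rewrite is_cvg_limn_esupE; last by apply/cvg_ex; exists l%:E.
  by rewrite (cvg_lim _ hlE).
have iz n : (itg mu (fun x => (v n x - z x) ^+ 2)%R <= ((16^-1) ^+ n)%:E)%E.
  pose F m x := (((v n x - v (n + m)%N x) ^+ 2)%R)%:E : \bar R.
  have mF m : measurable_fun setT (F m).
    by apply/measurable_EFinP; apply: measurable_funX; exact: measurable_funB.
  have F0 m x : (0 <= F m x)%E by rewrite lee_fin sqr_ge0.
  have := fatou mu measurableT mF (fun m x _ => F0 m x).
  have -> : (\int[mu]_x limn_einf (F^~ x) = itg mu (fun x => (v n x - z x) ^+ 2)%R)%E.
    apply: ge0_ae_eq_integral => //.
    - rewrite /limn_einf; apply: measurableT_comp => //.
      apply: measurable_fun_limn_esup => m; exact: measurableT_comp.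
    - by apply/measurable_EFinP; apply: measurable_funX; exact: measurable_funB.
    - move=> x _; rewrite limn_einf_lim; apply: lime_ge; first exact: is_cvg_einfs.
      apply: nearW => k; apply: le_ereal_inf_tmp => _ [m _ <-]; exact: F0.
    - by move=> x _; rewrite lee_fin sqr_ge0.
    apply: filterS vz => x hx _.
    have : F m x @[m --> \oo] --> ((v n x - z x) ^+ 2)%:E.
      apply: cvg_EFin; first exact: nearW.
      rewrite /F /= (_ : _ \o _ = fun m => (v n x - v (n + m)%N x) ^+ 2)//.
      have h : (fun m => v n x - v (n + m)%N x) @ \oo --> v n x - z x.
        apply: cvgB; first exact: cvg_cst.
        by move: hx; rewrite -(cvg_shiftn n); under eq_fun do rewrite addnC.
      rewrite expr2; under eq_fun do rewrite expr2.
      exact: cvgM.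
    by move=> /cvg_limn_einf_sup [-> _].
  move=> /le_trans; apply.
  rewrite limn_einf_lim; apply: lime_le; first exact: is_cvg_einfs.
  apply: nearW => k; apply: ereal_inf_le; exists (\int[mu]_x F k x)%E; first by exists k => //=.
  have := cv n (n + k)%N (leq_addr _ _).
  rewrite -lee_fin ipE; last exact: hB.
  by [].
have hz : sqint mu z.
  have h0 : sqint mu (fun x => v 0%N x - z x).
    by split; [exact: measurable_funB|exact: le_lt_trans (iz 0%N) (ltry _)].
  have := hB _ _ (hv 0%N) h0; congr sqint; apply/funext => x; ring.
exists z; split => // n.
by rewrite -lee_fin ipE; [exact: iz|exact: hB].
Qed.

(** Stands in for Cauchy-Schwarz: if g has norm at most s > 0, then <f, g> <= s (|f|^2 + 1) / 2. *)
Lemma ip_amgm (s : R) f g : sqint mu f -> sqint mu g ->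
  2 * s * ip mu f g <= s ^+ 2 * ip mu f f + ip mu g g.
Proof.
move=> hf hg; have := ip_ge0 mu (fun x => s * f x + (-1) * g x).
by rewrite ip_sqD//; lra.
Qed.

(* The minimal-norm point of the closure of D separates D from 0. *)
Lemma sqint_projection D (c : R) : D !=set0 -> (forall f, D f -> sqint mu f) ->
  (forall f g t, D f -> D g -> 0 <= t <= 1 ->
     D (fun x => t * f x + (1 - t) * g x)) ->
  (forall f, D f -> c <= ip mu f f) ->
  exists z, sqint mu z /\ forall f, D f -> c <= ip mu z f.
Proof.
move=> [f0 Df0] sD cD Dc.
pose A := [set ip mu f f | f in D].
have A0 : A !=set0 by exists (ip mu f0 f0), f0.
have lA : has_lbound A by exists c => _ [f Df <-]; exact: Dc.
have hA : has_inf A by [].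
pose a := inf A.
have aD f : D f -> a <= ip mu f f by move=> Df; apply: ge_inf => //; exists f.
have ca : c <= a by apply: lb_le_inf => // _ [f Df <-]; exact: Dc.
(* The factor 4^-1 makes the parallelogram law give squared distances at most 16^-n. *)
have /choice[v hv] : forall n, exists f, D f /\ ip mu f f <= a + 4^-1 * (16^-1) ^+ n.
  move=> n; have e0 : 0 < 4^-1 * (16^-1 : R) ^+ n by rewrite mulr_gt0// exprn_gt0.
  by have [_ [f Df <-] /ltW hf] := inf_adherent e0 hA; exists f.
have sv n : sqint mu (v n) by apply: sD; case: (hv n).
have [|z [hz vz]] := sqint_complete sv.
  move=> n m nm; have [Dn hn] := hv n; have [Dm hm] := hv m.
  have half : 0 <= (2^-1 : R) <= 1 by apply/andP; split; lra.
  have := aD _ (cD _ _ _ Dn Dm half); rewrite ip_sqD// => h.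
  rewrite (_ : (fun x => v n x - v m x) = (fun x => 1 * v n x + (-1) * v m x)); last first.
    by apply/funext => x; ring.
  rewrite ip_sqD//.
  have : (16^-1 : R) ^+ m <= (16^-1) ^+ n by apply: ler_wiXn2l => //; lra.
  lra.
exists z; split => // f Df; apply: le_trans ca _.
have sf := sD _ Df.
set b := ip mu z f.
have f2 := ip_ge0 mu f.
have hb n : ip mu f (v n) <= b + (ip mu f f + 1) / 2 * (4^-1) ^+ n.
  have sy : sqint mu (fun x => 1 * v n x + (-1) * z x) by exact: sqintD.
  have := ip_amgm ((4^-1) ^+ n) sf sy.
  rewrite [X in _ <= _ + X](_ : _ = ip mu (fun x => v n x - z x) (fun x => v n x - z x)); last first.
    by congr (ip mu); apply/funext => x; ring.
  rewrite [ip mu f (fun _ => _)]ipC ipDl// (ipC _ (v n)) -/b.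
  have := vz n.
  have -> : (16^-1 : R) ^+ n = (4^-1) ^+ n * (4^-1) ^+ n.
    by rewrite -exprMn; congr (_ ^+ n); lra.
  rewrite expr2.
  have q0 : 0 < (4^-1 : R) ^+ n by exact: exprn_gt0.
  set q := (4^-1) ^+ n in q0 *; set X := ip mu (fun x => v n x - z x) _ => h1 h2.
  have : 2 * q * (1 * ip mu f (v n) + -1 * b) <= q * (q * ip mu f f + q) by nra.
  rewrite mulrAC [X in _ <= X]mulrC mulrC => h3.
  have : 2 * (1 * ip mu f (v n) + -1 * b) <= q * ip mu f f + q.
    by rewrite -(ler_pM2r q0); nra.
  lra.
(* Limit n -> oo of a <= |t f + (1 - t) v_n|^2, where |v_n|^2 tends to a and <f, v_n> is at most b
   in the limit. *)
have key t : 0 <= t <= 1 -> a * (2 * t - t ^+ 2) <= t ^+ 2 * ip mu f f + 2 * t * (1 - t) * b.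
  move=> t01; apply: (@ler_geometricP 4^-1 _ _ (ip mu f f + 2)); first by apply/andP; split; lra.
  move=> n; have [Dn hn] := hv n.
  have := aD _ (cD _ _ t Df Dn t01); rewrite ip_sqD//.
  have := hb n; move: t01 => /andP[t0 t1].
  have q0 : 0 < (4^-1 : R) ^+ n by exact: exprn_gt0.
  have : (16^-1 : R) ^+ n <= (4^-1) ^+ n.
    by apply: lerXn2r; rewrite ?nnegrE; lra.
  move: hn; set q := (4^-1) ^+ n in q0 *; set q' := (16^-1) ^+ n.
  set A2 := ip mu f f in f2 *; set B := ip mu f _; set C := ip mu _ _ => h1 h2 h3 h4.
  have : (1 - t) ^+ 2 * C <= (1 - t) ^+ 2 * a + q.
    have : (1 - t) ^+ 2 * C <= (1 - t) ^+ 2 * (a + 4^-1 * q').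
      by apply: ler_wpM2l => //; exact: sqr_ge0.
    have : (1 - t) ^+ 2 <= 1 by rewrite expr_le1// ; lra.
    have : 0 <= (1 - t) ^+ 2 by exact: sqr_ge0.
    nra.
  have : 2 * t * (1 - t) * B <= 2 * t * (1 - t) * b + (A2 + 1) * q.
    have t3 : 0 <= 2 * t * (1 - t) by rewrite mulr_ge0//; lra.
    have : 2 * t * (1 - t) * B <= 2 * t * (1 - t) * (b + (A2 + 1) / 2 * q).
      exact: ler_wpM2l.
    have : 2 * t * (1 - t) * ((A2 + 1) / 2 * q) <= 1 * ((A2 + 1) * q).
      have X0 : 0 <= (A2 + 1) * q by rewrite mulr_ge0//; lra.
      rewrite (_ : _ * _ = t * (1 - t) * ((A2 + 1) * q)); last by field.
      apply: ler_wpM2r => //; nra.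
    lra.
  lra.
(* First variation at the minimum: divide [key] by t and let t = 2^-n tend to 0. *)
have : 2 * a <= 2 * b.
  apply: (@ler_geometricP 2^-1 _ _ (`|ip mu f f + a - 2 * b|)); first by apply/andP; split; lra.
  move=> n; set t : R := 2^-1 ^+ n.
  have t0 : 0 < t by exact: exprn_gt0.
  have t1 : t <= 1 by apply: exprn_ile1; lra.
  have := key t; rewrite (ltW t0) t1 => /(_ isT) h.
  have : t * (2 * a) <= t * (2 * b + (ip mu f f + a - 2 * b) * t) by nra.
  rewrite ler_pM2l// => h2; apply: le_trans h2 _; rewrite lerD2l.
  by apply: ler_wpM2r; [exact: ltW|exact: ler_norm].
lra.
Qed.

End separation.

(** * Truncation, and separation of convex sets by a nonnegative weight *)

Section truncation.
Context {dsp : measure_display} {T : measurableType dsp} {R : realType}.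
Variable mu : {measure set T -> \bar R}.
Variable E : nat -> set T.
Implicit Types (f g u w : T -> R) (U G : set (T -> R)).

Definition exhaustion := [/\ forall n, measurable (E n),
  forall n, E n `<=` E n.+1, forall x, exists n, E n x
  & forall n, (mu (E n) < +oo)%E].

Hypothesis hE : exhaustion.

Definition trunc n u : T -> R := fun x => Num.min (u x) n%:R * \1_(E n) x.

Lemma nnfun_trunc n u : nnfun u -> nnfun (trunc n u).
Proof.
move=> nu; apply: nnfunM; first by apply: nnfun_min => //; exact: nnfun_cst.
by apply: nnfun_indic; case: hE.
Qed.

Lemma trunc_le n u x : nnfun u -> trunc n u x <= u x.
Proof.
move=> [_ u0]; rewrite /trunc indicE; case: (_ \in _) => /=; last by rewrite mulr0.
by rewrite mulr1 ge_min lexx.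
Qed.

Lemma sqint_bounded u (b : R) n : measurable_fun setT u ->
  (forall x, `|u x| <= b * \1_(E n) x) -> sqint mu u.
Proof.
move=> mu_ hu; split=> //.
have mEn : measurable (E n) by case: hE.
apply: (@le_lt_trans _ _ (itg mu (fun x => b ^+ 2 * \1_(E n) x))).
  apply: le_itg => [||x].
  - by split=> [|x]; [exact: measurable_funX|exact: sqr_ge0].
  - by apply: nnfunZ; [exact: sqr_ge0|exact: nnfun_indic].
  - have := hu x; rewrite indicE; case: (_ \in _) => /=.
      rewrite !mulr1 => h; rewrite -(real_normK (num_real (u x))).
      by apply: lerXn2r; rewrite ?nnegrE//; apply: le_trans h.
    by rewrite !mulr0 normr_le0 => /eqP ->; rewrite expr0n.
rewrite itgZ; [|exact: sqr_ge0|exact: nnfun_indic].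
by rewrite itg_indic// lte_mul_pinfty ?lee_fin ?sqr_ge0//; case: hE.
Qed.

Lemma sqint_trunc n u : nnfun u -> sqint mu (trunc n u).
Proof.
move=> nu; have [mt t0] := nnfun_trunc n nu.
apply: (@sqint_bounded _ n%:R n) => // x; rewrite ger0_norm//.
rewrite /trunc; apply: ler_wpM2r; first by rewrite indicE.
by rewrite ge_min lexx orbT.
Qed.

Lemma trunc_nd u : nnfun u -> forall x n, trunc n u x <= trunc n.+1 u x.
Proof.
move=> [_ u0] x n; rewrite /trunc; apply: ler_pM.
- by rewrite le_min u0 ler0n.
- by rewrite indicE.
- rewrite le_min !ge_min lexx /=; apply/orP; right.
  by rewrite ler_nat.
- rewrite !indicE ler_nat; case: (boolP (x \in E n)) => // /set_mem Ex.
  by rewrite mem_set//; case: hE => _ + _ _; apply.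
Qed.

Lemma trunc_cvg u : nnfun u -> forall x, trunc n u x @[n --> \oo] --> u x.
Proof.
move=> [_ u0] x; apply: cvg_near_cst.
have [_ hs hc _] := hE.
have [m Em] := hc x.
have hm k : E (m + k)%N x.
  by elim: k => [|k ih]; rewrite ?addn0// addnS; exact: hs.
exists (m + Num.truncn (u x)).+1%N => // n /= nn.
have En : E n x.
  have -> : n = (m + (n - m))%N by rewrite subnKC//; apply: leq_trans nn; rewrite leqW// leq_addr.
  exact: hm.
rewrite /trunc indicE mem_set//= mulr1; apply/min_idPl/ltW.
apply: lt_le_trans (truncnS_gt _) _; rewrite ler_nat.
by apply: leq_trans nn; rewrite ltnS leq_addl.
Qed.

Lemma itg_trunc_le u w (B : \bar R) : nnfun u -> nnfun w ->
  (forall n, (itg mu (fun x => trunc n u x * w x)%R <= B)%E) ->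
  (itg mu (fun x => u x * w x)%R <= B)%E.
Proof.
move=> nu nw h; apply: (@itg_lim_le _ _ _ mu (fun n x => trunc n u x * w x)) => //.
- by move=> n; apply: nnfunM => //; exact: nnfun_trunc.
- exact: nnfunM.
- by move=> x n; apply: ler_wpM2r; [case: nw|exact: trunc_nd].
- by move=> x; apply: cvgM; [exact: trunc_cvg|exact: cvg_cst].
Qed.

Lemma itg_ip f g : sqint mu f -> sqint mu g -> nnfun f -> nnfun g ->
  itg mu (fun x => f x * g x) = (ip mu f g)%:E.
Proof.
move=> sf sg nf ng; rewrite /ip fineK//; apply: itg_fin_num; first exact: nnfunM.
have /integrableP[_] := sqint_integrableM sf sg; congr (_ < _)%E.
apply: eq_integral => x _ /=; rewrite ger0_norm// mulr_ge0//; first by case: nf.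
by case: ng.
Qed.

Lemma le_ip f g h : sqint mu f -> sqint mu g -> sqint mu h ->
  forall k, sqint mu k -> (forall x, f x * g x <= h x * k x) -> ip mu f g <= ip mu h k.
Proof.
move=> sf sg sh k sk hk; apply: (@le_Rintegral _ _ _ mu setT) => //.
- exact: sqint_integrableM.
- exact: sqint_integrableM.
Qed.

(** The minimal-norm vector z of the closure of G - U separates the two sets. Since U is solid, u
    may be cut down to the set where z > 0, so the positive part W of z separates as well and is a
    weight. Members of U outside L^2 are reached by truncation. *)
Lemma convex_separation U G (c : R) : 0 < c ->
  U (fun=> 0) -> (forall u, U u -> nnfun u) ->
  (forall u u', U u -> nnfun u' -> (forall x, u' x <= u x) -> U u') ->
  (forall f g t, U f -> U g -> 0 <= t <= 1 -> U (fun x => t * f x + (1 - t) * g x)) ->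
  G !=set0 -> (forall g, G g -> nnfun g /\ sqint mu g) ->
  (forall f g t, G f -> G g -> 0 <= t <= 1 -> G (fun x => t * f x + (1 - t) * g x)) ->
  (forall g u, G g -> U u -> sqint mu u ->
     c <= ip mu (fun x => g x - u x) (fun x => g x - u x)) ->
  exists w, [/\ nnfun w, forall u, U u -> (itg mu (fun x => u x * w x)%R <= 1)%E
    & forall g, G g -> (1 < itg mu (fun x => g x * w x)%R)%E].
Proof.
move=> c0 U0 nU sU cU [g0 Gg0] sG cG hc.
pose D := [set (fun x => g x - u x) | g in G & u in [set u | U u /\ sqint mu u]].
have s0 : sqint mu (fun=> 0 : R).
  split; first exact: measurable_cst.
  by rewrite (_ : itg _ _ = 0%E) ?ltry//; rewrite -(itg0 mu); apply: itg_ext => x; rewrite expr0n.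
have sB f g : sqint mu f -> sqint mu g -> sqint mu (fun x => f x - g x).
  move=> hf hg; have := sqintD 1 (-1) hf hg; congr sqint.
  by apply/funext => x; rewrite mul1r mulN1r.
have [||||z [sz hz]] := @sqint_projection _ _ _ mu D c.
- by exists (fun x => g0 x - 0), g0 => //; exists (fun=> 0).
- by move=> _ [g Gg [u [Uu su] <-]]; apply: sB => //; case: (sG _ Gg).
- move=> _ _ t [g Gg [u [Uu su] <-]] [g' Gg' [u' [Uu' su'] <-]] t01.
  exists (fun x => t * g x + (1 - t) * g' x); first exact: cG.
  exists (fun x => t * u x + (1 - t) * u' x).
    by split; [exact: cU|exact: sqintD].
  by apply/funext => x; ring.
- by move=> _ [g Gg [u [Uu su] <-]]; exact: hc.
have mz : measurable_fun setT z by case: sz.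
pose W x := Num.max (z x) 0.
have nW : nnfun W by exact: nnfun_pos.
have sW : sqint mu W.
  split; first by case: nW.
  apply: le_lt_trans sz.2; apply: le_itg => [||x].
  - by split=> [|x]; [apply: measurable_funX; case: nW|exact: sqr_ge0].
  - by split=> [|x]; [exact: measurable_funX|exact: sqr_ge0].
  - by rewrite /W; case: (leP (z x) 0) => //; rewrite expr0n sqr_ge0.
have key g u : G g -> U u -> sqint mu u -> c + ip mu W u <= ip mu W g.
  move=> Gg Uu su; have [ng sg] := sG _ Gg; have nu := nU _ Uu.
  pose P := [set x | 0 < z x].
  have mP : measurable P.
    have -> : P = z @^-1` `]0, +oo[ by apply/seteqP; split => x /=; rewrite in_itv/= andbT.
    by rewrite -[_ @^-1` _]setTI; apply: mz => //; exact: measurable_itv.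
  (* On P the function z equals W; off P the term with u disappears and z g <= 0 = W g. *)
  pose u' x := u x * \1_P x.
  have nu' : nnfun u' by apply: nnfunM => //; exact: nnfun_indic.
  have u'u x : u' x <= u x.
    by rewrite /u' indicE; case: (_ \in _); rewrite ?mulr1// mulr0; case: nu.
  have Uu' : U u' by exact: sU Uu nu' u'u.
  have su' : sqint mu u'.
    split; first by case: nu'.
    apply: le_lt_trans su.2; apply: le_itg => [||x].
    - by split=> [|x]; [apply: measurable_funX; case: nu'|exact: sqr_ge0].
    - by split=> [|x]; [apply: measurable_funX; case: nu|exact: sqr_ge0].
    - by apply: lerXn2r; rewrite ?nnegrE//; [case: nu'|case: nu].
  have h1 : c <= ip mu z (fun x => g x - u' x).
    by apply: hz; exists g => //; exists u'.
  have h2 : ip mu z (fun x => g x - u' x) <= ip mu W (fun x => 1 * g x + (-1) * u x).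
    apply: le_ip => //; [exact: sB|exact: sqintD|].
    move=> x; rewrite /u' /W indicE; case: (ltP 0 (z x)) => zx.
      by rewrite mem_set//= mulr1; nra.
    rewrite memNset/=; last by rewrite /P/= ltNge zx.
    by rewrite mul0r mulr0 subr0; have := ng.2 x; nra.
  by move: h2; rewrite [X in _ <= X]ipC ipDl// !(ipC _ W); lra.
pose A := [set ip mu W u | u in [set u | U u /\ sqint mu u]].
have A0 : A !=set0 by exists (ip mu W (fun=> 0)), (fun=> 0).
have uA g : G g -> ubound A (ip mu W g - c).
  by move=> Gg _ [u [Uu su] <-]; have := key _ _ Gg Uu su; lra.
pose s := sup A.
have hs g : G g -> s <= ip mu W g - c by move=> Gg; apply: ge_sup => //; exact: uA.
have us u : U u -> sqint mu u -> ip mu W u <= s.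
  move=> Uu su; apply: ub_le_sup; last by exists u.
  by exists (ip mu W g0 - c); exact: uA.
have ge_s : 0 <= s.
  apply: le_trans (us _ U0 s0).
  by rewrite /ip (_ : itg _ _ = 0%E)// -(itg0 mu); apply: itg_ext => x; rewrite mulr0.
(* Pairings with W are at most s on U and at least s + c on G. Normalising at the midpoint keeps the
   inequality on G strict and avoids division by 0 when s = 0. *)
pose k := (s + c / 2)^-1.
have sc : 0 < s + c / 2 by rewrite ltr_wpDl// divr_gt0.
have k0 : 0 <= k by rewrite invr_ge0 ltW.
have E1 u : nnfun u -> sqint mu u -> itg mu (fun x => u x * (k * W x)) = (k * ip mu W u)%:E.
  move=> nu su; rewrite EFinM -itg_ip// -itgZ//; last exact: nnfunM.
  by apply: itg_ext => x; ring.
exists (fun x => k * W x); split; first exact: nnfunZ.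
- move=> u Uu; have nu := nU _ Uu; apply: itg_trunc_le => //; first exact: nnfunZ.
  move=> n; have nt := nnfun_trunc n nu; have st := sqint_trunc n nu.
  rewrite E1// lee_fin /k mulrC ler_pdivrMr// mul1r.
  apply: (@le_trans _ _ s); last by rewrite lerDl divr_ge0// ltW.
  by apply: us => //; apply: sU Uu nt _ => x; exact: trunc_le.
- move=> g Gg; have [ng sg] := sG _ Gg.
  rewrite E1// lte_fin /k mulrC ltr_pdivlMr// mul1r.
  by have := hs _ Gg; lra.
Qed.

End truncation.

(** * Inequalities for real powers *)

Section powers.
Context {R : realType}.
Implicit Types a b c p q r x y : R.

Lemma le_powR2 r a b : 0 <= r -> 0 <= a -> a <= b -> a `^ r <= b `^ r.
Proof.
move=> r0 a0 ab; apply: ge0_ler_powR => //; rewrite nnegrE//.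
exact: le_trans ab.
Qed.

Lemma powRK r a : r != 0 -> 0 <= a -> (a `^ r) `^ r^-1 = a.
Proof. by move=> r0 a0; rewrite -powRrM mulfV// powRr1. Qed.

Lemma powRVK r a : r != 0 -> 0 <= a -> (a `^ r^-1) `^ r = a.
Proof. by move=> r0 a0; rewrite -powRrM mulVf// powRr1. Qed.

Lemma powR_le_root r a b : 0 < r -> 0 <= a -> 0 <= b ->
  (a <= b `^ r^-1) = (a `^ r <= b).
Proof.
move=> r0 a0 b0; apply/idP/idP => h.
  rewrite -[leRHS](@powRVK r)// ?gt_eqF//; apply: le_powR2 => //; exact: ltW.
rewrite -[leLHS](@powRK r)// ?gt_eqF//; apply: le_powR2 => //.
  by rewrite invr_ge0 ltW.
exact: powR_ge0.
Qed.

Lemma powR_mul1B r a : 1 <= r -> 0 <= a -> a `^ r = a * a `^ (r - 1).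
Proof.
move=> r1 a0; have [->|a_neq0] := eqVneq a 0.
  by rewrite mul0r powR0// gt_eqF//; lra.
rewrite -[X in X * _]powRr1// -powRD; last by apply/implyP.
by congr (_ `^ _); lra.
Qed.

(** Write a^r = a a^(r-1) and use a^(r-1) <= (a + b)^(r-1). *)
Lemma powR_superadd r a b : 1 <= r -> 0 <= a -> 0 <= b ->
  a `^ r + b `^ r <= (a + b) `^ r.
Proof.
move=> r1 a0 b0; rewrite (powR_mul1B r1 a0) (powR_mul1B r1 b0).
rewrite (powR_mul1B r1 (addr_ge0 a0 b0)) mulrDl.
have r10 : 0 <= r - 1 by lra.
by apply: lerD; apply: ler_wpM2l => //; apply: le_powR2 => //; lra.
Qed.

Lemma powR_subadd r a b : 1 <= r -> 0 <= a -> 0 <= b ->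
  (a + b) `^ r^-1 <= a `^ r^-1 + b `^ r^-1.
Proof.
move=> r1 a0 b0; have r0 : r != 0 by rewrite gt_eqF//; lra.
have h := @powR_superadd r (a `^ r^-1) (b `^ r^-1) r1 (powR_ge0 _ _) (powR_ge0 _ _).
rewrite !powRVK// in h.
rewrite -[leRHS](@powRK r)// ?addr_ge0 ?powR_ge0//; apply: le_powR2 => //.
  by rewrite invr_ge0; lra.
exact: addr_ge0.
Qed.

(** Hölder continuity of t^(1/r): geometric convergence of functions becomes geometric convergence
    of their roots. *)
Lemma powR_root_dist r a b c : 1 <= r -> 0 <= a -> 0 <= b -> `|a - b| <= c ->
  `|a `^ r^-1 - b `^ r^-1| <= c `^ r^-1.
Proof.
have aux a' b' : 1 <= r -> 0 <= a' -> 0 <= b' -> `|a' - b'| <= c ->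
    a' `^ r^-1 <= b' `^ r^-1 + c `^ r^-1.
  move=> r1 a0 b0 h; have c0 : 0 <= c by exact: le_trans h.
  apply: le_trans (powR_subadd r1 b0 c0); apply: le_powR2 => //.
    by rewrite invr_ge0; lra.
  by have := ler_norm (a' - b'); lra.
move=> r1 a0 b0 h; rewrite ler_norml; apply/andP; split.
  by have := aux b a r1 b0 a0; rewrite distrC => /(_ h); lra.
by have := aux a b r1 a0 b0 h; lra.
Qed.

Lemma powR_div r a b : 0 <= a -> 0 < b -> (a / b) `^ r = a `^ r / b `^ r.
Proof.
move=> a0 b0; have br : b `^ r != 0 by rewrite gt_eqF// powR_gt0.
apply: (mulIf br); rewrite divfK// -powRM ?divr_ge0 ?(ltW b0)// divfK//.
by rewrite gt_eqF.
Qed.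

(** The tangent line at 1 of the concave function t^(r/p), taken at t = b^p; an instance of Young's
    inequality. *)
Lemma powR_interp r p b : 0 < r <= p -> 0 <= b ->
  b `^ r <= r / p * b `^ p + (1 - r / p).
Proof.
move=> /andP[r0 rp] b0; have p0 : 0 < p by exact: lt_le_trans rp.
(* For r = p the conjugate of the exponent p / r is infinite. *)
have [<-|rp'] := eqVneq r p; first by rewrite divff ?gt_eqF// mul1r subrr addr0.
have {rp rp'}rp : r < p by rewrite lt_neqAle rp'.
have t1 : r / p < 1 by rewrite ltr_pdivrMr// mul1r.
have t0 : 0 < r / p by exact: divr_gt0.
have := @conjugate_powR _ (b `^ r) 1 (r / p)^-1 (1 - r / p)^-1.
rewrite powR_ge0 ler01 !invr_gt0 t0 subr_gt0 t1 !invrK => /(_ isT isT isT isT).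
rewrite addrC subrK => /(_ erefl); rewrite mulr1 powR1 mul1r -powRrM invf_div.
have -> : r * (p / r) = p by rewrite mulrCA mulfV ?gt_eqF// mulr1.
by rewrite [X in _ <= X + _]mulrC.
Qed.

End powers.

(** * Cubes and their Lebesgue measure *)

Section cubes.
Context {R : realType} {d : nat}.
Implicit Types (a b : d.-tuple R) (l : R).

Lemma measurable_cube a l : measurable (cube a l).
Proof.
have -> : cube a l = \bigcap_(i in [set: 'I_d])
    ((fun x : d.-tuple R => tnth x i) @^-1` `[tnth a i, tnth a i + l[).
  apply/seteqP; split => x /= h i; first by move=> _ /=; rewrite in_itv/= h.
  by have := h i I; rewrite /= in_itv.
apply: fin_bigcap_measurable => // i _.
by rewrite -[_ @^-1` _]setTI; apply: measurable_tnth => //; exact: measurable_itv.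
Qed.

Variable mu : {measure set (d.-tuple R) -> \bar R}.
Hypothesis hmu : is_lebesgue mu.

Lemma mu_cube a l : 0 <= l -> mu (cube a l) = (l ^+ d)%:E.
Proof.
move=> l0; have -> : cube a l = box a [tuple tnth a i + l | i < d].
  by apply/seteqP; split => x /= h i; have := h i; rewrite tnth_mktuple.
rewrite hmu; last by move=> i; rewrite tnth_mktuple lerDl.
congr EFin; under eq_bigr => i _ do rewrite tnth_mktuple addrC addKr.
by rewrite prodr_const card_ord.
Qed.

Definition centred_cube (n : nat) : set (d.-tuple R) :=
  cube [tuple - n%:R | _ < d] (2 * n%:R).

Lemma exhaustion_centred_cube : exhaustion mu centred_cube.
Proof.
split.
- by move=> n; exact: measurable_cube.
- move=> n x h i; have := h i; rewrite !tnth_mktuple -[n.+1]addn1 natrD; lra.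
- move=> x.
  exists (\sum_(i < d) (Num.truncn `|tnth x i|).+1)%N => i; rewrite tnth_mktuple.
  have h : `|tnth x i| < (\sum_(i < d) (Num.truncn `|tnth x i|).+1)%N%:R.
    apply: lt_le_trans (truncnS_gt _) _; rewrite ler_nat.
    by rewrite (bigD1 i)//= leq_addr.
  move: h; rewrite ltr_norml; lra.
- by move=> n; rewrite mu_cube ?mulr_ge0// ltry.
Qed.

End cubes.

(** * Banach function spaces: the Fatou property and the r-concavification *)

Section bfs_theory.
Context {R : realType} {d : nat}.
Variables (mu : {measure set (d.-tuple R) -> \bar R}) (Xs : bfs mu).
Local Notation T := (d.-tuple R).
Implicit Types (f g h : T -> R).

Lemma bX_le f g : bX Xs f -> measurable_fun setT g ->
  (forall x, `|g x| <= `|f x|) -> bX Xs g /\ nrm Xs g <= nrm Xs f.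
Proof. by move=> Xf mg h; apply: X_ideal => //; exact: aeW. Qed.

Lemma bX_nnfun_le f g : bX Xs f -> nnfun g -> (forall x, g x <= f x) ->
  bX Xs g /\ nrm Xs g <= nrm Xs f.
Proof.
move=> Xf [mg g0] h; apply: bX_le => // x; rewrite ger0_norm//.
by apply: le_trans (h x) (ler_norm _).
Qed.

Lemma bX_norm f : bX Xs f ->
  bX Xs (fun x => `|f x|) /\ nrm Xs (fun x => `|f x|) = nrm Xs f.
Proof.
move=> Xf; have mf := X_meas Xf.
have [Xn n1] : bX Xs (fun x => `|f x|) /\ nrm Xs (fun x => `|f x|) <= nrm Xs f.
  by apply: bX_le => // [|x]; [exact: measurableT_comp|rewrite normr_id].
have [_ n2] : bX Xs f /\ nrm Xs f <= nrm Xs (fun x => `|f x|).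
  by apply: bX_le => // x; rewrite normr_id.
by split=> //; apply/eqP; rewrite eq_le n1.
Qed.

Lemma nrm_scale_ge0 (c : R) f : 0 <= c -> bX Xs f ->
  nrm Xs (fun x => c * f x) = c * nrm Xs f.
Proof. by move=> c0 Xf; rewrite nrm_scale// ger0_norm. Qed.

Lemma bX_sum (I : eqType) (s : seq I) (F : I -> T -> R) :
  (forall i, i \in s -> bX Xs (F i)) -> bX Xs (fun x => \sum_(i <- s) F i x).
Proof.
elim: s => [|i s ih] h.
  rewrite (_ : (fun _ => _) = (fun=> 0)); first exact: X_zero.
  by apply/funext => x; rewrite big_nil.
rewrite (_ : (fun _ => _) = F i \+ (fun x => \sum_(j <- s) F j x)).
  apply: X_add; first by apply: h; rewrite mem_head.
  by apply: ih => j js; apply: h; rewrite inE js orbT.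
by apply/funext => x; rewrite big_cons.
Qed.

Lemma nrm_indic_gt0 (A : set T) : measurable A -> (0 < mu A)%E ->
  bX Xs \1_A -> 0 < nrm Xs \1_A.
Proof.
move=> mA A0 XA; rewrite lt_neqAle nrm_ge0// andbT eq_sym; apply/eqP.
move=> /(nrm_eq0 XA) [N [mN N0 hN]].
suff : (mu A <= mu N)%E by rewrite N0 leNgt A0.
apply: le_measure; rewrite ?inE// => x Ax; apply: hN => /=.
by rewrite indicE mem_set//= => /eqP; rewrite oner_eq0.
Qed.

Hypothesis hF : fatou_prop Xs.

Lemma fatou_le (u : nat -> T -> R) f (B : R) : (forall n, bX Xs (u n)) ->
  measurable_fun setT f -> (forall x, 0 <= u 0%N x) ->
  (forall x n, u n x <= u n.+1 x) ->
  {ae mu, forall x, u n x @[n --> \oo] --> f x} ->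
  (forall n, nrm Xs (u n) <= B) -> bX Xs f /\ nrm Xs f <= B.
Proof.
move=> Xu mf u0 ndu uf uB.
have [] := @hF u f Xu mf.
- by apply: filterS uf => x h; split; [exact: u0|split=> [n|]; [exact: ndu|]].
- by exists B.
move=> Xf ->; split=> //; apply: ge_sup; first by exists (nrm Xs (u 0%N)), 0%N.
by move=> _ [n _ <-].
Qed.

(** The limit may a priori be infinite. If it were +oo on a set of positive measure, saturation
    would give P in that set with \1_P in X; as k \1_P is the increasing limit of min(u_n, k) \1_P,
    its norm would be at most B for every k. *)
Lemma fatou_ereal (u : nat -> T -> R) (F : T -> \bar R) (B : R) :
  (forall n, bX Xs (u n)) -> (forall x, 0 <= u 0%N x) ->
  (forall x n, u n x <= u n.+1 x) ->
  (forall x, (u n x)%:E @[n --> \oo] --> F x) ->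
  (forall n, nrm Xs (u n) <= B) ->
  [/\ {ae mu, forall x, F x \is a fin_num}, bX Xs (fine \o F)
    & nrm Xs (fine \o F) <= B].
Proof.
move=> Xu u0 ndu uF uB.
have un0 n x : 0 <= u n x by elim: n => // n ih; exact: le_trans (ndu _ _).
have mu_ n : measurable_fun setT (u n) by exact: X_meas.
have mF : measurable_fun setT F.
  by apply: emeasurable_fun_cvg => [n|x _]; [apply/measurable_EFinP; exact: mu_|exact: uF].
have F0 x : (0 <= F x)%E.
  rewrite -(cvg_lim _ (uF x))//; apply: lime_ge; first by apply/cvg_ex; eexists; exact: uF.
  by apply: nearW => n; rewrite lee_fin.
pose A := F @^-1` [set +oo%E].
have mA : measurable A by rewrite -[A]setTI; apply: mF => //; exact: measurable_set1.
have A0 : mu A = 0%E.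
  apply: contrapT => /eqP A0; have {}A0 : (0 < mu A)%E by rewrite lt_def A0 measure_ge0.
  have [P [mP PA P0 XP]] := X_saturation Xs mA A0.
  have hk k : k%:R * nrm Xs \1_P <= B.
    rewrite -nrm_scale_ge0//.
    have nv n : nnfun (fun x => Num.min (u n x) k%:R * \1_P x).
      by apply: nnfunM; [apply: nnfun_min => //; exact: nnfun_cst|exact: nnfun_indic].
    have hv n : bX Xs (fun x => Num.min (u n x) k%:R * \1_P x) /\
        nrm Xs (fun x => Num.min (u n x) k%:R * \1_P x) <= nrm Xs (u n).
      apply: bX_nnfun_le => // x; rewrite indicE; case: (_ \in _) => /=.
        by rewrite mulr1 ge_min lexx.
      by rewrite mulr0.
    apply: (@fatou_le (fun n x => Num.min (u n x) k%:R * \1_P x) _ B _ _ _ _ _ _).2.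
    - by move=> n; case: (hv n).
    - by apply: measurable_funM => //; case: (nnfun_indic (R := R) mP).
    - by move=> x; case: (nv 0%N).
    - move=> x n; apply: ler_wpM2r; first by rewrite indicE.
      by rewrite le_min !ge_min ndu lexx orbT.
    - apply: aeW => x; have [Px|Px] := pselect (P x); last first.
        rewrite indicE memNset//= mulr0; under eq_fun do rewrite mulr0.
        exact: cvg_cst.
      have := uF x; rewrite (PA _ Px) => /cvgeyPge /(_ k%:R) hx.
      apply: cvg_near_cst; apply: filterS hx => n; rewrite lee_fin => hx.
      by congr (_ * _); apply/min_idPr.
    - by move=> n; apply: le_trans (uB n); case: (hv n).
  have nP := nrm_indic_gt0 mP P0 XP.
  have := hk (Num.truncn (B / nrm Xs \1_P)).+1; rewrite leNgt -ltr_pdivrMr//.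
  by rewrite truncnS_gt.
have Ffin : {ae mu, forall x, F x \is a fin_num}.
  by exists A; split => // x /=; rewrite /A/=; have := F0 x; case: (F x).
suff [] : bX Xs (fine \o F) /\ nrm Xs (fine \o F) <= B by [].
apply: (@fatou_le u) => //.
- exact: (measurableT_comp (fine_measurable measurableT)).
- apply: filterS Ffin => x /= hx.
  by have := uF x; rewrite -(fineK hx) => /fine_cvg.
Qed.

(** The monotone Fatou property, applied to the lower envelopes inf_{m >= n} v_m. *)
Lemma fatou_cvg (v : nat -> T -> R) f (B : R) : (forall n, bX Xs (v n)) ->
  (forall n x, 0 <= v n x) -> measurable_fun setT f ->
  {ae mu, forall x, v n x @[n --> \oo] --> f x} ->
  (forall n, nrm Xs (v n) <= B) -> bX Xs f /\ nrm Xs f <= B.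
Proof.
move=> Xv v0 mf vf vB.
have lb x : has_lbound (range (v^~ x)) by exists 0 => _ [n _ <-].
have lbd x n : has_lbound (sdrop (v^~ x) n) by exists 0 => _ [m _ <-].
pose u n x := infs (v^~ x) n.
have uv n x : u n x <= v n x by apply: ge_inf => //; exists n => /=.
have u0 n x : 0 <= u n x.
  by apply: lb_le_inf; [exists (v n x), n => /=|move=> _ [m _ <-]].
have mu_ n : measurable_fun setT (u n).
  by apply: measurable_fun_infs => // m; exact: X_meas.
have hu n : bX Xs (u n) /\ nrm Xs (u n) <= nrm Xs (v n) by apply: bX_nnfun_le.
apply: (@fatou_le u) => //.
- by move=> n; case: (hu n).
- by move=> x n; apply: nondecreasing_infs.
- by apply: filterS vf => x; exact: cvg_infs.
- by move=> n; apply: le_trans (vB n); case: (hu n).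
Qed.

(** The solid convex hull of the |f|^r with f in the unit ball of X; it plays the role of the unit
    ball of the r-concavification. Combinations are finite so that [rconvex] applies. *)
Definition pow_hull (r : R) : set (T -> R) := [set u | nnfun u /\
  exists s : seq (R * (T -> R)), [/\
    forall p, p \in s -> [/\ 0 <= p.1, bX Xs p.2 & nrm Xs p.2 <= 1],
    \sum_(p <- s) p.1 <= 1
  & forall x, u x <= \sum_(p <- s) p.1 * `|p.2 x| `^ r]].

Lemma pow_hull0 r : pow_hull r (fun=> 0).
Proof.
by split; [exact: nnfun_cst|exists [::]; split; rewrite ?big_nil// => x; rewrite big_nil].
Qed.

Lemma pow_hull1 r f : bX Xs f -> nrm Xs f <= 1 -> pow_hull r (fun x => `|f x| `^ r).
Proof.
move=> Xf f1; split; first by apply: nnfun_pow; exact: (nnfun_norm (X_meas Xf)).1.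
exists [:: (1, f)]; split => [p| |x]; rewrite ?big_seq1 ?mul1r//.
by rewrite inE => /eqP ->.
Qed.

Lemma pow_hull_solid r u u' : pow_hull r u -> nnfun u' ->
  (forall x, u' x <= u x) -> pow_hull r u'.
Proof.
move=> [_ [s [h1 h2 h3]]] nu' uu'; split=> //; exists s; split=> // x.
exact: le_trans (uu' x) (h3 x).
Qed.

Lemma pow_hull_convex r f g (t : R) : pow_hull r f -> pow_hull r g ->
  0 <= t <= 1 -> pow_hull r (fun x => t * f x + (1 - t) * g x).
Proof.
move=> [nf [s [h1 h2 h3]]] [ng [s' [h1' h2' h3']]] /andP[t0 t1].
have t1' : 0 <= 1 - t by lra.
split; first by apply: nnfunD; exact: nnfunZ.
exists ([seq (t * p.1, p.2) | p <- s] ++ [seq ((1 - t) * p.1, p.2) | p <- s']).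
split => [p| |x].
- rewrite mem_cat => /orP[] /mapP[q qs ->] /=.
    by have [? ? ?] := h1 _ qs; split=> //; exact: mulr_ge0.
  by have [? ? ?] := h1' _ qs; split=> //; exact: mulr_ge0.
- rewrite big_cat !big_map/= -!mulr_sumr.
  have : t * \sum_(p <- s) p.1 <= t * 1 by exact: ler_wpM2l.
  have : (1 - t) * \sum_(p <- s') p.1 <= (1 - t) * 1 by exact: ler_wpM2l.
  lra.
- rewrite big_cat !big_map/=; apply: lerD.
    by under eq_bigr do rewrite -mulrA; rewrite -mulr_sumr; exact: ler_wpM2l.
  by under eq_bigr do rewrite -mulrA; rewrite -mulr_sumr; exact: ler_wpM2l.
Qed.

(** Jensen's inequality for t^(r/p): by homogeneity the sum S may be taken to be 1, and then the
    tangent-line bounds [powR_interp] add up. *)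
Lemma convex_sum_powR (s : seq (R * R)) r p : 0 < r <= p ->
  (forall c, c \in s -> 0 <= c.1 /\ 0 <= c.2) -> \sum_(c <- s) c.1 <= 1 ->
  \sum_(c <- s) c.1 * c.2 `^ r <= (\sum_(c <- s) c.1 * c.2 `^ p) `^ (r / p).
Proof.
move=> /andP[r0 rp] hs s1; have p0 : 0 < p by exact: lt_le_trans rp.
set S := \sum_(c <- s) c.1 * c.2 `^ p.
have S0 : 0 <= S.
  by rewrite /S big_seq; apply: sumr_ge0 => c cs; rewrite mulr_ge0 ?powR_ge0//; case: (hs _ cs).
have [S00|S00] := eqVneq S 0.
  rewrite S00 powR0 ?gt_eqF ?divr_gt0//.
  rewrite big_seq big1// => c cs.
  have [c1 c2] := hs _ cs.
  have : c.1 * c.2 `^ p <= S.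
    rewrite /S (big_rem c)//= lerDl big_seq; apply: sumr_ge0 => e /mem_rem es.
    by rewrite mulr_ge0 ?powR_ge0//; case: (hs _ es).
  rewrite S00 => h; have : c.1 * c.2 `^ p == 0 by rewrite eq_le h mulr_ge0// powR_ge0.
  rewrite mulf_eq0 => /orP[/eqP ->|]; first by rewrite mul0r.
  by rewrite powR_eq0 => /andP[/eqP -> _]; rewrite powR0 ?mulr0// gt_eqF.
pose L := S `^ p^-1.
have L0 : 0 < L by rewrite powR_gt0// lt_def S00.
have LS : L `^ p = S by rewrite powRVK// gt_eqF.
have -> : S `^ (r / p) = L `^ r by rewrite /L -powRrM mulrC.
suff: (\sum_(c <- s) c.1 * c.2 `^ r) / L `^ r <= 1.
  have Lr : 0 < L `^ r by exact: powR_gt0.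
  by move=> /(ler_wpM2r (ltW Lr)); rewrite mul1r divfK ?gt_eqF.
rewrite mulr_suml.
apply: (@le_trans _ _ (\sum_(c <- s) (r / p * (c.1 * c.2 `^ p / S) + (1 - r / p) * c.1))).
  rewrite big_seq [leRHS]big_seq; apply: ler_sum => c cs; have [c1 c2] := hs _ cs.
  have h : c.2 `^ r / L `^ r = (c.2 / L) `^ r by rewrite powR_div.
  have h' : c.2 `^ p / S = (c.2 / L) `^ p by rewrite powR_div// LS.
  rewrite -!mulrA h h'.
  have := @powR_interp _ r p (c.2 / L); rewrite r0 rp => /(_ isT) /(_ (divr_ge0 c2 (ltW L0))).
  move=> /(ler_wpM2l c1); rewrite !mulrA; lra.
rewrite big_split/= -!mulr_sumr -mulr_suml -/S divff// mulr1.
have : 0 <= 1 - r / p by rewrite subr_ge0 ler_pdivrMr// mul1r.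
move=> /ler_wpM2l /(_ _ _ s1); lra.
Qed.

(** With the coefficients absorbed into the functions as c^(1/r0), r0-convexity bounds (sum c
    |f|^r0)^(1/r0); Jensen's inequality covers every smaller r with the same constant. *)
Lemma rconvex_pow_hull r0 : 1 < r0 -> rconvex Xs r0 -> exists2 K : R, 0 <= K &
  forall r, 1 <= r <= r0 -> forall u, pow_hull r u ->
    bX Xs (fun x => u x `^ r^-1) /\ nrm Xs (fun x => u x `^ r^-1) <= K.
Proof.
move=> r01 [C hC]; exists `|C| => // r /andP[r1 rr0] u [nu [s [h1 h2 h3]]].
have r00 : r0 != 0 by rewrite gt_eqF//; lra.
pose t : seq (T -> R) := [seq (fun x => p.1 `^ r0^-1 * p.2 x) | p <- s].
have tX f : f \in t -> bX Xs f.
  by move=> /mapP[p ps ->]; apply: X_scale; case: (h1 _ ps).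
pose v x := (\sum_(f <- t) `|f x| `^ r0) `^ r0^-1.
have vE x : v x = (\sum_(p <- s) p.1 * `|p.2 x| `^ r0) `^ r0^-1.
  rewrite /v big_map big_seq [in RHS]big_seq; congr (_ `^ _); apply: eq_bigr => p ps.
  have [p0 _ _] := h1 _ ps.
  by rewrite normrM powRM// ger0_norm ?powR_ge0// powRVK.
have nv : nrm Xs v <= `|C|.
  apply: le_trans (hC _ tX) _; apply: le_trans (ler_norm _) _; rewrite normrM.
  rewrite ler_piMr// ger0_norm ?powR_ge0//.
  have -> : (1 : R) = 1 `^ r0^-1 by rewrite powR1.
  apply: le_powR2; first by rewrite invr_ge0; lra.
    by apply: sumr_ge0 => f _; exact: powR_ge0.
  rewrite big_map; apply: le_trans h2; rewrite big_seq [leRHS]big_seq.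
  apply: ler_sum => p ps; have [p0 Xp p1] := h1 _ ps.
  rewrite nrm_scale_ge0 ?powR_ge0// powRM ?powR_ge0// ?nrm_ge0// powRVK//.
  rewrite ler_piMr//; have -> : (1 : R) = 1 `^ r0 by rewrite powR1.
  by apply: le_powR2 => //; [lra|exact: nrm_ge0].
have nnv : nnfun v.
  apply: nnfun_pow; apply: (nnfun_sum _).1 => f ft; apply: nnfun_pow.
  exact: (nnfun_norm (X_meas (tX _ ft))).1.
(* [rconvex] only bounds the total function [nrm], which yields no membership; v lies in X because
   the l^r0 norm is at most the l^1 norm. *)
have Xv : bX Xs v.
  apply: (bX_nnfun_le (f := fun x => \sum_(f <- t) `|f x|) _ nnv _).1.
    by apply: bX_sum => f ft; case: (bX_norm (tX _ ft)).
  move=> x; rewrite /v -[leRHS](@powRK _ r0)//; last by apply: sumr_ge0.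
  apply: le_powR2; first by rewrite invr_ge0; lra.
    by apply: sumr_ge0 => f _; exact: powR_ge0.
  elim: t {tX v vE nv nnv} => [|f t ih]; first by rewrite !big_nil powR0.
  rewrite !big_cons; apply: le_trans (powR_superadd _ _ _) => //.
  - by rewrite lerD2l.
  - lra.
  - by apply: sumr_ge0.
have nu' : nnfun (fun x => u x `^ r^-1) by apply: nnfun_pow; case: nu.
have [|X1 X2] := bX_nnfun_le Xv nu'; last by split=> //; exact: le_trans X2 nv.
move=> x; rewrite vE.
apply: (@le_trans _ _ ((\sum_(p <- s) p.1 * `|p.2 x| `^ r) `^ r^-1)).
  by apply: le_powR2; [rewrite invr_ge0; lra|case: nu|exact: h3].
have -> : r0^-1 = r / r0 * r^-1 by rewrite mulrAC mulfV ?mul1r// gt_eqF//; lra.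
rewrite powRrM; apply: le_powR2; first by rewrite invr_ge0; lra.
  rewrite big_seq; apply: sumr_ge0 => p ps; rewrite mulr_ge0 ?powR_ge0//.
  by case: (h1 _ ps).
have := @convex_sum_powR [seq (p.1, `|p.2 x|) | p <- s] r r0; rewrite !big_map/=; apply.
- by apply/andP; split=> //; lra.
- by move=> _ /mapP[p ps ->] /=; split=> //; case: (h1 _ ps).
- exact: h2.
Qed.

End bfs_theory.

(** * Lorentz-Luxemburg duality for the r-concavification *)

Section lorentz_luxemburg.
Context {R : realType} {d : nat}.
Variables (mu : {measure set (d.-tuple R) -> \bar R}) (Xs : bfs mu).
Hypothesis hmu : is_lebesgue mu.
Hypothesis hF : fatou_prop Xs.
Local Notation T := (d.-tuple R).
Local Notation E := (@centred_cube R d).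
Implicit Types (f g h w : T -> R).

(* w has norm at most B in the Köthe dual of the r-concavification of X. *)
Definition pow_dual_le (r B : R) w := forall f, bX Xs f -> nrm Xs f <= 1 ->
  (itg mu (fun x => `|f x| `^ r * w x)%R <= B%:E)%E.

Lemma bounded_nnfun_sqint h (b : R) n : nnfun h -> (forall x, h x <= b * \1_(E n) x) ->
  sqint mu h.
Proof.
move=> [mh h0] hb; apply: (sqint_bounded (exhaustion_centred_cube hmu) mh (n := n) (b := b)).
by move=> x; rewrite ger0_norm.
Qed.

(** If h^r / B has positive L^2 distance from the hull, separation yields an admissible weight whose
    integral against h^r exceeds B, a contradiction. Otherwise hull elements approach it
    geometrically fast in L^2, hence almost everywhere, and the Fatou property passes their bound K
    to the limit. Boundedness and bounded support place h^r / B in L^2. *)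
Lemma lorentz_luxemburg (r K B : R) h n (b : R) : 1 <= r -> 0 < B ->
  (forall u, pow_hull Xs r u ->
     bX Xs (fun x => u x `^ r^-1) /\ nrm Xs (fun x => u x `^ r^-1) <= K) ->
  nnfun h -> (forall x, h x <= b * \1_(E n) x) ->
  (forall w, nnfun w -> pow_dual_le r 1 w ->
     (itg mu (fun x => h x `^ r * w x)%R <= B%:E)%E) ->
  bX Xs h /\ nrm Xs h <= B `^ r^-1 * K.
Proof.
move=> r1 B0 hK nh hb hw.
have r0 : r != 0 by rewrite gt_eqF//; lra.
have hE := exhaustion_centred_cube hmu.
pose h0 x := B^-1 * h x `^ r.
have nh0 : nnfun h0.
  by apply: nnfunZ; [rewrite invr_ge0 ltW|apply: nnfun_pow; case: nh].
have sh0 : sqint mu h0.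
  apply: (@bounded_nnfun_sqint _ (B^-1 * b `^ r) n) => // x.
  rewrite /h0 -mulrA; apply: ler_wpM2l; first by rewrite invr_ge0 ltW.
  have := hb x; rewrite indicE; case: (_ \in _) => /=; rewrite ?mulr1 ?mulr0 => hx.
    by apply: le_powR2 => //; [lra|case: nh].
  have -> : h x = 0 by apply/eqP; rewrite eq_le hx nh.2.
  by rewrite powR0.
have [[c [c0 hc]]|nc] := pselect (exists c, 0 < c /\ forall u, pow_hull Xs r u ->
    sqint mu u -> c <= ip mu (fun x => h0 x - u x) (fun x => h0 x - u x)).
  have [||||||||w [nw w1 w2]] := @convex_separation _ _ _ mu E hE (pow_hull Xs r) [set h0] c c0.
  - exact: pow_hull0.
  - by move=> u [].
  - by move=> u u'; exact: pow_hull_solid.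
  - by move=> f g t; exact: pow_hull_convex.
  - by exists h0.
  - by move=> _ ->.
  - by move=> _ _ t -> -> _ /=; apply/funext => x; ring.
  - by move=> _ u ->; exact: hc.
  have /(hw _ nw) : pow_dual_le r 1 w.
    by move=> f Xf f1; apply: w1; exact: pow_hull1.
  have := w2 _ erefl; rewrite (_ : itg _ _ = (B^-1%:E * itg mu (fun x => h x `^ r * w x)%R)%E).
    move=> h1 h2; exfalso; move: h1; rewrite ltNge => /negP; apply.
    apply: (@le_trans _ _ (B^-1%:E * B%:E)%E).
      by apply: lee_wpmul2l => //; rewrite lee_fin invr_ge0 ltW.
    by rewrite -EFinM mulVf ?gt_eqF.
  rewrite -itgZ ?invr_ge0 ?(ltW B0)//; last first.
    by apply: nnfunM => //; apply: nnfun_pow; case: nh.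
  by apply: itg_ext => x; rewrite /h0 mulrA.
have /choice[u hu] : forall m : nat, exists u, [/\ pow_hull Xs r u, sqint mu u &
    ip mu (fun x => h0 x - u x) (fun x => h0 x - u x) <= (16^-1) ^+ m].
  move=> m; apply: contrapT => hn; apply: nc; exists ((16^-1) ^+ m); split.
    exact: exprn_gt0.
  move=> u Uu su; rewrite leNgt; apply/negP => /ltW h1; apply: hn.
  by exists u.
have nu m : nnfun (u m) by have [[]] := hu m.
have key : {ae mu, forall x, exists C, forall m, `|h0 x - u m x| <= C * 2^-1 ^+ m}.
  apply: (@sqint_fast_decay _ _ _ mu (fun m x => `|h0 x - u m x|)) => m.
    by apply: nnfun_norm; apply: measurable_funB; [case: nh0|case: (nu m)].
  have [_ su] := hu m; rewrite -lee_fin ipE.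
    by congr (_ <= _)%E; apply: itg_ext => x; rewrite real_normK// num_real.
  have := sqintD 1 (-1) sh0 su; congr sqint; apply/funext => x; ring.
have [|||||X1 X2] := @fatou_cvg _ _ _ Xs hF (fun m x => u m x `^ r^-1) (fun x => h0 x `^ r^-1) K.
- by move=> m; have [/hK []] := hu m.
- by move=> m x; exact: powR_ge0.
- by apply: (nnfun_pow _ _).1; case: nh0.
- apply: filterS key => x [C hC].
  have C0 : 0 <= C by have := hC 0%N; rewrite expr0 mulr1; exact: le_trans.
  have dist m : `|h0 x `^ r^-1 - u m x `^ r^-1| <= C `^ r^-1 * (2^-1 `^ r^-1) ^+ m.
    have -> : C `^ r^-1 * (2^-1 `^ r^-1) ^+ m = (C * 2^-1 ^+ m) `^ r^-1.
      rewrite powRM ?exprn_ge0//; congr (_ * _).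
      elim: m => [|m ih]; first by rewrite !expr0 powR1.
      by rewrite !exprS powRM ?exprn_ge0// ih.
    by apply: powR_root_dist => //; [case: nh0|case: (nu m)].
  apply/cvgrPdist_lt => e e0.
  have : (fun m => C `^ r^-1 * (2^-1 `^ r^-1) ^+ m) @ \oo --> (0:R).
    apply: (@cvg_geometric _ (C `^ r^-1) (2^-1 `^ r^-1)).
    rewrite ger0_norm ?powR_ge0//.
    have : 2^-1 `^ r^-1 < 1 `^ r^-1 :> R.
      by apply: gt0_ltr_powR; rewrite ?nnegrE ?invr_gt0; lra.
    by rewrite powR1.
  move=> /cvgrPdist_lt /(_ _ e0); apply: filterS => m; rewrite sub0r normrN.
  by move=> h1; apply: le_lt_trans (dist m) _; apply: le_lt_trans h1; exact: ler_norm.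
- by move=> m; have [/hK []] := hu m.
have hE' : h = (fun x => B `^ r^-1 * h0 x `^ r^-1).
  apply/funext => x; rewrite /h0 powRM ?invr_ge0 ?(ltW B0) ?powR_ge0//.
  have hx0 : 0 <= h x by case: nh.
  by rewrite powRK// mulrA -powRM ?invr_ge0 ?(ltW B0)// mulfV ?gt_eqF// powR1 mul1r.
rewrite hE'; split; first exact: X_scale.
by rewrite nrm_scale_ge0 ?powR_ge0//; apply: ler_wpM2l => //; exact: powR_ge0.
Qed.

End lorentz_luxemburg.

(** * Averages over rational cubes and maximal operators over finite families *)

Section rational_cubes.
Context {R : realType} {d : nat}.
Variable mu : {measure set (d.-tuple R) -> \bar R}.
Hypothesis hmu : is_lebesgue mu.
Local Notation T := (d.-tuple R).
Local Notation Qi := (@Qidx d).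
Local Notation Qc := (@Qcube R d).
Implicit Types (f g h w : T -> R) (q : Qi).

Definition side q : R := ratr (sval q).2.
Definition vol q : R := side q ^+ d.

Lemma side_gt0 q : 0 < side q.
Proof. by rewrite /side ltr0q; exact: (svalP q). Qed.

Lemma vol_gt0 q : 0 < vol q.
Proof. by rewrite exprn_gt0// side_gt0. Qed.

Lemma vol_neq0 q : vol q != 0.
Proof. by rewrite gt_eqF// vol_gt0. Qed.

Lemma measurable_Qcube q : measurable (Qc q).
Proof. exact: measurable_cube. Qed.
Hint Resolve measurable_Qcube : core.

Lemma mu_Qcube q : mu (Qc q) = (vol q)%:E.
Proof. by rewrite mu_cube// ltW// side_gt0. Qed.

Lemma QcubeP q x : Qc q x <-> forall i,
  ratr (tnth (sval q).1 i) <= tnth x i < ratr (tnth (sval q).1 i) + side q.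
Proof. by split=> h i; have := h i; rewrite tnth_map. Qed.

(** Real-valued, hence 0 when the integral is infinite; it is the true average only where that
    integral is finite. *)
Definition mean q f : R := fine (itg mu (fun x => \1_(Qc q) x * f x)) / vol q.

Definition locint f := measurable_fun setT f /\
  forall q, (itg mu (fun x => \1_(Qc q) x * `|f x|)%R < +oo)%E.

Lemma nnfun_indicM q f : nnfun f -> nnfun (fun x => \1_(Qc q) x * f x).
Proof. by move=> nf; apply: nnfunM => //; exact: nnfun_indic. Qed.

Lemma mean_ge0 q f : nnfun f -> 0 <= mean q f.
Proof.
move=> nf; rewrite divr_ge0//; last exact/ltW/vol_gt0.
by apply: fine_ge0; apply: itg_ge0; exact: nnfun_indicM.
Qed.

Lemma itg_mean q f : nnfun f -> locint f ->
  itg mu (fun x => \1_(Qc q) x * f x) = (mean q f * vol q)%:E.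
Proof.
move=> nf lf; rewrite /mean divfK ?vol_neq0// fineK//.
apply: itg_fin_num; first exact: nnfun_indicM.
have := lf.2 q; congr (_ < _)%E; apply: itg_ext => x.
by rewrite ger0_norm//; case: nf.
Qed.

Lemma avg_Qcube q f : nnfun f -> locint f -> avg mu (Qc q) f = (mean q f)%:E.
Proof.
move=> nf lf; rewrite /avg itg_setE// mu_Qcube/= itg_mean// -EFinM.
by rewrite mulfK// vol_neq0.
Qed.

Lemma le_mean q f g : nnfun f -> nnfun g -> locint f -> locint g ->
  (forall x, Qc q x -> f x <= g x) -> mean q f <= mean q g.
Proof.
move=> nf ng lf lg h; rewrite -(ler_pM2r (vol_gt0 q)) -lee_fin -!itg_mean//.
apply: le_itg => [||x]; try exact: nnfun_indicM.
rewrite indicE; case: (boolP (_ \in _)) => [/set_mem/h|_] /=.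
  by rewrite !mul1r.
by rewrite !mul0r.
Qed.

Lemma locint_le f g : locint g -> measurable_fun setT f ->
  {ae mu, forall x, `|f x| <= `|g x|} -> locint f.
Proof.
move=> [mg lg] mf h; split=> // q; apply: le_lt_trans (lg q).
apply: ae_le_itg; try by apply: nnfun_indicM; exact: nnfun_norm.
by apply: filterS h => x; apply: ler_wpM2l; rewrite indicE.
Qed.

Lemma locint_norm f : locint f -> locint (fun x => `|f x|).
Proof.
move=> lf; apply: (locint_le lf); first by case: (nnfun_norm lf.1).
by apply: aeW => x; rewrite normr_id.
Qed.

Lemma locintD f g : locint f -> locint g -> locint (fun x => f x + g x).
Proof.
move=> [mf lf] [mg lg]; split=> [|q]; first exact: measurable_funD.
have nf := nnfun_norm mf; have ng := nnfun_norm mg.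
apply: (@le_lt_trans _ _ (itg mu (fun x => \1_(Qc q) x * `|f x| + \1_(Qc q) x * `|g x|)%R)).
  apply: le_itg => [||x].
  - by apply: nnfun_indicM; apply: nnfun_norm; exact: measurable_funD.
  - by apply: nnfunD; exact: nnfun_indicM.
  - by rewrite -mulrDr; apply: ler_wpM2l; [rewrite indicE|exact: ler_normD].
by rewrite itgD; [exact: lte_add_pinfty|exact: nnfun_indicM|exact: nnfun_indicM].
Qed.

Lemma locintZ (c : R) f : locint f -> locint (fun x => c * f x).
Proof.
move=> [mf lf]; split=> [|q]; first by apply: measurable_funM.
have nf := nnfun_norm mf.
rewrite (_ : itg _ _ = itg mu (fun x => `|c| * (\1_(Qc q) x * `|f x|))%R).
  by rewrite itgZ//; [rewrite lte_mul_pinfty ?lee_fin|exact: nnfun_indicM].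
by apply: itg_ext => x; rewrite normrM mulrCA.
Qed.

Lemma locint_bounded f (b : R) : measurable_fun setT f -> (forall x, `|f x| <= b) -> locint f.
Proof.
move=> mf fb; split=> // q; have nf := nnfun_norm mf.
apply: (@le_lt_trans _ _ (itg mu (fun x => b * \1_(Qc q) x))).
  apply: le_itg => [||x]; first exact: nnfun_indicM.
    apply: nnfunZ; last exact: nnfun_indic.
    by apply: le_trans (fb (nseq_tuple d 0)).
  by rewrite mulrC; apply: ler_wpM2r; [rewrite indicE|].
have b0 : 0 <= b by apply: le_trans (fb (nseq_tuple d 0)).
rewrite itgZ; [|exact: b0|exact: nnfun_indic].
by rewrite itg_indic// mu_Qcube ltry.
Qed.

Lemma meanD q f g : nnfun f -> nnfun g -> locint f -> locint g ->
  mean q (fun x => f x + g x) = mean q f + mean q g.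
Proof.
move=> nf ng lf lg; apply: (mulIf (vol_neq0 q)).
apply: EFin_inj; rewrite -itg_mean; [|exact: nnfunD|exact: locintD].
rewrite mulrDl EFinD -!itg_mean// -itgD; try exact: nnfun_indicM.
by apply: itg_ext => x; rewrite mulrDr.
Qed.

Lemma meanZ q (c : R) f : 0 <= c -> nnfun f -> locint f ->
  mean q (fun x => c * f x) = c * mean q f.
Proof.
move=> c0 nf lf; apply: (mulIf (vol_neq0 q)).
apply: EFin_inj; rewrite -itg_mean; [|exact: nnfunZ|exact: locintZ].
rewrite -mulrA EFinM -!itg_mean// -itgZ//; try exact: nnfun_indicM.
by apply: itg_ext => x; rewrite mulrCA.
Qed.

(** Nested duplicate-free lists exhausting the countable index type; limits along them replace
    suprema and sums over all rational cubes. *)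
Definition Qseq n : seq Qi := pmap (@pickle_inv Qi) (iota 0 n).

Lemma Qseq_uniq n : uniq (Qseq n).
Proof. by apply: (pmap_uniq (@pickle_invK Qi)); exact: iota_uniq. Qed.

Lemma QseqS n : Qseq n.+1 = Qseq n ++ seq_of_opt (pickle_inv n).
Proof.
by rewrite /Qseq -addn1 iotaD add0n pmap_cat.
Qed.

Lemma mem_Qseq q : exists N, forall n, (N <= n)%N -> q \in Qseq n.
Proof.
exists (pickle q).+1 => n hn; rewrite mem_pmap; apply/mapP; exists (pickle q).
  by rewrite mem_iota.
by rewrite pickleK_inv.
Qed.

Definition maxop (s : seq Qi) f x : R :=
  \big[Num.max/0]_(q <- s) (mean q (fun y => `|f y|) * \1_(Qc q) x).

Lemma nnfun_maxop s f : measurable_fun setT f -> nnfun (maxop s f).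
Proof.
move=> mf; apply: nnfun_bigmax => q _; apply: nnfunZ; last exact: nnfun_indic.
by apply: mean_ge0; exact: nnfun_norm.
Qed.

Lemma le_maxop s f q x : q \in s ->
  mean q (fun y => `|f y|) * \1_(Qc q) x <= maxop s f x.
Proof. move=> qs; rewrite /maxop.
exact: (@le_bigmax_seq _ _ _ _ _ _ xpredT
  (fun q => mean q (fun y => `|f y|) * \1_(Qc q) x) qs). Qed.

Lemma maxop_le s f x (c : R) : 0 <= c ->
  (forall q, q \in s -> mean q (fun y => `|f y|) * \1_(Qc q) x <= c) ->
  maxop s f x <= c.
Proof. by move=> c0 h; rewrite /maxop big_seq; apply: bigmax_le. Qed.

Lemma maxop_nd f x n : maxop (Qseq n) f x <= maxop (Qseq n.+1) f x.
Proof.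
apply: maxop_le => [|q qs]; first exact: bigmax_ge_id.
by apply: le_maxop; rewrite QseqS mem_cat qs.
Qed.

Lemma Qcube_is_cube q : is_cube (Qc q).
Proof. by eexists; eexists; split; last reflexivity; exact: side_gt0. Qed.

(** A rational side l' strictly between l and t l leaves room l' - l in each coordinate for a
    rational corner. *)
Lemma Qcube_approx (a : T) (l t : R) : 0 < l -> 1 < t ->
  exists q, cube a l `<=` Qc q /\ vol q <= (t * l) ^+ d.
Proof.
move=> l0 t1; have [|l' /andP[]] := @rat_in_itvoo R l (t * l).
  by rewrite -[ltLHS]mul1r ltr_pM2r.
rewrite !bnd_simp => ll' l'tl.
have /choice[b hb] : forall i : 'I_d, exists b : rat,
    tnth a i + l - ratr l' <= ratr b <= tnth a i.
  move=> i; have [|b /andP[]] := @rat_in_itvoo R (tnth a i + l - ratr l') (tnth a i).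
    by lra.
  by rewrite !bnd_simp => /ltW h1 /ltW h2; exists b; rewrite h1.
have l'0 : 0 < l' by rewrite -(ltr0q R); exact: lt_trans ll'.
exists (exist _ ([tuple b i | i < d], l') l'0); split.
  move=> x hx; apply/QcubeP => i /=; rewrite /side/= tnth_mktuple.
  by have := hx i; have := hb i; lra.
by apply: lerXn2r; rewrite ?nnegrE /side/=; lra.
Qed.

(** A cube of side l lies in a rational cube of volume at most (t l)^d for every t > 1, so its
    average is at most t^d times the supremum over rational cubes; then t -> 1. Terms with x outside
    the cube are 0, harmless for a nonnegative supremum. *)
Lemma HLmaxE f x : locint f ->
  HLmax mu f x = ereal_sup [set (mean q (fun y => `|f y|) * \1_(Qc q) x)%:E | q in setT].
Proof.
move=> lf; have nf := nnfun_norm lf.1; have ln := locint_norm lf.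
set S := ereal_sup _; apply/eqP; rewrite eq_le; apply/andP; split; last first.
  apply: ge_ereal_sup => _ [q _ <-].
  have [Qx|Qx] := pselect (Qc q x).
    apply: le_ereal_sup_tmp; exists (avg mu (Qc q) (fun y => `|f y|)).
      by exists (Qc q) => //; split=> //; exact: Qcube_is_cube.
    by rewrite avg_Qcube// indicE mem_set// mulr1.
  rewrite indicE memNset// mulr0.
  pose Q := cube x 1; apply: le_ereal_sup_tmp; exists (avg mu Q (fun y => `|f y|)).
    exists Q => //; split; first by exists x, 1.
    by move=> i; rewrite lexx ltrDl ltr01.
  by rewrite /avg mule_ge0 ?integral_ge0// lee_fin invr_ge0 fine_ge0.
apply: ge_ereal_sup => _ [_ [[a [l [l0 ->]]] Qx] <-].
have qS q : ((mean q (fun y => `|f y|) * \1_(Qc q) x)%:E <= S)%E.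
  by apply: ereal_sup_ubound; exists q.
have [q0 [Qq0 _]] := Qcube_approx a l0 (ltr1n R 2).
have S0 : (0 <= S)%E.
  apply: le_trans (qS q0); rewrite lee_fin mulr_ge0 ?mean_ge0// indicE//.
have [->|Sy] := eqVneq S +oo%E; first by rewrite leey.
have Sfin : S \is a fin_num by rewrite ge0_fin_numE// ltey.
rewrite /avg itg_setE; last exact: measurable_cube.
set J := itg _ _; rewrite mu_cube ?(ltW l0)//=.
have mQ := measurable_cube a l.
have nJ : nnfun (fun y => \1_(cube a l) y * `|f y|).
  by apply: nnfunM => //; exact: nnfun_indic.
have JQ q : cube a l `<=` Qc q -> (J <= (mean q (fun y => `|f y|) * vol q)%:E)%E.
  move=> hq; rewrite -itg_mean//; apply: le_itg => [||y]; [exact: nJ|exact: nnfun_indicM|].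
  apply: ler_wpM2r => //; rewrite !indicE ler_nat.
  by case: (boolP (y \in cube a l)) => // /set_mem /hq ?; rewrite mem_set.
have J0 : (0 <= J)%E by exact: itg_ge0.
have Jfin : J \is a fin_num.
  by rewrite ge0_fin_numE//; apply: le_lt_trans (JQ _ Qq0) _; rewrite ltry.
rewrite -(fineK Jfin) -(fineK Sfin) -EFinM lee_fin.
have ld0 : 0 < l ^+ d by exact: exprn_gt0.
rewrite ler_pdivrMr//.
have key t : 1 < t -> fine J <= fine S * (t * l) ^+ d.
  move=> t1; have [q [Qq vq]] := Qcube_approx a l0 t1.
  have := JQ _ Qq; rewrite -(fineK Jfin) lee_fin => /le_trans; apply.
  have := qS q; rewrite indicE mem_set ?mulr1; last exact: Qq.
  rewrite -(fineK Sfin) lee_fin => h.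
  apply: ler_pM => //; [exact: mean_ge0|exact/ltW/vol_gt0].
have cX k (u : nat -> R) (y : R) : u @ \oo --> y -> (fun n => u n ^+ k) @ \oo --> y ^+ k.
  move=> h; elim: k => [|k ih]; first by under eq_fun do rewrite expr0; exact: cvg_cst.
  by rewrite exprS; under eq_fun do rewrite exprS; exact: cvgM.
have c : (fun n => fine S * ((1 + 1 * 2^-1 ^+ n) * l) ^+ d) @ \oo --> fine S * ((1 + 0) * l) ^+ d.
  apply: cvgM; first exact: cvg_cst.
  apply: (cX d).
  apply: cvgM; last exact: cvg_cst.
  apply: cvgD; first exact: cvg_cst.
  by apply: (@cvg_geometric _ 1 2^-1); rewrite ger0_norm; lra.
move: c; rewrite addr0 mul1r => c; rewrite -(cvg_lim _ c)//.
apply: limr_ge; first by apply/cvg_ex; eexists; exact: c.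
apply: nearW => n; apply: key; rewrite ltrDl mul1r.
exact: exprn_gt0.
Qed.

Lemma maxop_cvg f x : locint f ->
  (maxop (Qseq n) f x)%:E @[n --> \oo] --> HLmax mu f x.
Proof.
move=> lf; have nf := nnfun_norm lf.1.
have := @ereal_nondecreasing_cvgn _ (fun n => (maxop (Qseq n) f x)%:E).
rewrite HLmaxE//; set A := ereal_sup _; set B := ereal_sup _.
suff -> : A = B.
  apply; apply/nondecreasing_seqP => n; rewrite lee_fin; exact: maxop_nd.
apply/eqP; rewrite eq_le; apply/andP; split; apply: ge_ereal_sup.
  move=> _ [n _ <-].
  have B0 : (0 <= B)%E.
    have [q [_ _]] := Qcube_approx x ltr01 (ltr1n R 2).
    apply: le_ereal_sup_tmp; exists (mean q (fun y => `|f y|) * \1_(Qc q) x)%:E; first by exists q.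
    by rewrite lee_fin mulr_ge0 ?mean_ge0// indicE.
  rewrite /maxop; elim/big_ind : _ => // [y z yB zB|q _].
    by rewrite EFin_max ge_max yB.
  by apply: ereal_sup_ubound; exists q.
move=> _ [q _ <-]; have [N hN] := mem_Qseq q.
apply: le_ereal_sup_tmp; exists (maxop (Qseq N) f x)%:E; first by exists N.
by rewrite lee_fin; apply: le_maxop; exact: hN.
Qed.

Lemma le_HLmax f q x : locint f -> HLmax mu f x \is a fin_num ->
  mean q (fun y => `|f y|) * \1_(Qc q) x <= fine (HLmax mu f x).
Proof.
move=> lf h; rewrite -lee_fin fineK// HLmaxE//; apply: ereal_sup_ubound.
by exists q.
Qed.

(** If |f| had infinite integral over Q, the maximal function would be +oo on all of Q, a set of
    positive measure. *)
Lemma HLmax_locint f : measurable_fun setT f ->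
  {ae mu, forall x, HLmax mu f x \is a fin_num} -> locint f.
Proof.
move=> mf [N [mN N0 hN]]; split=> // q.
have nf := nnfun_norm mf.
have [x [Qx Nx]] : exists x, Qc q x /\ ~ N x.
  apply: contrapT => hn.
  have : (mu (Qc q) <= mu N)%E.
    apply: le_measure; rewrite ?inE// => x Qx.
    by apply: contrapT => Nx; apply: hn; exists x.
  by rewrite N0 mu_Qcube lee_fin leNgt vol_gt0.
have hx : HLmax mu f x \is a fin_num by apply: contrapT => h; apply: Nx; exact: hN.
rewrite ltey; apply/eqP => h; move: hx.
have : (avg mu (Qc q) (fun y => `|f y|%R) <= HLmax mu f x)%E.
  by apply: ereal_sup_ubound; exists (Qc q) => //; split=> //; exact: Qcube_is_cube.
rewrite /avg itg_setE// h mu_Qcube gt0_mulye; last by rewrite lte_fin invr_gt0 vol_gt0.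
by rewrite leye_eq => /eqP ->.
Qed.

End rational_cubes.

(** * Hölder's inequality *)

Section holder.
Context {dsp : measure_display} {T : measurableType dsp} {R : realType}.
Variable mu : {measure set T -> \bar R}.

(** Young's inequality for g / a and k / b, which have mass 1. *)
Lemma itg_holder (p a b : R) (F g k : T -> R) : 1 < p ->
  nnfun F -> nnfun g -> nnfun k -> itg mu g = a%:E -> itg mu k = b%:E ->
  {ae mu, forall x, F x <= g x `^ p^-1 * k x `^ (1 - p^-1)} ->
  (itg mu F <= (a `^ p^-1 * b `^ (1 - p^-1))%:E)%E.
Proof.
move=> p1 nF ng nk ia ib h.
have p0 : 0 < p by lra.
have ip1 : p^-1 < 1 by rewrite invf_lt1.
have q0 : 0 < 1 - p^-1 by lra.
have a0 : 0 <= a by rewrite -lee_fin -ia; exact: itg_ge0.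
have b0 : 0 <= b by rewrite -lee_fin -ib; exact: itg_ge0.
have ipn : p^-1 != 0 by rewrite gt_eqF// invr_gt0.
have qn : 1 - p^-1 != 0 by rewrite gt_eqF.
have F0 : {ae mu, forall x, F x = 0} -> itg mu F = 0%E.
  by move=> hF; rewrite -(itg0 mu); apply: ae_eq_itg => //; exact: nnfun_cst.
(* A vanishing mass cannot be normalised; then g = 0, hence F = 0, almost everywhere. *)
have [az|an] := eqVneq a 0.
  rewrite F0 ?lee_fin ?mulr_ge0 ?powR_ge0//.
  have : {ae mu, forall x, g x = 0} by apply: itg_eq0; rewrite ?ia ?az.
  apply: filterS2 h => x hx gx; apply/eqP; rewrite eq_le nF.2 andbT.
  by apply: le_trans hx _; rewrite gx powR0// mul0r.
have [bz|bn] := eqVneq b 0.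
  rewrite F0 ?lee_fin ?mulr_ge0 ?powR_ge0//.
  have : {ae mu, forall x, k x = 0} by apply: itg_eq0; rewrite ?ib ?bz.
  apply: filterS2 h => x hx gx; apply/eqP; rewrite eq_le nF.2 andbT.
  by apply: le_trans hx _; rewrite gx powR0// mulr0.
have a1 : 0 < a by rewrite lt_def an.
have b1 : 0 < b by rewrite lt_def bn.
set c := a `^ p^-1 * b `^ (1 - p^-1).
have c0 : 0 <= c by rewrite mulr_ge0// powR_ge0.
apply: (@le_trans _ _ (itg mu (fun x => c * (p^-1 / a) * g x + c * ((1 - p^-1) / b) * k x))).
  apply: ae_le_itg => //.
    by apply: nnfunD; apply: nnfunZ => //; rewrite mulr_ge0// divr_ge0// ?invr_ge0 ltW.
  apply: filterS h => x /le_trans; apply.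
  have g0 := ng.2 x; have k0 := nk.2 x.
  have := @conjugate_powR _ ((g x / a) `^ p^-1) ((k x / b) `^ (1 - p^-1)) p (1 - p^-1)^-1.
  rewrite !powR_ge0 p0 invr_gt0 q0 invrK addrC subrK => /(_ isT isT isT isT erefl).
  rewrite powRVK ?gt_eqF ?divr_ge0 ?(ltW a1)//.
  rewrite powRK ?divr_ge0 ?(ltW b1)// => hy.
  have := ler_wpM2l c0 hy; rewrite powR_div// powR_div//.
  have ap := powR_gt0 p^-1 a1; have bp := powR_gt0 (1 - p^-1) b1.
  rewrite /c; move: (a `^ p^-1) (b `^ _) (g x `^ _) (k x `^ _) ap bp => A B G H ap bp.
  rewrite [X in X <= _](_ : _ = G * H); last by field; rewrite !gt_eqF.
  move=> /le_trans; apply; rewrite le_eqVlt; apply/orP; left; apply/eqP; field.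
  by rewrite !gt_eqF.
rewrite itgD; try by apply: nnfunZ => //; rewrite mulr_ge0// divr_ge0// ?invr_ge0 ltW.
rewrite !itgZ//; try by rewrite mulr_ge0// divr_ge0// ?invr_ge0 ltW.
rewrite ia ib -!EFinM -EFinD lee_fin le_eqVlt; apply/orP; left; apply/eqP; field.
by rewrite !gt_eqF.
Qed.

End holder.

(** * Pointwise l^r norms as limits of finite sums *)

Section lr_pointwise.
Context {R : realType} {d : nat}.
Local Notation T := (d.-tuple R).
Local Notation Qi := (@Qidx d).
Implicit Types (r : R) (m : Qi -> T -> R) (x : T).

Definition lr_part r m n x : R :=
  (\sum_(q <- @Qseq d n) `|m q x| `^ r) `^ r^-1.

Lemma lr_part_nd r m n x : 0 < r -> lr_part r m n x <= lr_part r m n.+1 x.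
Proof.
move=> r0; apply: le_powR2; first by rewrite invr_ge0 ltW.
  by apply: sumr_ge0 => q _; exact: powR_ge0.
rewrite QseqS big_cat/= lerDl; apply: sumr_ge0 => q _; exact: powR_ge0.
Qed.

(** Presents the unordered sum behind [lr_pt] as an increasing limit of real finite sums, the form
    in which the Fatou property applies. *)
Lemma lr_part_cvg r m x : 0 < r ->
  (lr_part r m n x)%:E @[n --> \oo] --> lr_pt r (fun q y => (m q y)%:E) x.
Proof.
move=> r0; have rn : r != 0 by rewrite gt_eqF.
have ir0 : 0 <= r^-1 by rewrite invr_ge0 ltW.
have := @ereal_nondecreasing_cvgn _ (fun n => (lr_part r m n x)%:E).
set y := ereal_sup _.
suff -> : y = lr_pt r (fun q y => (m q y)%:E) x.
  by apply; apply/nondecreasing_seqP => n; rewrite lee_fin; exact: lr_part_nd.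
pose a q : \bar R := (`|(m q x)%:E| `^ r)%E.
have a0 q : (0 <= a q)%E by exact: poweR_ge0.
have partE n : (lr_part r m n x)%:E = ((\sum_(q \in [set` @Qseq d n]) a q) `^ r^-1)%E.
  rewrite -fsbig_seq ?Qseq_uniq//= /lr_part -poweR_EFin -sumEFin.
  by congr (_ `^ _)%E; apply: eq_bigr => q _; rewrite /a/= poweR_EFin.
have part_ge0 n : (0 <= (lr_part r m n x)%:E)%E by rewrite lee_fin powR_ge0.
have y0 : (0 <= y)%E.
  by apply: le_trans (part_ge0 0%N) _; apply: ereal_sup_ubound; exists 0%N.
have in0 z : (0 <= z :> \bar R)%E -> z \in `[0%E, +oo%E].
  by move=> z0; rewrite in_itv/= z0 leey.
apply/eqP; rewrite eq_le; apply/andP; split.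
  apply: ge_ereal_sup => _ [n _ <-]; rewrite partE /lr_pt.
  apply: gt0_ler_poweR => //.
  - by apply: in0; rewrite -fsbig_seq ?Qseq_uniq//=; apply: sume_ge0.
  - by apply: in0; apply: esum_ge0 => q _; exact: a0.
  - apply: esum_ge; exists [set` @Qseq d n] => //.
    by split => //; exact: finite_seq.
have -> : y = ((y `^ r) `^ r^-1)%E by rewrite -poweRrM mulfV// poweRe1.
apply: gt0_ler_poweR => //.
- by apply: in0; apply: esum_ge0 => q _; exact: a0.
- by apply: in0; exact: poweR_ge0.
apply: ge_ereal_sup => _ [A [fA _] <-].
have [N hN] : exists N, A `<=` [set` @Qseq d N].
  have [s ->] := (finite_seqP _).1 fA.
  elim: s => [|q s [N hN]]; first by exists 0%N => q.
  have [M hM] := mem_Qseq q.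
  exists (maxn M N) => z /=; rewrite inE => /orP[/eqP ->|zs].
    by apply: hM; exact: leq_maxl.
  have /= := hN z zs; rewrite /Qseq !mem_pmap => /mapP[j jN ->].
  apply: map_f; move: jN; rewrite !mem_iota /= !add0n => /leq_trans; apply.
  exact: leq_maxr.
apply: (@le_trans _ _ (\sum_(q \in [set` @Qseq d N]) a q)%E).
  apply: lee_fsum_nneg_subset; [exact: fA|exact: finite_seq| |].
    by move=> q /set_mem /hN ?; apply/mem_set.
  by move=> q *; exact: a0.
have -> : (\sum_(q \in [set` @Qseq d N]) a q = ((lr_part r m N x)%:E `^ r))%E.
  rewrite partE -poweRrM mulVf// poweRe1//.
  by rewrite -fsbig_seq ?Qseq_uniq//=; apply: sume_ge0.
apply: gt0_ler_poweR; [exact: ltW|exact: in0|exact: in0|].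
by apply: ereal_sup_ubound; exists N.
Qed.

Lemma lr_part_le r m n x : 0 < r ->
  ((lr_part r m n x)%:E <= lr_pt r (fun q y => (m q y)%:E) x)%E.
Proof.
move=> r0; have h := @lr_part_cvg r m x r0; rewrite -(cvg_lim _ h)//.
apply: lime_ge; first by apply/cvg_ex; eexists; exact: h.
exists n => // k /= nk; rewrite lee_fin.
have /nondecreasing_seqP : forall n, lr_part r m n x <= lr_part r m n.+1 x.
  by move=> j; exact: lr_part_nd.
exact.
Qed.

Lemma le_lr_pt r m (m' : Qi -> T -> R) x : 0 < r -> (forall q, `|m q x| <= `|m' q x|) ->
  (lr_pt r (fun q y => (m q y)%:E) x <= lr_pt r (fun q y => (m' q y)%:E) x)%E.
Proof.
move=> r0 h; have e0 (M : Qi -> T -> R) :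
    (0 <= \esum_(q in [set: Qi]) (`|(M q x)%:E| `^ r))%E.
  by apply: esum_ge0 => q _; exact: poweR_ge0.
apply: gt0_ler_poweR; rewrite ?in_itv/= ?e0 ?leey//.
  by rewrite invr_ge0 ltW.
apply: le_esum => q _; rewrite lee_fin; apply: le_powR2 => //.
exact: ltW.
Qed.

Lemma measurable_lr_pt r m : 0 < r ->
  (forall q, measurable_fun setT (m q)) ->
  measurable_fun setT (lr_pt r (fun q y => (m q y)%:E)).
Proof.
move=> r0 mm.
apply: (@emeasurable_fun_cvg _ _ _ setT (fun n x => (lr_part r m n x)%:E)).
  move=> n; apply/measurable_EFinP; apply: (nnfun_pow _ _).1.
  apply: (nnfun_sum _).1 => q _; apply: nnfun_pow.
  exact: (nnfun_norm (mm q)).1.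
by move=> x _; exact: lr_part_cvg.
Qed.

Lemma le_lr_pt1 r m q x : 0 < r -> lr_pt r (fun q y => (m q y)%:E) x \is a fin_num ->
  `|m q x| <= fine (lr_pt r (fun q y => (m q y)%:E) x).
Proof.
move=> r0 fx; have [N hN] := mem_Qseq q.
have := @lr_part_le r m N x r0; rewrite -(fineK fx) lee_fin; apply: le_trans.
rewrite /lr_part powR_le_root//; last by apply: sumr_ge0 => p _; exact: powR_ge0.
rewrite (big_rem q (hN _ (leqnn _)))//= lerDl; apply: sumr_ge0 => p _; exact: powR_ge0.
Qed.

End lr_pointwise.

(** * The Köthe dual *)

Section kothe_dual.
Context {R : realType} {d : nat}.
Variables (mu : {measure set (d.-tuple R) -> \bar R}) (Xs : bfs mu).
Hypothesis hmu : is_lebesgue mu.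
Local Notation T := (d.-tuple R).
Local Notation Qi := (@Qidx d).
Local Notation Qc := (@Qcube R d).
Implicit Types (f g h w : T -> R) (q : Qi).

(** Makes the set of test functions in [kdual_sup] nonempty; over the empty set the supremum would
    be -oo. *)
Lemma exists_unit_vector : exists f, bX Xs f /\ nrm Xs f = 1.
Proof.
have : (0 < mu setT)%E.
  apply: (@lt_le_trans _ _ (mu (cube (nseq_tuple d 0) 1))).
    by rewrite mu_cube// expr1n.
  by apply: le_measure; rewrite ?inE//; exact: measurable_cube.
move=> /(X_saturation Xs measurableT) [P [mP _ P0 XP]].
have nP := nrm_indic_gt0 mP P0 XP.
exists (fun x => (nrm Xs \1_P)^-1 * \1_P x); split; first exact: X_scale.
by rewrite nrm_scale_ge0 ?invr_ge0 ?ltW// mulVf// gt_eqF.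
Qed.

Lemma kdual_sup_ge0 g : (0 <= kdual_sup Xs g)%E.
Proof.
have [f hf] := exists_unit_vector.
apply: le_ereal_sup_tmp; exists (\int[mu]_x (`|f x * g x|)%:E)%E; first by exists f.
by apply: integral_ge0 => x _; rewrite lee_fin.
Qed.

Lemma kdual_nrm_ge0 g : 0 <= kdual_nrm Xs g.
Proof. exact: fine_ge0 (kdual_sup_ge0 g). Qed.

Lemma kdual_pairing f g : bX Xs f -> kdual_set Xs g ->
  (itg mu (fun x => `|f x| * `|g x|)%R <= (nrm Xs f * kdual_nrm Xs g)%:E)%E.
Proof.
move=> Xf [mg hg]; have mf := X_meas Xf.
have nf := nnfun_norm mf; have ng := nnfun_norm mg.
have n0 := nrm_ge0 Xf.
have [nz|nn] := eqVneq (nrm Xs f) 0.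
  rewrite nz mul0r; apply: (@le_trans _ _ (itg mu (fun=> 0))); last by rewrite itg0.
  apply: ae_le_itg; [exact: nnfunM|exact: nnfun_cst|].
  by have := (nrm_eq0 Xf).1 nz; apply: filterS => x ->; rewrite normr0 mul0r.
pose c := nrm Xs f; have c0 : 0 < c by rewrite lt_def nn.
have : (itg mu (fun x => `|c^-1 * f x * g x|)%R <= kdual_sup Xs g)%E.
  apply: ereal_sup_ubound; exists (fun x => c^-1 * f x) => //; split; first exact: X_scale.
  by rewrite nrm_scale_ge0 ?invr_ge0 ?ltW// mulVf// gt_eqF.
have kfin : kdual_sup Xs g \is a fin_num by rewrite ge0_fin_numE// kdual_sup_ge0.
rewrite -(fineK kfin) -/(kdual_nrm Xs g) => h.
rewrite (_ : itg _ _ = (c%:E * itg mu (fun x => `|c^-1 * f x * g x|)%R)%E).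
  by rewrite EFinM; apply: lee_wpmul2l => //; rewrite lee_fin ltW.
rewrite -itgZ ?(ltW c0)//; last first.
  by apply: nnfun_norm; apply: measurable_funM => //; exact: measurable_funM.
by apply: itg_ext => x; rewrite !normrM gtr0_norm ?invr_gt0// !mulrA mulfV ?mul1r//.
Qed.

(** For r = 1 the dual ball of the concavification consists of nonnegative elements of the unit ball
    of X'. *)
Lemma pow_dual_kdual w : nnfun w -> pow_dual_le Xs 1 1 w ->
  kdual_set Xs w /\ kdual_nrm Xs w <= 1.
Proof.
move=> nw hw; have h : (kdual_sup Xs w <= 1)%E.
  apply: ge_ereal_sup => _ [f [Xf f1] <-].
  have := hw _ Xf; rewrite f1 lexx => /(_ isT); congr (_ <= _)%E.
  apply: eq_integral => x _; congr EFin; rewrite powRr1// normrM.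
  by rewrite [`|w x|]ger0_norm// nw.2.
have kfin : kdual_sup Xs w \is a fin_num.
  by rewrite ge0_fin_numE ?kdual_sup_ge0//; apply: le_lt_trans h _; rewrite ltry.
split; first by split; [case: nw|apply: le_lt_trans h _; rewrite ltry].
by rewrite -lee_fin fineK.
Qed.

Lemma Qcube_centred (s : seq Qi) : exists n, forall q, q \in s ->
  Qc q `<=` centred_cube (R := R) (d := d) n.
Proof.
elim: s => [|q s [n hn]]; first by exists 0%N.
pose m := (\sum_(i < d) (Num.truncn `|ratr (tnth (sval q).1 i) : R|).+1
           + (Num.truncn (side q : R)).+1 + n)%N.
exists m => p; rewrite inE => /orP[/eqP ->|ps].
  move=> x /QcubeP hx i; rewrite tnth_mktuple; have := hx i.
  set a := ratr _.
  have h1 : `|a| < (\sum_(i < d) (Num.truncn `|ratr (tnth (sval q).1 i) : R|).+1)%N%:R.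
    apply: lt_le_trans (truncnS_gt _) _; rewrite ler_nat.
    by rewrite (bigD1 i)//= leq_addr.
  have h2 : (side q : R) < ((Num.truncn (side q : R)).+1)%:R by exact: truncnS_gt.
  have h3 : 0 <= n%:R :> R by exact: ler0n.
  by move: h1; rewrite /m !natrD ltr_norml; lra.
move=> x /(hn _ ps) hx i; have := hx i; rewrite !tnth_mktuple.
have : n%:R <= m%:R :> R by rewrite ler_nat leq_addl.
lra.
Qed.

(** Self-adjointness of f |-> <f>_Q 1_Q: both sides equal <f>_Q <w>_Q |Q|. *)
Lemma itg_mean_swap q f w : nnfun f -> nnfun w -> locint mu f -> locint mu w ->
  itg mu (fun x => (mean mu q f * \1_(Qc q) x) * w x)
  = itg mu (fun x => f x * (mean mu q w * \1_(Qc q) x)).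
Proof.
move=> nf nw lf lw.
rewrite (@itg_ext _ _ _ mu _ (fun x => mean mu q f * (\1_(Qc q) x * w x))); last first.
  by move=> x; rewrite mulrA.
rewrite [RHS](@itg_ext _ _ _ mu _ (fun x => mean mu q w * (\1_(Qc q) x * f x))); last first.
  by move=> x; rewrite mulrC mulrA.
rewrite !itgZ ?mean_ge0//; try exact: nnfun_indicM.
by rewrite !itg_mean// -!EFinM; congr EFin; ring.
Qed.

Lemma sum_indic_bounded (s : seq Qi) (m : Qi -> R) : (forall q, 0 <= m q) ->
  exists n b, forall x, \sum_(q <- s) m q * \1_(Qc q) x
                        <= b * \1_(centred_cube (R := R) (d := d) n) x.
Proof.
move=> m0; have [n hn] := Qcube_centred s.
exists n, (\sum_(q <- s) m q) => x; rewrite mulr_suml big_seq [leRHS]big_seq.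
apply: ler_sum => q qs; apply: ler_wpM2l => //; rewrite !indicE ler_nat.
by case: (boolP (x \in Qc q)) => // /set_mem /(hn _ qs) ?; rewrite mem_set.
Qed.

End kothe_dual.

(** * From M on X and X' to the vector-valued bound *)

Section maximal_bounds_imply_vector_bound.
Context {R : realType} {d : nat}.
Variables (mu : {measure set (d.-tuple R) -> \bar R}) (Xs : bfs mu).
Hypothesis hmu : is_lebesgue mu.
Hypothesis hF : fatou_prop Xs.
Local Notation T := (d.-tuple R).
Local Notation Qi := (@Qidx d).
Local Notation Qc := (@Qcube R d).
Variables (r0 : R).
Hypothesis r01 : 1 < r0.
Hypothesis hconv : rconvex Xs r0.
Hypothesis hM : bounded_on mu (bX Xs) (nrm Xs) (HLmax mu).
Hypothesis hM' : bounded_on mu (kdual_set Xs) (kdual_nrm Xs) (HLmax mu).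
Implicit Types (f g h w : T -> R) (q : Qi).

Lemma bX_locint f : bX Xs f -> locint mu f.
Proof.
move=> Xf; have [C hC] := hM; have [h _ _] := hC _ Xf.
by apply: HLmax_locint => //; exact: (X_meas Xf).
Qed.

Lemma kdual_locint g : kdual_set Xs g -> locint mu g.
Proof.
move=> Xg; have [C hC] := hM'; have [h _ _] := hC _ Xg.
by apply: HLmax_locint => //; case: Xg.
Qed.

(** Against w in the unit ball of X', self-adjointness moves the averages onto w: the pairing
    becomes the sum of the integrals of g_q <w>_q 1_q, at most the integral of G M w. Hence A = |C|
    K, with C from M on X' and K from the duality lemma. *)
Lemma l1_vector_bound : exists2 A : R, 0 <= A & forall (s : seq Qi) (g : Qi -> T -> R) G,
  (forall q, nnfun (g q)) -> nnfun G -> bX Xs G ->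
  (forall x, \sum_(q <- s) g q x <= G x) -> uniq s ->
  let h := fun x => \sum_(q <- s) mean mu q (g q) * \1_(Qc q) x in
  bX Xs h /\ nrm Xs h <= A * nrm Xs G.
Proof.
have [K K0 hK] := rconvex_pow_hull r01 hconv.
have [C hC] := hM'.
exists (`|C| * K); first by rewrite mulr_ge0.
move=> s g G ng nG XG sG us h.
have lG := bX_locint XG.
have gG q x : q \in s -> g q x <= G x.
  move=> qs; apply: le_trans (sG x); rewrite (big_rem q)//= lerDl.
  by apply: sumr_ge0 => p _; case: (ng p).
have lg q : q \in s -> locint mu (g q).
  move=> qs; apply: (locint_le lG); first by case: (ng q).
  by apply: aeW => x; rewrite !ger0_norm ?gG//; [exact: nG.2|exact: (ng q).2].
have nh1 q : nnfun (fun x => mean mu q (g q) * \1_(Qc q) x).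
  apply: nnfunZ; first exact: mean_ge0.
  by apply: nnfun_indic; exact: measurable_Qcube.
have nh : nnfun h by apply: nnfun_sum => q _.
have [n [b hb]] := @sum_indic_bounded R d s (fun q => mean mu q (g q)) (fun q => mean_ge0 mu q (ng q)).
have nG0 := nrm_ge0 XG.
(* The duality lemma needs a positive bound, while |C| times the norm of G may be 0. *)
have key e : 0 < e -> bX Xs h /\ nrm Xs h <= (`|C| * nrm Xs G + e) * K.
  move=> e0; have B0 : 0 < `|C| * nrm Xs G + e by rewrite ltr_wpDl// mulr_ge0.
  have := @lorentz_luxemburg _ _ mu Xs hmu hF 1 K _ h n b (lexx 1) B0.
  rewrite invr1 powRr1 ?(ltW B0)//; apply => //.
    by move=> u hu; have := hK 1; rewrite lexx (ltW r01) => /(_ isT u hu); rewrite invr1.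
  move=> w nw hw; have [Xw w1] := pow_dual_kdual hmu nw hw.
  have lw := kdual_locint Xw.
  have [Mfin XM nM] := hC _ Xw.
  pose Mw := fine \o HLmax mu w.
  apply: (@le_trans _ _ (itg mu (fun x => `|G x| * `|Mw x|)%R)); last first.
    apply: le_trans (kdual_pairing hmu XG XM) _; rewrite lee_fin.
    apply: (@le_trans _ _ (`|C| * nrm Xs G)); last by rewrite lerDl ltW.
    rewrite mulrC; apply: ler_wpM2r => //; apply: le_trans nM _.
    apply: le_trans (ler_norm _) _; rewrite normrM ler_piMr// ger0_norm//.
    exact: kdual_nrm_ge0.
  rewrite (@itg_ext _ _ _ mu _ (fun x => \sum_(q <- s) (mean mu q (g q) * \1_(Qc q) x) * w x)); last first.
    by move=> x; rewrite powRr1 ?nh.2// /h mulr_suml.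
  rewrite itg_sum; last by move=> q _; apply: nnfunM.
  rewrite big_seq (eq_bigr (fun q => itg mu (fun x => g q x * (mean mu q w * \1_(Qc q) x)))); last first.
    by move=> q qs; apply: itg_mean_swap => //; exact: lg.
  have nk q : nnfun (fun x => g q x * (mean mu q w * \1_(Qc q) x)).
    apply: nnfunM => //; apply: nnfunZ; first exact: mean_ge0.
    by apply: nnfun_indic; exact: measurable_Qcube.
  rewrite -big_seq -itg_sum//.
  apply: ae_le_itg; first by apply: nnfun_sum.
    by apply: nnfunM; apply: nnfun_norm; [case: nG|case: XM].
  apply: filterS Mfin => x hx.
  apply: (@le_trans _ _ (\sum_(q <- s) g q x * Mw x)).
    apply: ler_sum => q _; apply: ler_wpM2l; first exact: (ng q).2.
    have := @le_HLmax _ _ mu hmu w q x lw hx.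
    by rewrite (_ : (fun y => `|w y|) = w)//; apply/funext => y; rewrite ger0_norm// nw.2.
  rewrite -mulr_suml; apply: le_trans (ler_norm _) _; rewrite normrM.
  apply: ler_wpM2r => //; rewrite ger0_norm ?ger0_norm ?nG.2//.
  by apply: sumr_ge0 => q _; exact: (ng q).2.
split; first by case: (key 1 ltr01).
apply/ler_addgt0Pl => e e0; have e1 : 0 < e / (K + 1) by rewrite divr_gt0//; lra.
have [_ /le_trans] := key _ e1; apply.
rewrite mulrDl mulrAC addrC lerD2r mulrAC ler_pdivrMr; last by lra.
by rewrite ler_wpM2l ?ltW//; lra.
Qed.

Lemma mean_holder q (r : R) F g k : 1 < r -> nnfun F -> nnfun g -> nnfun k ->
  locint mu F -> locint mu g -> locint mu k ->
  {ae mu, forall x, F x <= g x `^ r^-1 * k x `^ (1 - r^-1)} ->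
  mean mu q F <= mean mu q g `^ r^-1 * mean mu q k `^ (1 - r^-1).
Proof.
move=> r1 nF ng nk lF lg lk h.
have v0 := @vol_gt0 R d q.
rewrite -(ler_pM2r v0) -lee_fin -itg_mean//.
have := @itg_holder _ _ _ mu r _ _ _ _ _ r1 (nnfun_indicM q nF) (nnfun_indicM q ng)
   (nnfun_indicM q nk) (itg_mean q ng lg) (itg_mean q nk lk).
have -> : (mean mu q g * vol q) `^ r^-1 * (mean mu q k * vol q) `^ (1 - r^-1) =
    mean mu q g `^ r^-1 * mean mu q k `^ (1 - r^-1) * vol q.
  rewrite (powRM _ (mean_ge0 mu q ng) (ltW v0)) (powRM _ (mean_ge0 mu q nk) (ltW v0)).
  rewrite mulrACA -powRD; last by apply/implyP => _; rewrite gt_eqF.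
  by rewrite [r^-1 + _]addrC subrK powRr1// ltW.
apply.
apply: filterS h => x hx; rewrite indicE; case: (_ \in _) => /=.
  by rewrite !mul1r.
by rewrite !mul0r mulr_ge0// powR_ge0.
Qed.

Lemma vector_maximal_bound : Mcal_bounded Xs r0.
Proof.
have [A A0 hA] := l1_vector_bound; have [C hC] := hM.
have r00 : 0 < r0 by exact: lt_trans r01.
have r10 : 0 <= r0 - 1 by rewrite subr_ge0 ltW.
have rn : r0 != 0 by rewrite gt_eqF.
exists (A + `|C|) => F [mF _ fF XF].
pose Phi := fine \o lr_pt r0 (fun q x => (F q x)%:E).
have {}mF q : measurable_fun setT (F q) by exact: mF.
have nPhi : nnfun Phi by split; [exact: X_meas XF|move=> x; apply: fine_ge0; exact: poweR_ge0].
have lPhi := bX_locint XF; rewrite -/Phi in lPhi XF *.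
(* Where Phi = 0 the factor 0^(1 - r0) is 0 because its exponent is nonzero. Phi is also 0 on the
   null set where the l^r0 norm is infinite. *)
pose g q x := `|F q x| `^ r0 * Phi x `^ (1 - r0).
have ng q : nnfun (g q).
  apply: nnfunM; apply: nnfun_pow; first exact: (nnfun_norm (mF q)).1.
  by case: nPhi.
have r1n : 1 - r0 != 0 by rewrite lt_eqF// subr_lt0.
have sg n x : \sum_(q <- @Qseq d n) g q x <= Phi x.
  rewrite -mulr_suml; have [P0|P0] := eqVneq (Phi x) 0.
    by rewrite P0 powR0// mulr0.
  have fx : lr_pt r0 (fun q y => (F q y)%:E) x \is a fin_num.
    by apply: contraT => h; move: P0; rewrite /Phi/=; case: (lr_pt _ _ _) h => //=; rewrite eqxx.
  have := @lr_part_le _ _ r0 F n x r00; rewrite -(fineK fx) lee_fin -/(Phi x) => h.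
  have S0 : 0 <= \sum_(q <- @Qseq d n) `|F q x| `^ r0.
    by apply: sumr_ge0 => q _; exact: powR_ge0.
  have h' : \sum_(q <- @Qseq d n) `|F q x| `^ r0 <= Phi x `^ r0.
    rewrite -[leLHS](@powRVK _ r0)//; apply: le_powR2 => //; [exact: ltW|exact: powR_ge0].
  apply: le_trans (ler_wpM2r (powR_ge0 _ _) h') _.
  rewrite -powRD; last by apply/implyP => _.
  by rewrite addrCA subrr addr0 powRr1// nPhi.2.
have gPhi q x : g q x <= Phi x.
  have [N hN] := mem_Qseq q; apply: le_trans (sg N x).
  rewrite (big_rem q (hN _ (leqnn _)))//= lerDl.
  by apply: sumr_ge0 => p _; exact: (ng p).2.
have lg q : locint mu (g q).
  apply: (locint_le lPhi); first by case: (ng q).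
  by apply: aeW => x; rewrite !ger0_norm ?gPhi//; [exact: nPhi.2|exact: (ng q).2].
have FPhi : {ae mu, forall x q, `|F q x| <= Phi x}.
  by apply: filterS fF => x fx q; exact: le_lr_pt1.
have lF q : locint mu (F q).
  apply: (locint_le lPhi) => //; apply: filterS FPhi => x hx.
  by rewrite (ger0_norm (nPhi.2 x)).
have lnF q : locint mu (fun x => `|F q x|) by exact: locint_norm.
have nnF q : nnfun (fun x => `|F q x|) by exact: nnfun_norm.
have FgPhi q : {ae mu, forall x, `|F q x| <= g q x `^ r0^-1 * Phi x `^ (1 - r0^-1)}.
  apply: filterS FPhi => x /(_ q) hx.
  have [P0|P0] := eqVneq (Phi x) 0.
    by apply: le_trans hx _; rewrite P0 mulr_ge0// powR_ge0.
  rewrite /g powRM ?powR_ge0// powRK// -mulrA -powRrM -powRD; last by apply/implyP.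
  rewrite (_ : _ + _ = 0); last by field.
  by rewrite powRr0 mulr1.
have hmean q : mean mu q (fun x => `|F q x|) <=
    mean mu q (g q) `^ r0^-1 * mean mu q Phi `^ (1 - r0^-1).
  exact: mean_holder.
have [Mfin XM nM] := hC _ XF.
pose MP := fine \o HLmax mu Phi.
pose m q x := mean mu q (fun y => `|F q y|) * \1_(Qc q) x.
have nm q : nnfun (m q).
  apply: nnfunZ; first exact: mean_ge0.
  by apply: nnfun_indic; exact: measurable_Qcube.
pose u n x := \sum_(q <- @Qseq d n) mean mu q (g q) * \1_(Qc q) x.
have hu n : bX Xs (u n) /\ nrm Xs (u n) <= A * nrm Xs Phi.
  by apply: hA => //; exact: Qseq_uniq.
have u0 n x : 0 <= u n x.
  by apply: sumr_ge0 => q _; rewrite mulr_ge0 ?mean_ge0// indicE.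
have nh n : nnfun (lr_part r0 m n).
  apply: nnfun_pow; apply: (nnfun_sum _).1 => q _; apply: nnfun_pow.
  exact: (nnfun_norm (nm q).1).1.
(* The geometric mean of u and M Phi is replaced by their sum, which the triangle inequality
   controls: (u + M Phi)^r0 >= u (M Phi)^(r0 - 1). *)
have hum n : {ae mu, forall x, lr_part r0 m n x <= u n x + MP x}.
  apply: filterS Mfin => x fx.
  have MP0 : 0 <= MP x.
    have [q _] := Qcube_approx x (ltr01) (ltr1n R 2).
    apply: le_trans (le_HLmax hmu q lPhi fx) => //.
    by rewrite mulr_ge0 ?mean_ge0 ?indicE//; exact: nnfun_norm nPhi.1.
  have s0 : 0 <= u n x + MP x by rewrite addr_ge0.
  rewrite -[leRHS](@powRK _ r0)//; apply: le_powR2; first by rewrite invr_ge0 ltW.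
    by apply: sumr_ge0 => q _; exact: powR_ge0.
  rewrite (powR_mul1B (ltW r01) s0).
  apply: (@le_trans _ _ (u n x * MP x `^ (r0 - 1))); last first.
    apply: ler_pM; rewrite ?powR_ge0// ?lerDl//.
    by apply: le_powR2; rewrite ?lerDr.
  rewrite mulr_suml; apply: ler_sum => q _; rewrite /m.
  have := @le_HLmax _ _ mu hmu Phi q x lPhi fx; rewrite -/(MP x).
  rewrite (_ : (fun y => `|Phi y|) = Phi); last first.
    by apply/funext => y; rewrite ger0_norm// nPhi.2.
  rewrite indicE; case: (_ \in _) => /=; last first.
    by rewrite !mulr0 normr0 powR0// mul0r.
  rewrite !mulr1 => hM1; rewrite ger0_norm ?mean_ge0//.
  apply: le_trans (le_powR2 (ltW r00) (mean_ge0 mu q (nnF q)) (hmean q)) _.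
  rewrite powRM ?powR_ge0// powRVK ?mean_ge0//; apply: ler_wpM2l; first exact: mean_ge0.
  rewrite -powRrM (_ : _ * _ = r0 - 1); last by field.
  by apply: le_powR2 => //; exact: mean_ge0.
have nPhi0 := nrm_ge0 XF.
have hh n : bX Xs (lr_part r0 m n) /\ nrm Xs (lr_part r0 m n) <= (A + `|C|) * nrm Xs Phi.
  have [Xu nu] := hu n.
  have [|X1 X2] := @X_ideal _ _ _ Xs _ _ (X_add Xu XM) (nh n).1.
    apply: filterS (hum n) => x hx; rewrite ger0_norm ?(nh n).2//.
    by apply: le_trans hx (ler_norm _).
  split=> //; apply: le_trans X2 _; apply: le_trans (nrm_triangle Xu XM) _.
  rewrite mulrDl; apply: lerD => //; apply: le_trans nM _.
  by apply: ler_wpM2r => //; exact: ler_norm.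
have [|||||Hfin XH nH] := @fatou_ereal _ _ _ Xs hF (lr_part r0 m)
  (lr_pt r0 (fun q y => (m q y)%:E)) ((A + `|C|) * nrm Xs Phi).
- by move=> n; case: (hh n).
- by move=> x; exact: powR_ge0.
- by move=> x n; exact: lr_part_nd.
- by move=> x; exact: lr_part_cvg.
- by move=> n; case: (hh n).
(* Averages of the signed F q are dominated by those of |F q|, so the bound for m passes to [Mcal]
   by the ideal property. *)
pose c q := fine (avg mu (Qc q) (F q)).
have cfin q : (`|avg mu (Qc q) (F q)| <= (mean mu q (fun y => `|F q y|))%:E)%E.
  rewrite /avg abseM (mu_Qcube hmu)/=.
  apply: (@le_trans _ _ ((mean mu q (fun y => `|F q y|%R) * vol q)%:E * ((vol q)^-1)%:E)%E).
    have v0 : (0 <= (vol q)^-1 :> R)%R by rewrite invr_ge0 ltW// vol_gt0.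
    rewrite (ger0_norm v0); apply: lee_wpmul2r; first by rewrite lee_fin.
    have mQ := measurable_Qcube (R := R) q.
    have mFE : measurable_fun (Qc q) (EFin \o F q).
      by apply/measurable_EFinP; apply: measurable_funTS.
    apply: le_trans (le_abse_integral mu mQ mFE) _.
    by rewrite -itg_mean// -itg_setE.
  by rewrite -EFinM mulfK// vol_neq0.
have McE : Mcal mu F = (fun q x => (c q * \1_(Qc q) x)%:E).
  apply/funext => q; apply/funext => x; rewrite /Mcal /c EFinM fineK//.
  by rewrite fin_num_abs; apply: le_lt_trans (cfin q) (ltry _).
have cm q : `|c q| <= mean mu q (fun y => `|F q y|).
  rewrite -lee_fin; apply: le_trans (cfin q); rewrite -abse_EFin /c fineK//.
  by rewrite fin_num_abs; apply: le_lt_trans (cfin q) (ltry _).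
have mc q : measurable_fun setT (fun x => c q * \1_(Qc q) x).
  by apply: measurable_funM => //; apply: measurable_indic; exact: measurable_Qcube.
have ml := measurable_lr_pt r00 mc.
have lrle x : (lr_pt r0 (fun q y => (c q * \1_(Qc q) y)%:E) x
    <= lr_pt r0 (fun q y => (m q y)%:E) x)%E.
  apply: le_lr_pt => // q; rewrite /m normrM [leRHS]normrM; apply: ler_wpM2r => //.
  exact: le_trans (cm q) (ler_norm _).
have lr0 (M : Qi -> T -> R) x : (0 <= lr_pt r0 (fun q y => (M q y)%:E) x)%E.
  exact: poweR_ge0.
have cfn : {ae mu, forall x, lr_pt r0 (fun q y => (c q * \1_(Qc q) y)%:E) x \is a fin_num}.
  apply: filterS Hfin => x; rewrite !ge0_fin_numE//; exact: le_lt_trans.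
have [||X1 X2] := @X_ideal _ _ _ Xs _ (fine \o lr_pt r0 (fun q y => (c q * \1_(Qc q) y)%:E)) XH.
- exact: (measurableT_comp (fine_measurable measurableT)).
- apply: filterS2 cfn Hfin => x h1 h2 /=.
  by rewrite !ger0_norm ?fine_ge0//; apply: fine_le.
rewrite McE /Xlr_nrm; split; last by apply: le_trans X2 nH.
by split=> // q; exact: aeW.
Qed.

End maximal_bounds_imply_vector_bound.

(** * Vitali's covering lemma for finite families of cubes *)

Section vitali.
Context {R : realType} {d : nat}.
Local Notation T := (d.-tuple R).
Local Notation Qi := (@Qidx d).
Local Notation Qc := (@Qcube R d).
Implicit Types (p q : Qi) (s : seq Qi) (x : T).

Lemma triple_subproof q : 0 < ([tuple tnth (sval q).1 i - (sval q).2 | i < d],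
  3 * (sval q).2).2.
Proof. by rewrite /= mulr_gt0//; exact: (svalP q). Qed.

(** The concentric cube of three times the side; its data stay rational, so it is an index of the
    same type. *)
Definition triple q : Qi :=
  exist (fun p : d.-tuple rat * rat => 0 < p.2) _ (triple_subproof q).

Lemma side_triple q : side (triple q) = 3 * side q :> R.
Proof. by rewrite /side/= rmorphM/= ratr_nat. Qed.

Lemma vol_triple q : vol (triple q) = 3 ^+ d * vol q :> R.
Proof. by rewrite /vol side_triple exprMn. Qed.

Lemma tripleP q x : Qc (triple q) x <-> forall i,
  ratr (tnth (sval q).1 i) - side q <= tnth x i < ratr (tnth (sval q).1 i) + 2 * side q.
Proof.
split=> [/QcubeP h i|h].
  have := h i; rewrite side_triple/= tnth_mktuple rmorphB/= -/(side q : R); lra.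
apply/QcubeP => i; have := h i.
rewrite side_triple/= tnth_mktuple rmorphB/= -/(side q : R); lra.
Qed.

Lemma sub_triple q : Qc q `<=` Qc (triple q).
Proof.
by move=> x /QcubeP h; apply/tripleP => i; have := h i; have := @side_gt0 R d q; lra.
Qed.

Lemma Qcube_corner q : Qc q (map_tuple ratr (sval q).1).
Proof.
apply/QcubeP => i; rewrite tnth_map lexx ltrDl; exact: side_gt0.
Qed.

Lemma max_side s : s != [::] -> exists2 q, q \in s & forall p, p \in s -> side p <= side q :> R.
Proof.
elim: s => // q s ih _; have [->|sn] := eqVneq s [::].
  by exists q => [|p]; rewrite inE// => /eqP ->.
have [p ps hp] := ih sn; have [pq|qp] := leP (side p : R) (side q).
  exists q => [|p']; rewrite inE ?eqxx// => /orP[/eqP -> //|/hp].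
  by move=> /le_trans; exact.
exists p => [|p']; rewrite inE ?ps ?orbT// => /orP[/eqP ->|/hp //].
exact: ltW.
Qed.

(** Greedy selection: a cube of largest side is kept and all cubes meeting it are dropped; their
    sides are no larger, so they lie in its triple. Disjointness is stated as a sum of indicators,
    ready for integration. *)
Lemma vitali s : exists s', [/\ forall q, q \in s' -> q \in s,
  forall x, \sum_(q <- s') \1_(Qc q) x <= 1 :> R
  & forall q, q \in s -> exists2 p, p \in s' & Qc q `<=` Qc (triple p)].
Proof.
have [n] := ubnP (size s); elim: n s => // n ih s.
have [-> _|sn] := eqVneq s [::].
  by exists [::]; split=> // x; rewrite big_nil.
move=> sz; have [q qs hq] := max_side sn.
pose t := [seq p <- s | `[< Qc p `&` Qc q = set0 >]].
(* The cube q is nonempty and so meets itself; hence the list shrinks and induction on its length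
   applies. *)
have qt : q \notin t.
  rewrite mem_filter; apply/negP => /andP[/asboolP h _].
  have : (Qc q `&` Qc q) (map_tuple ratr (sval q).1) by split; exact: Qcube_corner.
  by rewrite h.
have st : (size t < n)%N.
  rewrite -ltnS; apply: leq_trans sz; rewrite ltnS /t size_filter ltn_neqAle count_size andbT.
  apply/negP; rewrite -all_count => /allP /(_ _ qs) h.
  by move: qt; rewrite mem_filter h qs.
have [t' [h1 h2 h3]] := ih _ st.
exists (q :: t'); split.
- move=> p; rewrite inE => /orP[/eqP -> //|/h1].
  by rewrite mem_filter => /andP[].
- move=> x; rewrite big_cons indicE; case: (boolP (x \in Qc q)) => [/set_mem qx|_] /=; last first.
    by rewrite add0r.
  rewrite big_seq big1 ?addr0// => p /h1; rewrite mem_filter => /andP[/asboolP h _].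
  rewrite indicE memNset// => px; have : (Qc p `&` Qc q) x by split.
  by rewrite h.
- move=> p ps; case: (boolP (p \in t)) => [/h3[p' p't h]|].
    by exists p' => //; rewrite inE p't orbT.
  rewrite mem_filter ps andbT => /asboolPn /eqP /set0P[y [/QcubeP py /QcubeP qy]].
  exists q; rewrite ?mem_head// => x /QcubeP px; apply/tripleP => i.
  by have := py i; have := qy i; have := px i; have := hq _ ps; lra.
Qed.

End vitali.

(** * Weak and strong type of a maximal function for a doubling weight *)

Section weighted_maximal.
Context {R : realType} {d : nat}.
Variable mu : {measure set (d.-tuple R) -> \bar R}.
Local Notation T := (d.-tuple R).
Local Notation Qi := (@Qidx d).
Local Notation Qc := (@Qcube R d).

(** Discrete form of d(y^p) / y = p' d(y^(p-1)) with p' = p / (p - 1); it is Young's inequality for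
    x^(p-1) y. *)
Lemma conj_exp_diff (p x y : R) : 1 < p -> 0 <= x -> x <= y -> 0 < y ->
  (y `^ p - x `^ p) / y <= p / (p - 1) * (y `^ (p - 1) - x `^ (p - 1)).
Proof.
move=> p1 x0 xy y0; have p0 : 0 < p by lra.
have pm : 0 < p - 1 by lra.
have y0' := ltW y0.
rewrite ler_pdivrMr// (powR_mul1B (ltW p1) y0') (powR_mul1B (ltW p1) x0).
have Y := @conjugate_powR _ (x `^ (p - 1)) y (p / (p - 1)) p.
have {Y} := Y (powR_ge0 _ _) y0' (divr_gt0 p0 pm) p0.
have -> : (p / (p - 1))^-1 + p^-1 = 1 by rewrite invf_div; field; rewrite gt_eqF.
move=> /(_ erefl); rewrite -powRrM (_ : (p - 1) * (p / (p - 1)) = p); last first.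
  by field; rewrite gt_eqF.
rewrite (powR_mul1B (ltW p1) y0') (powR_mul1B (ltW p1) x0) invf_div.
set A := x `^ (p - 1); set B := y `^ (p - 1) => h.
have : p / (p - 1) * (A * y) <= p / (p - 1) * (x * A * ((p - 1) / p) + y * B / p).
  by apply: ler_wpM2l => //; rewrite divr_ge0// ltW.
rewrite (_ : p / (p - 1) * (x * A * ((p - 1) / p) + y * B / p) = x * A + y * B / (p - 1)); last first.
  by field; rewrite !gt_eqF.
rewrite (_ : p / (p - 1) * (B - A) * y = y * B + y * B / (p - 1) - p / (p - 1) * (A * y)); last first.
  by field; rewrite gt_eqF.
lra.
Qed.

Variables (v f : T -> R) (s : seq Qi) (a V : Qi -> R) (D p : R).
Hypothesis nv : nnfun v.
Hypothesis nf : nnfun f.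
Hypothesis a0 : forall q, 0 <= a q.
Hypothesis D0 : 0 <= D.
Hypothesis p1 : 1 < p.
Hypothesis hV : forall q, q \in s -> itg mu (fun x => \1_(Qc q) x * v x) = (V q)%:E.
Hypothesis hD : forall q, q \in s ->
  (itg mu (fun x => \1_(Qc (triple q)) x * v x)%R <= (D * V q)%:E)%E.
Hypothesis ha : forall q, q \in s ->
  ((a q * V q)%:E <= itg mu (fun x => \1_(Qc q) x * (f x * v x))%R)%E.

(** A finite maximal function for the measure v dmu: by [ha] each a q is at most the average of f
    over q in that measure; V q is the mass of q, and D is a doubling constant for triples. *)
Let F x : R := \big[Num.max/0]_(q <- s) (a q * \1_(Qc q) x).

Let nI q : nnfun (\1_(Qc q) : T -> R).
Proof. by apply: nnfun_indic; exact: measurable_Qcube. Qed.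

Let nF : nnfun F.
Proof. by apply: nnfun_bigmax => q _; apply: nnfunZ. Qed.

Let level (l : R) : set T := [set x | l <= F x].

Let nlevel l : nnfun (\1_(level l) : T -> R).
Proof.
apply: nnfun_indic; have -> : level l = F @^-1` `[l, +oo[.
  by apply/seteqP; split => x /=; rewrite in_itv/= andbT.
by rewrite -[_ @^-1` _]setTI; apply: nF.1 => //; exact: measurable_itv.
Qed.

(** Vitali selection among the cubes with a q >= l: the triples cover the level set, while the
    selected cubes are disjoint and contained in it. Keeping the level set on the right makes the
    passage to the strong type a summation over levels. *)
Lemma weighted_weak_type l : 0 < l ->
  (l%:E * itg mu (fun x => \1_(level l) x * v x)%R
   <= D%:E * itg mu (fun x => \1_(level l) x * (f x * v x))%R)%E.
Proof.
move=> l0; have nfv : nnfun (fun x => f x * v x) by exact: nnfunM.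
have [s' [h1 h2 h3]] := @vitali R d [seq q <- s | l <= a q].
have s's q : q \in s' -> q \in s /\ l <= a q.
  by move=> /h1; rewrite mem_filter => /andP[].
have n1 q : nnfun (fun x => \1_(Qc q) x * v x) by exact: nnfunM.
have n2 q : nnfun (fun x => \1_(Qc q) x * (f x * v x)) by exact: nnfunM.
have nl1 : nnfun (fun x => \1_(level l) x * v x) by exact: nnfunM.
apply: (@le_trans _ _ (l%:E * (\sum_(q <- s') (D * V q)%:E))%E).
  apply: lee_wpmul2l; first by rewrite lee_fin ltW.
  apply: (@le_trans _ _ (\sum_(q <- s') itg mu (fun x => \1_(Qc (triple q)) x * v x)%R)%E).
    rewrite -itg_sum//; apply: le_itg => // [|x]; first by apply: nnfun_sum.
    rewrite -mulr_suml; apply: ler_wpM2r; first exact: nv.2.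
    rewrite indicE; case: (boolP (x \in level l)) => [/set_mem lx|_] /=; last first.
      by apply: sumr_ge0 => q _; rewrite indicE.
    have [q qs [lq qx]] : exists2 q, q \in s & l <= a q /\ Qc q x.
      have : exists2 q, q \in s & l <= a q * \1_(Qc q) x.
        apply: contrapT => hn; have : F x < l.
          rewrite /F big_seq; apply: bigmax_lt => // q qs; rewrite ltNge.
          by apply/negP => hq; apply: hn; exists q.
        by rewrite ltNge => /negP; apply.
      move=> [q qs]; rewrite indicE; case: (boolP (x \in Qc q)) => [/set_mem qx|_] /=.
        by rewrite mulr1 => lq; exists q.
      by rewrite mulr0 leNgt l0.
    have [|q' q's' sub] := h3 q; first by rewrite mem_filter lq.
    rewrite (big_rem q')//= indicE mem_set/=; last exact: sub.
    by rewrite lerDl; apply: sumr_ge0 => *; rewrite indicE.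
  rewrite big_seq [leRHS]big_seq; apply: lee_sum => q /s's[qs _]; exact: hD.
apply: (@le_trans _ _ (D%:E * \sum_(q <- s') itg mu (fun x => \1_(Qc q) x * (f x * v x))%R)%E).
  rewrite sumEFin -EFinM -mulr_sumr mulrCA EFinM.
  apply: lee_wpmul2l; first by rewrite lee_fin.
  rewrite mulr_sumr -sumEFin big_seq [leRHS]big_seq; apply: lee_sum => q /s's[qs lq].
  apply: le_trans (ha qs); rewrite lee_fin; apply: ler_wpM2r => //.
  by rewrite -lee_fin -hV//; exact: itg_ge0.
apply: lee_wpmul2l; first by rewrite lee_fin.
rewrite -itg_sum//; apply: le_itg => [||x]; [by apply: nnfun_sum|exact: nnfunM|].
rewrite -mulr_suml; apply: ler_wpM2r; first exact: nfv.2.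
rewrite [leRHS]indicE; case: (boolP (x \in level l)) => [_|lx] /=; first exact: h2.
rewrite big_seq big1// => q /s's[qs lq]; rewrite indicE memNset// => qx.
move: lx => /negP; apply; apply/mem_set; rewrite /level/=; apply: le_trans lq _.
rewrite -[leLHS]mulr1 -[X in _ * X](_ : \1_(Qc q) x = 1); last by rewrite indicE mem_set.
exact: (@le_bigmax_seq _ _ _ _ _ _ xpredT (fun q => a q * \1_(Qc q) x) qs).
Qed.

(** F takes values in the finite list of 0 and the a q, so the layer-cake formula is a telescoping
    sum over the sorted list, without integration in l. *)
Lemma layer_cake_sum : exists n (b : nat -> R),
  [/\ b 0%N = 0, forall i, (i < n)%N -> 0 <= b i <= b i.+1
  & forall x (phi : R -> R), \sum_(0 <= i < n)
      (phi (b i.+1) - phi (b i)) * \1_(level (b i.+1)) x = phi (F x) - phi 0].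
Proof.
pose L := sort <=%R (0 :: [seq a q | q <- s]).
have Lin y : y \in L -> 0 <= y.
  rewrite mem_sort inE => /orP[/eqP -> //|/mapP[q _ ->]]; exact: a0.
have szL : size L = (size s).+1 by rewrite size_sort/= size_map.
have sL : sorted <=%R L by apply: sort_sorted; exact: le_total.
pose b i := nth 0 L i.
have mono i j : (i <= j)%N -> (j <= size s)%N -> b i <= b j.
  move=> ij js; apply: (sorted_leq_nth le_trans lexx) => //; rewrite inE szL ltnS//.
  exact: leq_trans js.
have binL i : (i <= size s)%N -> b i \in L by move=> h; apply: mem_nth; rewrite szL ltnS.
have b00 : b 0%N = 0.
  apply/eqP; rewrite eq_le (Lin _ (binL _ (leq0n _))) andbT.
  have zL : 0 \in L by rewrite mem_sort mem_head.
  rewrite -[leRHS](nth_index 0 zL); apply: mono => //.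
  by rewrite -ltnS -szL index_mem.
exists (size s), b; split=> // [i hi|x phi].
  by rewrite mono ?leqnSn// andbT; apply/Lin/binL/ltnW.
have FL : F x \in L.
  rewrite mem_sort /F; elim: s => [|q t ih]; first by rewrite big_nil mem_head.
  rewrite big_cons maxEle; case: ifP => _.
    by move: ih; rewrite !inE => /orP[->//|->]; rewrite !orbT.
  rewrite indicE; case: (x \in Qc q) => /=; last by rewrite mulr0 mem_head.
  by rewrite mulr1 !inE eqxx orbT.
have [k ks kF] : exists2 k, (k <= size s)%N & b k = F x.
  by exists (index (F x) L); [rewrite -ltnS -szL index_mem|exact: nth_index].
rewrite -kF.
rewrite (@eq_big_nat _ _ _ _ _ _ (fun i => phi (Num.min (b i.+1) (b k)) - phi (Num.min (b i) (b k)))).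
  rewrite telescope_sumr// b00; congr (phi _ - phi _).
    by apply/min_idPr; exact: mono.
  by apply/min_idPl; apply/Lin/binL.
move=> i /= ik; rewrite indicE; case: (boolP (x \in level (b i.+1))).
  rewrite /level inE/= -kF mulr1 => h.
  have h' : b i <= b k by apply: le_trans h; apply: mono.
  by rewrite (min_idPl h) (min_idPl h').
rewrite /level notin_setE/= -kF => /negP; rewrite -ltNge mulr0 => h.
have h' : b k <= b i.
  have [ki|ik'] := leqP k i; first by apply: mono => //; exact: ltnW.
  by have := mono i.+1 k ik' ks; rewrite leNgt h.
by rewrite (min_idPr (ltW h)) (min_idPr h') subrr.
Qed.

(** Summing the weak type over levels with [conj_exp_diff] bounds the integral of F^p v by K = D p'
    times that of F^(p-1) f v. Young's inequality turns this into K^p / p times the integral of f^p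
    v plus 1 / p' times that of F^p v, and the last term, finite for a finite family, is
    absorbed. *)
Lemma weighted_strong_type :
  (itg mu (fun x => F x `^ p * v x)%R
   <= ((D * (p / (p - 1))) `^ p)%:E * itg mu (fun x => f x `^ p * v x)%R)%E.
Proof.
have p0 : 0 < p by exact: lt_trans p1.
have pm : 0 < p - 1 by rewrite subr_gt0.
have pn : p != 0 by rewrite gt_eqF.
have pmn : p - 1 != 0 by rewrite gt_eqF.
pose p' := p / (p - 1).
have p'0 : 0 < p' by rewrite divr_gt0.
have nfv : nnfun (fun x => f x * v x) by exact: nnfunM.
have nFp t : nnfun (fun x => F x `^ t) by apply: nnfun_pow; case: nF.
have nfp : nnfun (fun x => f x `^ p) by apply: nnfun_pow; case: nf.
have step1 : (itg mu (fun x => F x `^ p * v x)%R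
    <= itg mu (fun x => (D * p') * (F x `^ (p - 1) * (f x * v x)))%R)%E.
  have [n [b [b00 bm hb]]] := layer_cake_sum.
  have phi0 t : t != 0 -> forall x, F x `^ t =
     \sum_(0 <= i < n) (b i.+1 `^ t - b i `^ t) * \1_(level (b i.+1)) x.
    by move=> t0 x; rewrite (hb x (fun y => y `^ t)) powR0// subr0.
  have c0 t i : 0 <= t -> i \in index_iota 0 n -> 0 <= b i.+1 `^ t - b i `^ t.
    rewrite mem_index_iota => t0 /andP[_ /bm /andP[b1 b2]].
    by rewrite subr_ge0; apply: le_powR2.
  rewrite (@itg_ext _ _ _ mu _ (fun x => \sum_(i <- index_iota 0 n)
     (b i.+1 `^ p - b i `^ p) * (\1_(level (b i.+1)) x * v x))); last first.
    by move=> x; rewrite (phi0 p)// mulr_suml; apply: eq_bigr => i _; rewrite mulrA.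
  rewrite [leRHS](@itg_ext _ _ _ mu _ (fun x => \sum_(i <- index_iota 0 n)
     (D * p' * (b i.+1 `^ (p - 1) - b i `^ (p - 1))) * (\1_(level (b i.+1)) x * (f x * v x)))); last first.
    move=> x; rewrite (phi0 (p - 1))// mulr_suml mulr_sumr; apply: eq_bigr => i _.
    by rewrite !mulrA.
  have m1 i : nnfun (fun x => \1_(level (b i.+1)) x * v x) by exact: nnfunM.
  have m2 i : nnfun (fun x => \1_(level (b i.+1)) x * (f x * v x)) by exact: nnfunM.
  have d0 i : i \in index_iota 0 n -> 0 <= D * p' * (b i.+1 `^ (p - 1) - b i `^ (p - 1)).
    move=> hi; apply: mulr_ge0; first by rewrite mulr_ge0// ltW.
    by apply: c0 => //; exact: ltW.
  rewrite !itg_sum; last 2 first.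
  - by move=> i hi; apply: nnfunZ => //; exact: d0.
  - by move=> i hi; apply: nnfunZ => //; apply: c0 => //; exact: ltW.
  rewrite big_seq [leRHS]big_seq; apply: lee_sum => i hi.
  rewrite itgZ ?c0 ?(ltW p0)// itgZ ?d0//.
  have := hi; rewrite mem_index_iota => /andP[_ /bm /andP[b1 b2]].
  have [bz|bn] := eqVneq (b i.+1) 0.
    have bz' : b i = 0 by apply/eqP; rewrite eq_le b1 -bz b2.
    have -> : b i.+1 `^ p - b i `^ p = 0 by rewrite bz bz' subrr.
    by rewrite mul0e; apply: mule_ge0; [rewrite lee_fin; exact: d0|exact: itg_ge0].
  have bp : 0 < b i.+1 by rewrite lt_def bn (le_trans b1 b2).
  have hw := weighted_weak_type bp.
  apply: (@le_trans _ _ (((b i.+1 `^ p - b i `^ p) / b i.+1)%:E *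
     ((b i.+1)%:E * itg mu (fun x => \1_(level (b i.+1)) x * v x)%R))%E).
    by rewrite muleA -EFinM divfK.
  apply: (@le_trans _ _ (((b i.+1 `^ p - b i `^ p) / b i.+1)%:E *
     (D%:E * itg mu (fun x => \1_(level (b i.+1)) x * (f x * v x))%R))%E).
    by apply: lee_wpmul2l => //; rewrite lee_fin divr_ge0 ?c0 ?ltW.
  rewrite muleA -EFinM; apply: lee_wpmul2r; first exact: itg_ge0.
  rewrite lee_fin mulrC -mulrA; apply: ler_wpM2l => //.
  exact: conj_exp_diff.
pose K := D * p'.
have K0 : 0 <= K by rewrite mulr_ge0// ltW.
have step2 x : K * (F x `^ (p - 1) * (f x * v x)) <=
    K `^ p / p * (f x `^ p * v x) + p'^-1 * (F x `^ p * v x).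
  have v0 := nv.2 x.
  rewrite !mulrA -mulrDl; apply: ler_wpM2r => //.
  have := @conjugate_powR _ (K * f x) (F x `^ (p - 1)) p p'.
  rewrite mulr_ge0 ?nf.2// powR_ge0 p0 p'0 => /(_ isT isT isT isT).
  rewrite {1}/p' invf_div (_ : p^-1 + _ = 1); last by field.
  move=> /(_ erefl); rewrite powRM ?nf.2// -powRrM (_ : (p - 1) * p' = p); last first.
    by rewrite /p'; field.
  lra.
set X := itg mu (fun x => F x `^ p * v x).
have nX : nnfun (fun x => F x `^ p * v x) by exact: nnfunM.
have nY : nnfun (fun x => f x `^ p * v x) by exact: nnfunM.
have Xfin : X \is a fin_num.
  apply: itg_fin_num => //.
  apply: (@le_lt_trans _ _ (itg mu (fun x => \sum_(q <- s) a q `^ p * (\1_(Qc q) x * v x)))%R).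
    apply: le_itg => // [|x].
      by apply: nnfun_sum => q _; apply: nnfunZ; [exact: powR_ge0|exact: nnfunM].
    under eq_bigr do rewrite mulrA; rewrite -mulr_suml; apply: ler_wpM2r; first exact: nv.2.
    rewrite /F; elim: s => [|q t ih]; first by rewrite !big_nil powR0.
    rewrite !big_cons; apply: (@le_trans _ _ ((a q * \1_(Qc q) x) `^ p +
       (\big[Num.max/0]_(j <- t) (a j * \1_(Qc j) x)) `^ p)).
      by rewrite maxEle; case: ifP => _; rewrite ?lerDl ?lerDr powR_ge0.
    apply: lerD => //; rewrite powRM ?a0 ?indicE//; case: (_ \in _) => /=.
      by rewrite powR1.
    by rewrite powR0.
  rewrite itg_sum; last by move=> q _; apply: nnfunZ; [exact: powR_ge0|exact: nnfunM].
  rewrite big_seq (eq_bigr (fun q => (a q `^ p * V q)%:E)) ?sumEFin ?ltry// => q qs.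
  by rewrite itgZ ?powR_ge0//; [rewrite hV|exact: nnfunM].
set Y := itg mu (fun x => f x `^ p * v x).
have [->|Yn] := eqVneq Y +oo%E.
  (* As 0 times +oo is 0, the case K = 0 needs an argument: [step1] then gives X <= 0. *)
  have [Kz|Kn] := eqVneq (K `^ p) 0; last first.
    by rewrite gt0_muley ?leey// lte_fin lt_def Kn powR_ge0.
  have : (X <= 0)%E.
    apply: le_trans step1 _; rewrite -/K.
    have -> : K = 0 by apply: powR_eq0_eq0 Kz.
    rewrite itgZ//; first by rewrite mul0e.
    by apply: nnfunM => //; exact: nFp.
  by move=> /le_trans; apply; rewrite mule_ge0 ?lee_fin ?powR_ge0// leey.
have Yfin : Y \is a fin_num by rewrite ge0_fin_numE ?itg_ge0// ltey.
have : (X <= (K `^ p / p)%:E * Y + (p'^-1)%:E * X)%E.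
  apply: le_trans step1 _.
  apply: (@le_trans _ _ (itg mu (fun x => K `^ p / p * (f x `^ p * v x) + p'^-1 * (F x `^ p * v x)))).
    apply: le_itg => //.
      by apply: nnfunZ => //; apply: nnfunM => //; exact: nFp.
    by apply: nnfunD; apply: nnfunZ => //; rewrite ?divr_ge0 ?powR_ge0 ?invr_ge0 ?ltW.
  rewrite itgD; try by apply: nnfunZ => //; rewrite ?divr_ge0 ?powR_ge0 ?invr_ge0 ?ltW.
  by rewrite !itgZ// ?divr_ge0 ?powR_ge0 ?invr_ge0 ?ltW.
rewrite -(fineK Xfin) -(fineK Yfin) -!EFinM -EFinD !lee_fin.
set X' := fine X; set Y' := fine Y => h.
have : p * X' <= p * (K `^ p / p * Y' + p'^-1 * X') by apply: ler_wpM2l => //; exact: ltW.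
rewrite (_ : p * (K `^ p / p * Y' + p'^-1 * X') = K `^ p * Y' + (p - 1) * X'); last first.
  by rewrite /p'; field; rewrite ?pn ?pmn.
lra.
Qed.

End weighted_maximal.

(** * Muckenhoupt's theorem over a finite family *)

Section muckenhoupt.
Context {R : realType} {d : nat}.
Variable mu : {measure set (d.-tuple R) -> \bar R}.
Hypothesis hmu : is_lebesgue mu.
Local Notation T := (d.-tuple R).
Local Notation Qi := (@Qidx d).
Local Notation Qc := (@Qcube R d).
Implicit Types (f v w sigma : T -> R) (q : Qi) (s : seq Qi).

(** This is sigma = v^(1 - p'), written in a form preserved when v, p are exchanged with sigma, p'.
    At zeros of v both weights vanish, in agreement with [powR]. *)
Definition conj_weights (p : R) v sigma := forall x,
  (v x = 0 /\ sigma x = 0) \/ [/\ 0 < v x, 0 < sigma x & v x * sigma x `^ (p - 1) = 1].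

Lemma conj_weights_sym p v sigma : 1 < p -> conj_weights p v sigma ->
  conj_weights (p / (p - 1)) sigma v.
Proof.
move=> p1 h x; have pm : p - 1 != 0 by rewrite gt_eqF//; lra.
case: (h x) => [[v0 s0]|[v0 s0 e]]; [by left|right; split=> //].
have -> : p / (p - 1) - 1 = (p - 1)^-1 by field.
have : (v x * sigma x `^ (p - 1)) `^ (p - 1)^-1 = 1 by rewrite e powR1.
by rewrite powRM ?powR_ge0 ?(ltW v0)// powRK ?(ltW s0)// mulrC.
Qed.

(** Dividing by |Q|^p gives the usual A_p condition <v> <sigma>^(p-1) <= A; the doubling constant D
    of v is kept as a separate parameter. *)
Definition ap_cubes (p A D : R) v sigma s (V S : Qi -> R) := forall q, q \in s ->
  [/\ itg mu (fun x => \1_(Qc q) x * v x) = (V q)%:E,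
      itg mu (fun x => \1_(Qc q) x * sigma x) = (S q)%:E,
      0 < V q /\ 0 < S q,
      V q * S q `^ (p - 1) <= A * vol q `^ p
    & (itg mu (fun x => \1_(Qc (triple q)) x * v x)%R <= (D * V q)%:E)%E].

Lemma conj_exp_gt1 (p : R) : 1 < p -> 1 < p / (p - 1).
Proof. by move=> p1; rewrite ltr_pdivlMr; lra. Qed.

(* Lerner's pointwise bound: M f <= C M_v(M_sigma(f / sigma)^(p-1) / v)^(1/(p-1)). *)
Lemma muckenhoupt (p A D D' : R) v sigma s (V S : Qi -> R) f :
  1 < p -> 0 <= A -> 0 <= D -> 0 <= D' ->
  nnfun v -> nnfun sigma -> conj_weights p v sigma ->
  ap_cubes p A D v sigma s V S ->
  (forall q, q \in s ->
     (itg mu (fun x => \1_(Qc (triple q)) x * sigma x)%R <= (D' * S q)%:E)%E) ->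
  {ae mu, forall x q, q \in s -> Qc q x -> 0 < v x} ->
  nnfun f -> locint mu f ->
  (itg mu (fun x => maxop mu s f x `^ p * v x)%R <=
   (A `^ (p / (p - 1)) * (D * p) `^ (p / (p - 1)) * (D' * (p / (p - 1))) `^ p)%:E
   * itg mu (fun x => f x `^ p * v x)%R)%E.
Proof.
move=> p1 A0 D0 D'0 nv ns hc hA hD' vpos nf lf.
have p0 : 0 < p by lra.
have pm : 0 < p - 1 by lra.
have pn : p != 0 by rewrite gt_eqF.
have pmn : p - 1 != 0 by rewrite gt_eqF.
set p' := p / (p - 1).
have p'1 : 1 < p' by exact: conj_exp_gt1.
have p'0 : 0 < p' by lra.
have nI q : nnfun (\1_(Qc q) : T -> R) by apply: nnfun_indic; exact: measurable_Qcube.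
have m0 q : 0 <= mean mu q f by exact: mean_ge0.
have mE q : mean mu q (fun y => `|f y|) = mean mu q f.
  by congr (mean mu q); apply/funext => y; rewrite ger0_norm// nf.2.
have n1f q : nnfun (fun x => \1_(Qc q) x * f x) by exact: nnfunM.
(* The average of f / sigma over q for the measure sigma dmu, so that N1 is M_sigma (f / sigma). The
   absolute value keeps it nonnegative also for q outside s, where S q is arbitrary. *)
pose al q := `|mean mu q f * vol q / S q|.
have al0 q : 0 <= al q by exact: normr_ge0.
have alE q : q \in s -> al q * S q = mean mu q f * vol q.
  move=> qs; have [_ _ [_ S0] _ _] := hA _ qs.
  rewrite /al ger0_norm; first by rewrite divfK// gt_eqF.
  by apply: divr_ge0; [apply: mulr_ge0 => //; exact/ltW/vol_gt0|exact: ltW].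
pose h x := f x * (sigma x)^-1.
have nh : nnfun h.
  split=> [|x]; last by rewrite mulr_ge0 ?invr_ge0 ?nf.2 ?ns.2.
  apply: measurable_funM; first by case: nf.
  apply: (@eq_measurable_fun _ _ _ _ _ (fun x => sigma x `^ (-1))).
    by move=> x _; rewrite powR_inv1// ns.2.
  by case: (nnfun_pow (-1) ns.1).
pose N1 x := \big[Num.max/0]_(q <- s) (al q * \1_(Qc q) x).
have nN1 : nnfun N1 by apply: nnfun_bigmax => q _; apply: nnfunZ.
have spos : {ae mu, forall x q, q \in s -> Qc q x -> 0 < sigma x}.
  apply: filterS vpos => x hx q qs qx; have := hx q qs qx.
  by case: (hc x) => [[-> _]|[_ ? _]//]; rewrite ltxx.
have step1 : (itg mu (fun x => N1 x `^ p * sigma x)%R <=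
    ((D' * p') `^ p)%:E * itg mu (fun x => f x `^ p * v x)%R)%E.
  have -> : itg mu (fun x => f x `^ p * v x) = itg mu (fun x => h x `^ p * sigma x).
    apply: itg_ext => x; rewrite /h; case: (hc x) => [[-> ->]|[v0 s0 e]].
      by rewrite !mulr0.
    rewrite powR_div ?nf.2//.
    rewrite -mulrA; congr (_ * _); apply: (mulIf (lt0r_neq0 (powR_gt0 (p - 1) s0))).
    rewrite e (powR_mul1B (ltW p1) (ltW s0)).
    have : sigma x `^ (p - 1) != 0 by rewrite gt_eqF// powR_gt0.
    move: (sigma x `^ _) => u un; field.
    by rewrite un gt_eqF.
  apply: (@weighted_strong_type _ _ mu sigma h s al S D' p) => //.
  - by move=> q qs; have [] := hA _ qs.
  - move=> q qs; rewrite alE// -itg_mean//.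
    apply: ae_le_itg; [exact: n1f|by apply: nnfunM => //; exact: nnfunM|].
    apply: filterS spos => x hx; rewrite indicE; case: (boolP (x \in Qc q)) => [/set_mem qx|_] /=.
      by rewrite !mul1r /h mulfVK// gt_eqF//; exact: hx qx.
    by rewrite !mul0r.
pose k x := N1 x `^ (p - 1) * (v x)^-1.
have nN1p t : nnfun (fun x => N1 x `^ t) by apply: nnfun_pow; case: nN1.
have nk : nnfun k.
  split=> [|x]; last by rewrite mulr_ge0 ?invr_ge0 ?powR_ge0 ?nv.2.
  apply: measurable_funM; first by case: (nN1p (p - 1)).
  apply: (@eq_measurable_fun _ _ _ _ _ (fun x => v x `^ (-1))).
    by move=> x _; rewrite powR_inv1// nv.2.
  by case: (nnfun_pow (-1) nv.1).
have lN1 : locint mu (fun x => N1 x `^ (p - 1)).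
  apply: (@locint_bounded _ _ mu hmu _ ((\sum_(q <- s) al q) `^ (p - 1))).
    by case: (nN1p (p - 1)).
  move=> x; rewrite ger0_norm ?powR_ge0//; apply: le_powR2; [exact: ltW|exact: nN1.2|].
  rewrite /N1; elim: (s) => [|q t ih]; first by rewrite !big_nil.
  rewrite !big_cons ge_max; apply/andP; split.
    rewrite -[leLHS]addr0; apply: lerD; last by apply: sumr_ge0.
    by rewrite indicE; case: (_ \in _); rewrite ?mulr1// mulr0.
  by apply: le_trans ih _; rewrite lerDr.
(* The average of N1^(p-1) / v for the measure v dmu, so that N2 is M_v (N1^(p-1) / v). *)
pose be q := `|mean mu q (fun x => N1 x `^ (p - 1)) * vol q / V q|.
have be0 q : 0 <= be q by exact: normr_ge0.
have beE q : q \in s -> be q * V q = mean mu q (fun x => N1 x `^ (p - 1)) * vol q.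
  move=> qs; have [_ _ [V0 _] _ _] := hA _ qs.
  rewrite /be ger0_norm; first by rewrite divfK// gt_eqF.
  apply: divr_ge0; [apply: mulr_ge0|exact: ltW]; first exact: mean_ge0.
  exact/ltW/vol_gt0.
pose N2 x := \big[Num.max/0]_(q <- s) (be q * \1_(Qc q) x).
have nN2 : nnfun N2 by apply: nnfun_bigmax => q _; apply: nnfunZ.
have step2 : (itg mu (fun x => N2 x `^ p' * v x)%R <=
    ((D * p) `^ p')%:E * itg mu (fun x => N1 x `^ p * sigma x)%R)%E.
  have -> : itg mu (fun x => N1 x `^ p * sigma x) = itg mu (fun x => k x `^ p' * v x).
    have hc' := conj_weights_sym p1 hc.
    apply: itg_ext => x; rewrite /k; case: (hc' x) => [[-> ->]|[s0 v0 e]].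
      by rewrite !mulr0.
    rewrite powR_div ?powR_ge0// -powRrM (_ : (p - 1) * p' = p); last first.
      by rewrite /p'; field.
    rewrite -mulrA; congr (_ * _); apply: (mulIf (lt0r_neq0 (powR_gt0 (p' - 1) v0))).
    rewrite e (powR_mul1B (ltW p'1) (ltW v0)).
    have : v x `^ (p' - 1) != 0 by rewrite gt_eqF// powR_gt0.
    move: (v x `^ _) => u un; field.
    by rewrite un gt_eqF.
  (* The strong type is now applied with exponent p', whose conjugate is p. *)
  have -> : D * p = D * (p' / (p' - 1)).
    have -> : p' - 1 = (p - 1)^-1 by rewrite /p'; field.
    by rewrite invrK /p' divfK.
  apply: (@weighted_strong_type _ _ mu v k s be V D p') => //.
  - by move=> q qs; have [] := hA _ qs.
  - by move=> q qs; have [] := hA _ qs.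
  - move=> q qs; rewrite beE// -itg_mean//.
    apply: ae_le_itg; [exact: nnfunM|by apply: nnfunM => //; exact: nnfunM|].
    apply: filterS vpos => x hx; rewrite indicE; case: (boolP (x \in Qc q)) => [/set_mem qx|_] /=.
      by rewrite !mul1r /k mulfVK// gt_eqF//; exact: hx qx.
    by rewrite !mul0r.
have nM : nnfun (maxop mu s f) by apply: nnfun_maxop; case: nf.
(* Since <f>_q = al_q S_q / |Q| and al_q^(p-1) <= <N1^(p-1)>_q = be_q V_q / |Q|, the A_p condition
   yields <f>_q^(p-1) <= A be_q. *)
have ptw x : maxop mu s f x `^ p <= A `^ p' * N2 x `^ p'.
  have N20 := nN2.2 x.
  have -> : maxop mu s f x `^ p = (maxop mu s f x `^ (p - 1)) `^ p'.
    by rewrite -powRrM; congr (_ `^ _); rewrite /p'; field.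
  rewrite -powRM//; apply: le_powR2; [exact: ltW|exact: powR_ge0|].
  rewrite -[leRHS](@powRVK _ (p - 1))// ?mulr_ge0//; apply: le_powR2; [exact: ltW|exact: nM.2|].
  apply: maxop_le; first exact: powR_ge0.
  move=> q qs; rewrite mE indicE; case: (boolP (x \in Qc q)) => [/set_mem qx|_] /=; last first.
    by rewrite mulr0 powR_ge0.
  rewrite mulr1 (powR_le_root pm (m0 q) (mulr_ge0 A0 N20)).
  have [_ _ [V0 S0] hAq _] := hA _ qs.
  have v0 := @vol_gt0 R d q.
  apply: (@le_trans _ _ (A * be q)); last first.
    apply: ler_wpM2l => //.
    rewrite -[leLHS]mulr1 -[X in _ * X](_ : \1_(Qc q) x = 1); last by rewrite indicE mem_set.
    exact: (@le_bigmax_seq _ _ _ _ _ _ xpredT (fun q => be q * \1_(Qc q) x) qs).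
  have am : al q `^ (p - 1) <= mean mu q (fun x => N1 x `^ (p - 1)).
    rewrite -(ler_pM2r v0) -lee_fin -itg_mean//.
    have -> : (al q `^ (p - 1) * vol q)%:E = itg mu (fun y => al q `^ (p - 1) * \1_(Qc q) y).
      rewrite itgZ ?powR_ge0// itg_indic; last exact: measurable_Qcube.
      by rewrite mu_Qcube.
    apply: le_itg => [||y]; [by apply: nnfunZ => //; exact: powR_ge0|exact: nnfunM|].
    rewrite indicE; case: (boolP (y \in Qc q)) => [/set_mem qy|_] /=; last by rewrite mulr0 mul0r.
    rewrite mulr1 mul1r; apply: le_powR2 => //; first exact: ltW.
    rewrite -[leLHS]mulr1 -[X in _ * X](_ : \1_(Qc q) y = 1); last by rewrite indicE mem_set.
    exact: (@le_bigmax_seq _ _ _ _ _ _ xpredT (fun q => al q * \1_(Qc q) y) qs).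
  have mf : mean mu q f = al q * (S q / vol q) by rewrite mulrA alE// mulfK// gt_eqF.
  rewrite mf powRM ?divr_ge0 ?(ltW S0) ?(ltW v0)// powR_div ?(ltW S0)//.
  apply: (@le_trans _ _ (be q * V q / vol q * (S q `^ (p - 1) / vol q `^ (p - 1)))).
    apply: ler_wpM2r; first by rewrite divr_ge0// powR_ge0.
    by rewrite beE// mulfK// gt_eqF.
  rewrite (powR_mul1B (ltW p1) (ltW v0)) in hAq.
  have vp := powR_gt0 (p - 1) v0.
  move: (vol q `^ (p - 1)) vp hAq => u u0 hAq.
  rewrite (_ : be q * V q / vol q * (S q `^ (p - 1) / u) =
    be q * ((V q * S q `^ (p - 1)) / (vol q * u))); last by field; rewrite !gt_eqF.
  by rewrite mulrC; apply: ler_wpM2r => //; rewrite ler_pdivrMr// mulr_gt0.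
apply: (@le_trans _ _ (itg mu (fun x => A `^ p' * (N2 x `^ p' * v x)))).
  apply: le_itg => [||x].
  - by apply: nnfunM => //; apply: nnfun_pow; case: nM.
  - apply: nnfunZ; first exact: powR_ge0.
    by apply: nnfunM => //; apply: nnfun_pow; case: nN2.
  - by rewrite mulrA; apply: ler_wpM2r => //; exact: nv.2.
rewrite itgZ ?powR_ge0//; last first.
  by apply: nnfunM => //; apply: nnfun_pow; case: nN2.
rewrite !EFinM -!muleA; apply: lee_wpmul2l; first by rewrite lee_fin powR_ge0.
apply: le_trans step2 _; apply: lee_wpmul2l; first by rewrite lee_fin powR_ge0.
exact: step1.
Qed.

End muckenhoupt.

(** * First consequences of the vector-valued bound: integrability on cubes *)

Section vector_bound_consequences.
Context {R : realType} {d : nat}.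
Variables (mu : {measure set (d.-tuple R) -> \bar R}) (Xs : bfs mu).
Hypothesis hmu : is_lebesgue mu.
Local Notation T := (d.-tuple R).
Local Notation Qi := (@Qidx d).
Local Notation Qc := (@Qcube R d).
Implicit Types (f g w : T -> R) (q : Qi) (s : seq Qi).

Lemma lr_pt_finite (r : R) s (m : Qi -> T -> R) x : 0 < r -> uniq s ->
  (forall q, q \notin s -> m q x = 0) ->
  lr_pt r (fun q y => (m q y)%:E) x = ((\sum_(q <- s) `|m q x| `^ r) `^ r^-1)%:E.
Proof.
move=> r0 us ms; rewrite /lr_pt -poweR_EFin; congr (_ `^ _)%E.
have a0 q : (0 <= `|(m q x)%:E| `^ r)%E by exact: poweR_ge0.
rewrite -sumEFin (eq_bigr (fun q => (`|(m q x)%:E| `^ r)%E)); last first.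
  by [].
rewrite (fsbig_seq _ _ us)/= -esum_fset; [|exact: finite_seq|by move=> q _].
rewrite esum_mkcond; apply: eq_esum => q _; case: ifPn => // /negP qs.
rewrite ms; last by apply/negP => h; apply: qs; apply/mem_set.
by rewrite /= normr0 powR0// gt_eqF.
Qed.

Variable r : R.
Hypothesis r1 : 1 < r.
Hypothesis hM : Mcal_bounded Xs r.

Let r0 : 0 < r. Proof. by apply: lt_trans r1. Qed.
Let rn : r != 0. Proof. by rewrite gt_eqF. Qed.

(** The family is extended by 0 outside s. Integrability over the cubes comes for free: an infinite
    average would make [Mcal] infinite on a whole cube, against its almost everywhere finiteness. *)
Lemma finite_vector_bound : exists2 C : R, 0 <= C & forall s (F : Qi -> T -> R),
  uniq s -> (forall q, nnfun (F q)) ->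
  bX Xs (fun x => (\sum_(q <- s) F q x `^ r) `^ r^-1) ->
  let H := fun x => (\sum_(q <- s) (mean mu q (F q) * \1_(Qc q) x) `^ r) `^ r^-1 in
  [/\ forall q, q \in s -> (itg mu (fun x => \1_(Qc q) x * F q x)%R < +oo)%E, bX Xs H
    & nrm Xs H <= C * nrm Xs (fun x => (\sum_(q <- s) F q x `^ r) `^ r^-1)].
Proof.
have [C hC] := hM; exists `|C|; first exact: normr_ge0.
move=> s F us nF XG H.
pose F' q x : R := if q \in s then F q x else 0.
have GE x : lr_pt r (fun q y => (F' q y)%:E) x = ((\sum_(q <- s) F q x `^ r) `^ r^-1)%:E.
  have F's q : q \notin s -> F' q x = 0 by move=> /negbTE qs; rewrite /F' qs.
  rewrite (lr_pt_finite r0 us F's).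
  rewrite big_seq [in RHS]big_seq; congr (_ `^ _)%:E; apply: eq_bigr => q qs.
  by rewrite /F' qs ger0_norm// (nF q).2.
have FE : fine \o lr_pt r (fun q y => (F' q y)%:E) = (fun x => (\sum_(q <- s) F q x `^ r) `^ r^-1).
  by apply/funext => x /=; rewrite GE.
have [] := hC F'.
  split=> [q|q||].
  - rewrite (_ : fine \o _ = F' q); last by apply/funext.
    by rewrite /F'; case: (q \in s); [case: (nF q)|exact: measurable_cst].
  - exact: aeW.
  - by apply: aeW => x; rewrite GE.
  - by rewrite FE.
rewrite /Xlr_nrm FE => -[_ h2 _ h4] h5.
have fin q : q \in s -> (itg mu (fun x => \1_(Qc q) x * F q x)%R < +oo)%E.
  move=> qs; have [N [mN N0 hN]] := h2 q.
  have [x [Qx Nx]] : exists x, Qc q x /\ ~ N x.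
    apply: contrapT => hn.
    have : (mu (Qc q) <= mu N)%E.
      apply: le_measure; rewrite ?inE//; first exact: measurable_Qcube.
      by move=> x Qx; apply: contrapT => Nx; apply: hn; exists x.
    by rewrite N0 mu_Qcube// lee_fin leNgt vol_gt0.
  have : Mcal mu F' q x \is a fin_num by apply: contrapT => h; apply: Nx; exact: hN.
  rewrite /Mcal indicE mem_set//= mule1 /avg itg_setE; last exact: measurable_Qcube.
  rewrite mu_Qcube//= (_ : F' q = F q); last by rewrite /F' qs; apply/funext.
  rewrite ltey => h; apply/eqP => hy; move: h; rewrite hy.
  by rewrite gt0_mulye// lte_fin invr_gt0 vol_gt0.
have ME q x : Mcal mu F' q x = ((if q \in s then mean mu q (F q) else 0) * \1_(Qc q) x)%:E.
  rewrite /Mcal EFinM; congr (_ * _)%E.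
  rewrite /avg itg_setE; last exact: measurable_Qcube.
  rewrite mu_Qcube//= /F'; case: ifPn => qs; last first.
    rewrite (_ : itg _ _ = 0%E) ?mul0e// -(itg0 mu); apply: itg_ext => y.
    by rewrite mulr0.
  rewrite /mean EFinM fineK//; apply: itg_fin_num; last exact: fin.
  exact: nnfun_indicM.
have HE x : lr_pt r (Mcal mu F') x = (H x)%:E.
  have -> : Mcal mu F' = (fun q y => ((if q \in s then mean mu q (F q) else 0) * \1_(Qc q) y)%:E).
    by apply/funext => q; apply/funext => y; rewrite ME.
  pose m q y : R := (if q \in s then mean mu q (F q) else 0) * \1_(Qc q) y.
  have ms q : q \notin s -> m q x = 0 by move=> /negbTE qs; rewrite /m qs mul0r.
  rewrite (lr_pt_finite r0 us ms) /m.
  rewrite /H big_seq [in RHS]big_seq; congr (_ `^ _)%:E; apply: eq_bigr => q ->.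
  by rewrite ger0_norm// mulr_ge0 ?mean_ge0// indicE.
have HF : fine \o lr_pt r (Mcal mu F') = H by apply/funext => x /=; rewrite HE.
rewrite HF in h4 h5; split=> //; apply: le_trans h5 _.
by apply: ler_wpM2r; [exact: nrm_ge0|exact: ler_norm].
Qed.

Lemma bX_locint_vector f : bX Xs f -> locint mu f.
Proof.
move=> Xf; split=> [|q]; first exact: X_meas Xf.
have [C _ hC] := finite_vector_bound.
have [|||h _ _] := hC [:: q] (fun _ x => `|f x|) => //.
- by move=> p; apply: nnfun_norm; exact: X_meas Xf.
- rewrite (_ : (fun x => _) = (fun x => `|f x|)); first by case: (bX_norm Xf).
  by apply/funext => x; rewrite big_seq1 powRK.
- by apply: h; rewrite mem_head.
Qed.

(** Saturation gives P in Q of positive measure with \1_P in X; averaging over Q turns \1_P into a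
    positive multiple of \1_Q. *)
Lemma bX_indic_Qcube q : bX Xs \1_(Qc q).
Proof.
have mQ := measurable_Qcube (R := R) q.
have : (0 < mu (Qc q))%E by rewrite mu_Qcube// lte_fin vol_gt0.
move=> /(X_saturation Xs mQ) [P [mP PQ P0 XP]].
have [C _ hC] := finite_vector_bound.
have nP : nnfun (\1_P : T -> R) by exact: nnfun_indic.
have [|||h XH _] := hC [:: q] (fun _ => \1_P) => //.
- rewrite (_ : (fun x => _) = \1_P)//.
  by apply/funext => x; rewrite big_seq1 powRK// indicE.
have e : (fun x => (\sum_(p <- [:: q]) (mean mu p \1_P * \1_(Qc p) x) `^ r) `^ r^-1)
    = (fun x => mean mu q \1_P * \1_(Qc q) x).
  by apply/funext => x; rewrite big_seq1 powRK// mulr_ge0 ?mean_ge0// indicE.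
rewrite e in XH.
have lP : locint mu \1_P by exact: bX_locint_vector.
have m0 : 0 < mean mu q \1_P.
  rewrite -(pmulr_lgt0 _ (vol_gt0 (R := R) q)) -lte_fin -itg_mean//.
  rewrite (@itg_ext _ _ _ mu _ \1_P) ?itg_indic// => x.
  rewrite !indicE; case: (boolP (x \in P)) => [/set_mem /PQ ?|_]; last by rewrite mulr0.
  by rewrite mem_set// mulr1.
rewrite (_ : \1_(Qc q) = (fun x => (mean mu q \1_P)^-1 * (mean mu q \1_P * \1_(Qc q) x))).
  exact: X_scale.
by apply/funext => x; rewrite mulrA mulVf ?mul1r// gt_eqF.
Qed.

(** A bound c > 0 on the norm is used for the scaling, since the norm itself may be 0. *)
Lemma pow_dual_scale (B c : R) w f : nnfun w -> pow_dual_le Xs r B w -> bX Xs f ->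
  nrm Xs f <= c -> 0 < c ->
  (itg mu (fun x => `|f x| `^ r * w x)%R <= (c `^ r * B)%:E)%E.
Proof.
move=> nw hw Xf fc c0.
have := hw (fun x => c^-1 * f x) (X_scale _ Xf).
rewrite nrm_scale_ge0 ?invr_ge0 ?(ltW c0)// mulrC ler_pdivrMr// mul1r => /(_ fc) h.
have mf := X_meas Xf.
rewrite (_ : itg _ _ = ((c `^ r)%:E * itg mu (fun x => `|c^-1 * f x| `^ r * w x)%R)%E).
  by rewrite EFinM; apply: lee_wpmul2l => //; rewrite lee_fin powR_ge0.
rewrite -itgZ ?powR_ge0//.
  apply: itg_ext => x; rewrite mulrA -powRM ?(ltW c0)//.
  by rewrite normrM gtr0_norm ?invr_gt0// mulrA mulfV ?mul1r// gt_eqF.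
apply: nnfunM => //; apply: nnfun_pow; apply: (nnfun_norm _).1.
by apply: measurable_funM => //; exact: measurable_cst.
Qed.

Lemma pow_dual_Qcube (B : R) w q : nnfun w -> pow_dual_le Xs r B w ->
  (itg mu (fun x => \1_(Qc q) x * w x)%R < +oo)%E.
Proof.
move=> nw hw; have XQ := bX_indic_Qcube q.
have c0 : 0 < nrm Xs \1_(Qc q) + 1 by rewrite ltr_wpDl// nrm_ge0.
have := pow_dual_scale nw hw XQ _ c0; rewrite lerDl ler01 => /(_ isT) h.
apply: (@le_lt_trans _ _ (((nrm Xs \1_(Qc q) + 1) `^ r * B)%:E)); last by rewrite ltry.
apply: le_trans h; rewrite le_eqVlt; apply/orP; left; apply/eqP; apply: itg_ext => x.
by rewrite indicE; case: (_ \in _); rewrite ?normr1 ?powR1// normr0 powR0.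
Qed.

End vector_bound_consequences.

(** * Convexity inequalities for the separation argument *)

Section two_term_inequalities.
Context {R : realType}.

Lemma weighted_hoelder2 (r t al be x y : R) : 1 < r -> 0 <= t -> 0 <= 1 - t ->
  0 <= al -> 0 <= be -> 0 <= x -> 0 <= y ->
  t * al `^ (r - 1) * x + (1 - t) * be `^ (r - 1) * y <=
  ((t * al `^ r + (1 - t) * be `^ r) `^ r^-1) `^ (r - 1) *
  (t * x `^ r + (1 - t) * y `^ r) `^ r^-1.
Proof.
move=> r1 t0; move: (1 - t) => u u0 al0 be0 x0 y0; have r0 : 0 < r by lra.
have rn : r != 0 by rewrite gt_eqF.
have rm : r - 1 != 0 by rewrite gt_eqF//; lra.
pose q := r / (r - 1).
have q0 : 0 < q by rewrite divr_gt0; lra.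
have qn : q != 0 by rewrite gt_eqF.
have q1 : r^-1 + q^-1 = 1 by rewrite /q invf_div; field.
have split_t (z : R) : 0 <= z -> z `^ r^-1 * z `^ q^-1 = z.
  by move=> z0; rewrite -powRD q1 ?powRr1// oner_eq0.
have e1 (z w : R) : 0 <= z -> 0 <= w -> (z `^ r^-1 * w) `^ r = z * w `^ r.
  by move=> z0 w0; rewrite (powRM _ (powR_ge0 _ _) w0) (powRVK rn z0).
have e2 (z w : R) : 0 <= z -> 0 <= w -> (z `^ q^-1 * w `^ (r - 1)) `^ q = z * w `^ r.
  move=> z0 w0; rewrite (powRM _ (powR_ge0 _ _) (powR_ge0 _ _)) (powRVK qn z0).
  by rewrite -powRrM (_ : (r - 1) * q = r)// /q; field.
have := @hoelder2 _ (t `^ r^-1 * x) (u `^ r^-1 * y)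
   (t `^ q^-1 * al `^ (r - 1)) (u `^ q^-1 * be `^ (r - 1)) r q
   (mulr_ge0 (powR_ge0 _ _) x0) (mulr_ge0 (powR_ge0 _ _) y0)
   (mulr_ge0 (powR_ge0 _ _) (powR_ge0 _ _)) (mulr_ge0 (powR_ge0 _ _) (powR_ge0 _ _))
   r0 q0 q1.
rewrite (e1 _ _ t0 x0) (e1 _ _ u0 y0) (e2 _ _ t0 al0) (e2 _ _ u0 be0).
rewrite -[(_ `^ r^-1) `^ (r - 1)]powRrM (_ : r^-1 * (r - 1) = q^-1); last first.
  by rewrite /q invf_div mulrC.
rewrite [X in X + _ <= _]mulrACA (split_t _ t0) [X in _ + X <= _]mulrACA (split_t _ u0).
by rewrite [X in _ <= X]mulrC (mulrC x) (mulrC y) !mulrA.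
Qed.

Lemma powR_cvx_le (r t x y : R) : 1 < r -> 0 <= t <= 1 -> 0 <= x -> 0 <= y ->
  (t * x `^ r + (1 - t) * y `^ r) `^ r^-1 <= x + y.
Proof.
move=> r1 /andP[t0 t1] x0 y0; have r0 : 0 <= r by lra.
have s0 : 0 <= x + y by exact: addr_ge0.
rewrite -[leRHS](@powRK _ r)//; last by rewrite gt_eqF//; lra.
apply: le_powR2; first by rewrite invr_ge0.
  by rewrite addr_ge0// mulr_ge0 ?powR_ge0//; lra.
have hx : x `^ r <= (x + y) `^ r by apply: le_powR2 => //; lra.
have hy : y `^ r <= (x + y) `^ r by apply: le_powR2 => //; lra.
nra.
Qed.

Lemma powR_add_le (r x y : R) : 0 < r -> 0 <= x -> 0 <= y ->
  (x + y) `^ r <= 2 `^ r * (x `^ r + y `^ r).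
Proof.
move=> r0 x0 y0; wlog xy : x y x0 y0 / x <= y.
  move=> h; have [xy|/ltW yx] := leP x y; first exact: h.
  by rewrite addrC [X in _ * X]addrC; exact: h.
apply: (@le_trans _ _ ((2 * y) `^ r)).
  by apply: le_powR2; [exact: ltW|exact: addr_ge0|lra].
by rewrite powRM//; apply: ler_wpM2l; rewrite ?lerDr powR_ge0.
Qed.

(** Closing arithmetic of the distance estimate for convex sets: the first term contributes at most
    1/2, so J, the squared L^2 norm of the difference, must supply the rest. *)
Lemma dist_lower_bound (tau Om Ov J : R) : 0 < tau -> 0 <= Ov -> 0 <= J ->
  tau * Om <= 1 -> 1 <= (tau * Om + J / tau * Ov) / 2 -> tau / (Ov + 1) <= J.
Proof.
move=> t0 Ov0 J0 h1 h2; rewrite ler_pdivrMr; last by lra.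
have h3 : 1 <= J / tau * Ov by lra.
have := ler_wpM2l (ltW t0) h3.
rewrite mulr1 mulrA [tau * _]mulrC divfK ?gt_eqF//; lra.
Qed.

End two_term_inequalities.

Section mean_powers.
Context {R : realType} {d : nat}.
Variable mu : {measure set (d.-tuple R) -> \bar R}.
Hypothesis hmu : is_lebesgue mu.
Local Notation T := (d.-tuple R).
Local Notation Qi := (@Qidx d).
Local Notation Qc := (@Qcube R d).
Implicit Types (f g k a b : T -> R) (q : Qi).

Lemma nnfun_locint_le f g : nnfun f -> nnfun g -> locint mu g ->
  (forall x, f x <= g x) -> locint mu f.
Proof.
move=> nf ng lg fg; apply: (locint_le lg nf.1); apply: aeW => x.
by rewrite (ger0_norm (nf.2 x)) (ger0_norm (ng.2 x)).
Qed.

Lemma locint_cst (c : R) : locint mu (fun=> c).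
Proof. by apply: (locint_bounded hmu (b := `|c|)) => //; exact: measurable_cst. Qed.

Lemma mean_cst q (c : R) : 0 <= c -> mean mu q (fun=> c) = c.
Proof.
move=> c0; apply: (mulIf (vol_neq0 (R := R) q)); apply: EFin_inj.
rewrite -itg_mean; [|exact: nnfun_cst|exact: locint_cst].
rewrite (@itg_ext _ _ _ mu _ (fun x => c * \1_(Qc q) x)); last by move=> x; rewrite mulrC.
have mQ := measurable_Qcube (R := R) q.
by rewrite (itgZ mu c0 (nnfun_indic mQ)) (itg_indic mu mQ) mu_Qcube.
Qed.

Lemma locint_root (r : R) k : 1 < r -> nnfun k -> locint mu k ->
  locint mu (fun x => k x `^ r^-1).
Proof.
move=> r1 nk lk; have ir1 : r^-1 < 1 by rewrite invf_lt1//; lra.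
have ir0 : 0 < r^-1 by rewrite invr_gt0; lra.
have n1 : nnfun (fun _ : T => 1 : R) by exact: nnfun_cst.
apply: (@nnfun_locint_le _ (fun x => k x + 1)).
- by apply: nnfun_pow; case: nk.
- exact: nnfunD.
- by apply: locintD => //; exact: locint_cst.
move=> x; have k0 := nk.2 x.
have := @powR_interp _ r^-1 1 (k x); rewrite ir0 (ltW ir1) => /(_ isT k0).
by rewrite divr1 powRr1//; nra.
Qed.

Lemma mean_root (r : R) q k : 1 < r -> nnfun k -> locint mu k ->
  mean mu q (fun x => k x `^ r^-1) `^ r <= mean mu q k.
Proof.
move=> r1 nk lk; have r0 : 0 < r by lra.
have nr : nnfun (fun x => k x `^ r^-1) by apply: nnfun_pow; case: nk.
rewrite -(powR_le_root r0 (mean_ge0 mu q nr) (mean_ge0 mu q nk)).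
have := @mean_holder _ _ mu q r _ _ (fun=> 1) r1 nr nk (nnfun_cst ler01)
  (locint_root r1 nk lk) lk (locint_cst 1).
rewrite mean_cst// powR1 mulr1; apply; apply: aeW => x.
by rewrite mulr1.
Qed.

(** Minkowski's inequality for the two-point l^r norm, proved by pairing with the extremal vector
    (al^(r-1), be^(r-1)). It makes the target set of the separation argument convex. *)
Lemma mean_cvx (r t : R) q a b : 1 < r -> 0 <= t <= 1 ->
  nnfun a -> nnfun b -> locint mu a -> locint mu b ->
  let F := fun x => (t * a x `^ r + (1 - t) * b x `^ r) `^ r^-1 in
  [/\ nnfun F, locint mu F
    & t * mean mu q a `^ r + (1 - t) * mean mu q b `^ r <= mean mu q F `^ r].
Proof.
move=> r1 t01 na nb la lb F; have r0 : 0 < r by lra.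
have rn : r != 0 by rewrite gt_eqF.
have alg (a1 A1 b1 B1 : R) :
    t * (a1 * A1) + (1 - t) * (b1 * B1) <= t * A1 * a1 + (1 - t) * B1 * b1.
  by rewrite le_eqVlt; apply/orP; left; apply/eqP; ring.
move/andP: (t01) => [t0 t1]; have t1' : 0 <= 1 - t by lra.
have nap : nnfun (fun x => a x `^ r) by apply: nnfun_pow; case: na.
have nbp : nnfun (fun x => b x `^ r) by apply: nnfun_pow; case: nb.
have nF : nnfun F.
  by apply: nnfun_pow; apply: (nnfunD (nnfunZ t0 nap) (nnfunZ t1' nbp)).1.
have lF : locint mu F.
  apply: (nnfun_locint_le nF (nnfunD na nb) (locintD la lb)) => x.
  by apply: powR_cvx_le => //; [exact: na.2|exact: nb.2].
split=> //; set al := mean mu q a; set be := mean mu q b.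
have al0 : 0 <= al by exact: mean_ge0.
have be0 : 0 <= be by exact: mean_ge0.
set S := t * al `^ r + (1 - t) * be `^ r.
have S0 : 0 <= S by rewrite addr_ge0// mulr_ge0// powR_ge0.
have [->|Sn] := eqVneq S 0; first exact: powR_ge0.
pose M := S `^ r^-1.
have M0 : 0 < M by rewrite powR_gt0// lt_def Sn.
have mF0 : 0 <= mean mu q F by exact: mean_ge0.
suff : M <= mean mu q F.
  by move=> h; rewrite -[leLHS](@powRVK _ r)//; apply: le_powR2 => //; exact: ltW.
have Mr : 0 < M `^ (r - 1) by exact: powR_gt0.
rewrite -(ler_pM2l Mr).
have Fpt x : t * al `^ (r - 1) * a x + (1 - t) * be `^ (r - 1) * b x <= M `^ (r - 1) * F x.
  have a0 := na.2 x; have b0 := nb.2 x.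
  exact: weighted_hoelder2.
have c1 : 0 <= t * al `^ (r - 1) by rewrite mulr_ge0// powR_ge0.
have c2 : 0 <= (1 - t) * be `^ (r - 1) by rewrite mulr_ge0// powR_ge0.
have := @le_mean _ _ mu q (fun x => t * al `^ (r - 1) * a x + (1 - t) * be `^ (r - 1) * b x)
  (fun x => M `^ (r - 1) * F x) (nnfunD (nnfunZ c1 na) (nnfunZ c2 nb)) (nnfunZ (ltW Mr) nF)
  (locintD (locintZ _ la) (locintZ _ lb)) (locintZ _ lF) (fun x _ => Fpt x).
rewrite (meanD q (nnfunZ c1 na) (nnfunZ c2 nb) (locintZ _ la) (locintZ _ lb)).
rewrite (meanZ q c1 na la) (meanZ q c2 nb lb) (meanZ q (ltW Mr) nF lF) -/al -/be.
apply: le_trans; rewrite [leLHS]mulrC -(powR_mul1B (ltW r1) (ltW M0)) /M powRVK//.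
rewrite /S (powR_mul1B (ltW r1) al0) (powR_mul1B (ltW r1) be0).
exact: alg.
Qed.

End mean_powers.

(** * The companion weight obtained by separation *)

Section weight_construction.
Context {R : realType} {d : nat}.
Variables (mu : {measure set (d.-tuple R) -> \bar R}) (Xs : bfs mu).
Hypothesis hmu : is_lebesgue mu.
Local Notation T := (d.-tuple R).
Local Notation Qi := (@Qidx d).
Local Notation Qc := (@Qcube R d).
Implicit Types (f g w : T -> R) (q : Qi) (s : seq Qi).
Variables (r K : R).
Hypothesis r1 : 1 < r.
Hypothesis hM : Mcal_bounded Xs r.
Hypothesis K0 : 0 <= K.
Hypothesis hK : forall u, pow_hull Xs r u ->
  bX Xs (fun x => u x `^ r^-1) /\ nrm Xs (fun x => u x `^ r^-1) <= K.

(* The two-weight A_r condition for the pair (w, W), tested on bounded functions. *)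
Definition ar_pair (G : R) s w (W : T -> R) := forall q f (b : R), q \in s ->
  nnfun f -> (forall x, f x <= b) ->
  ((mean mu q f `^ r)%:E * itg mu (fun x => \1_(Qc q) x * w x)%R <=
   G%:E * itg mu (fun x => \1_(Qc q) x * (f x `^ r * W x))%R)%E.

Lemma sqint_locint f : sqint mu f -> nnfun f -> locint mu f.
Proof.
move=> sf nf; split=> [|q]; first by case: nf.
have mQ := measurable_Qcube (R := R) q.
have nQ : nnfun (\1_(Qc q) : T -> R) by exact: nnfun_indic.
have sQ : sqint mu (\1_(Qc q) : T -> R).
  split; first by case: nQ.
  rewrite (@itg_ext _ _ _ mu _ \1_(Qc q)); first by rewrite itg_indic// mu_Qcube// ltry.
  by move=> x; rewrite indicE; case: (_ \in _); rewrite ?expr1n// expr0n.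
rewrite (@itg_ext _ _ _ mu _ (fun x => \1_(Qc q) x * f x)); last first.
  by move=> x; rewrite (ger0_norm (nf.2 x)).
by rewrite (itg_ip sQ sf nQ nf) ltry.
Qed.

Lemma mean_sq_le q (tau : R) f : 0 < tau -> sqint mu f -> nnfun f ->
  mean mu q f <= (tau + (ip mu f f / tau) / vol q) / 2.
Proof.
move=> tau0 sf nf; have v0 := vol_gt0 (R := R) q.
have mQ := measurable_Qcube (R := R) q.
have nQ : nnfun (\1_(Qc q) : T -> R) by exact: nnfun_indic.
have eQ : itg mu (fun x => \1_(Qc q) x ^+ 2) = (vol q)%:E.
  rewrite (@itg_ext _ _ _ mu _ \1_(Qc q)); first by rewrite itg_indic// mu_Qcube.
  by move=> x; rewrite indicE; case: (_ \in _); rewrite ?expr1n// expr0n.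
have sQ : sqint mu (\1_(Qc q) : T -> R) by split; [case: nQ|rewrite eQ ltry].
have qQ : ip mu \1_(Qc q) \1_(Qc q) = vol q by apply: EFin_inj; rewrite ipE.
have e : mean mu q f * vol q = ip mu \1_(Qc q) f.
  by apply: EFin_inj; rewrite -(itg_mean q nf (sqint_locint sf nf)) (itg_ip sQ sf nQ nf).
have := ip_amgm tau sQ sf; rewrite qQ -e => h.
rewrite -(ler_pM2r (mulr_gt0 (mulr_gt0 tau0 v0) (ltr0n R 2))).
rewrite (_ : (tau + _ / vol q) / 2 * (tau * vol q * 2) = tau ^+ 2 * vol q + ip mu f f); last first.
  by field; rewrite !gt_eqF.
by apply: le_trans h; rewrite le_eqVlt; apply/orP; left; apply/eqP; ring.
Qed.

(** W separates the hull from the convex set [GG] of functions g dominating a sum of F_q^r with sum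
    of <F_q>^r w(Q) >= G. Testing W on a single function carried by one cube, rescaled into [GG],
    gives the two-weight inequality. G exceeds what the vector bound allows for families lying below
    a hull element, which keeps [GG] away from the hull. *)
Lemma weight_step : exists2 G : R, 0 < G & forall s w, uniq s -> nnfun w ->
  pow_dual_le Xs r 1 w -> exists W, [/\ nnfun W, pow_dual_le Xs r 1 W & ar_pair G s w W].
Proof.
have r0 : 0 < r by exact: lt_trans r1.
have rn : r != 0 by rewrite gt_eqF.
have ir0 : 0 < r^-1 by rewrite invr_gt0.
have [C C0 hC] := finite_vector_bound hmu r1 hM.
(* Bounds the norm of the averaged family when the family lies below a hull element; the 1 keeps c
   positive. *)
pose c := C * K + 1.
have c0 : 0 < c by rewrite ltr_wpDl// mulr_ge0.
(* 2^r comes from (x + y)^r <= 2^r (x^r + y^r), c^r bounds what a family below a hull element can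
   reach, and the surplus 1 forces an L^2 gap. *)
pose G := 2 `^ r * (c `^ r + 1).
have p20 : 0 < 2 `^ r :> R by exact: powR_gt0.
have G0 : 0 < G by rewrite mulr_gt0// ltr_wpDl// powR_ge0.
exists G => // s w us nw hw.
have ofin q : (itg mu (fun x => \1_(Qc q) x * w x)%R < +oo)%E by exact: pow_dual_Qcube hw.
pose om q := fine (itg mu (fun x => \1_(Qc q) x * w x)%R).
have omE q : itg mu (fun x => \1_(Qc q) x * w x) = (om q)%:E.
  by rewrite /om fineK//; apply: itg_fin_num => //; exact: nnfun_indicM.
have om0 q : 0 <= om q by rewrite -lee_fin -omE; apply: itg_ge0; exact: nnfun_indicM.
pose GG : set (T -> R) := [set g | [/\ nnfun g, sqint mu g & exists F : Qi -> T -> R,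
  [/\ forall q, nnfun (F q), forall q, locint mu (F q),
      forall x, \sum_(q <- s) F q x `^ r <= g x
    & G <= \sum_(q <- s) mean mu q (F q) `^ r * om q]]].
have scaled_in_GG q f b : q \in s -> nnfun f -> (forall x, f x <= b) ->
    0 < mean mu q f `^ r * om q ->
    GG (fun x => G / (mean mu q f `^ r * om q) * (\1_(Qc q) x * f x `^ r)).
  move=> qs nf fb z0; set z := mean mu q f `^ r * om q in z0 *.
  have Gz0 : 0 <= G / z by apply: divr_ge0; exact: ltW.
  have nfp : nnfun (fun x => f x `^ r) by apply: nnfun_pow; case: nf.
  have ng := nnfunZ Gz0 (nnfun_indicM q nfp).
  have lf : locint mu f.
    by apply: (locint_bounded hmu nf.1 (b := b)) => x; rewrite (ger0_norm (nf.2 x)).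
  split=> //.
    have [n hn] := Qcube_centred (R := R) [:: q].
    apply: (@bounded_nnfun_sqint _ _ _ hmu _ (G / z * b `^ r) n) => // x.
    rewrite -[leRHS]mulrA; apply: (ler_wpM2l Gz0).
    have := powR_ge0 b r; rewrite !indicE; case: (boolP (x \in Qc q)) => [/set_mem qx|_] /= b0.
      rewrite mul1r mem_set ?mulr1; last by apply: (hn q) => //; rewrite mem_head.
      by apply: le_powR2 => //; [exact: ltW|exact: nf.2].
    by rewrite mul0r mulr_ge0.
  pose l := (G / z) `^ r^-1.
  have l0 : 0 <= l by exact: powR_ge0.
  have lr : l `^ r = G / z by rewrite powRVK.
  pose fq x := \1_(Qc q) x * f x.
  have nfq : nnfun fq by exact: nnfun_indicM.
  have lfq : locint mu fq.
    apply: (nnfun_locint_le nfq nf lf) => x; have := nf.2 x.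
    by rewrite /fq indicE; case: (_ \in _) => /=; rewrite ?mul1r ?mul0r.
  have mfq : mean mu q fq = mean mu q f.
    rewrite /mean; congr (fine _ / _); apply: itg_ext => x.
    by rewrite /fq indicE; case: (_ \in _) => /=; rewrite ?mul1r ?mul0r.
  have nF p : nnfun (fun x => if p == q then l * fq x else 0).
    by case: (p == q); [exact: nnfunZ|exact: nnfun_cst].
  exists (fun p x => if p == q then l * fq x else 0); split.
  - exact: nF.
  - by move=> p; case: (p == q); [exact: locintZ|exact: locint_cst].
  - move=> x; rewrite (bigD1_seq q)//= eqxx big1 ?addr0; last first.
      by move=> p /negbTE ->; rewrite powR0.
    rewrite (powRM _ l0 (nfq.2 x)) lr; apply: ler_wpM2l => //.
    by rewrite /fq indicE; case: (_ \in _) => /=; rewrite ?mul1r// !mul0r powR0.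
  - rewrite (bigD1_seq q)//= eqxx (meanZ q l0 nfq lfq) mfq (powRM _ l0 (mean_ge0 mu q nf)) lr.
    rewrite -mulrA -/z divfK ?gt_eqF// lerDl; apply: sumr_ge0 => p _.
    by rewrite mulr_ge0// powR_ge0.
pose Om := \sum_(q <- s) om q.
have Om0 : 0 <= Om by apply: sumr_ge0.
pose Ov := \sum_(q <- s) om q / vol q.
have Ov0 : 0 <= Ov by apply: sumr_ge0 => q _; rewrite divr_ge0// ltW// vol_gt0.
(* Parameter of the bound <k> <= (tau + |k|^2 / (tau |Q|)) / 2, so small that its constant part
   contributes at most 1/2 to the weighted sum. *)
pose tau := (Om + 1)^-1.
have Om1 : 0 < Om + 1 by rewrite ltr_wpDl.
have Ov1 : 0 < Ov + 1 by rewrite ltr_wpDl.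
have tau0 : 0 < tau by rewrite invr_gt0.
(* Only positivity matters here: the distance depends on s and w, whereas G does not. *)
pose dist := tau / (Ov + 1).
have dist0 : 0 < dist by rewrite divr_gt0.
have distance_GG g u : GG g -> pow_hull Xs r u -> sqint mu u ->
    dist <= ip mu (fun x => g x - u x) (fun x => g x - u x).
  move=> [ng sg [F [h1 h2 h3 h4]]] hu su; have nu : nnfun u := hu.1.
  have sgu : sqint mu (fun x => g x - u x).
    have := sqintD 1 (-1) sg su; congr sqint; apply/funext => x; ring.
  pose k x := Num.max (g x - u x) 0.
  have nk : nnfun k by apply: nnfun_pos; exact: sgu.1.
  have ksq x : k x ^+ 2 <= (g x - u x) ^+ 2.
    by rewrite /k; case: (leP (g x - u x) 0) => //; rewrite expr0n sqr_ge0.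
  have sk : sqint mu k.
    split; first by case: nk.
    apply: le_lt_trans sgu.2; apply: le_itg => //.
    - by split=> [|x]; [apply: measurable_funX; case: nk|exact: sqr_ge0].
    - by split=> [|x]; [apply: measurable_funX; exact: sgu.1|exact: sqr_ge0].
  have kk : ip mu k k <= ip mu (fun x => g x - u x) (fun x => g x - u x).
    by apply: le_ip => // x; rewrite -!expr2.
  apply: le_trans kk.
  have lk := sqint_locint sk nk.
  pose kr x := k x `^ r^-1.
  have nkr : nnfun kr by apply: nnfun_pow; case: nk.
  have lkr : locint mu kr by exact: locint_root.
  (* Lowering every F_q by k^(1/r), with k the positive part of g - u, brings the family below u:
     where some F'_q is positive, superadditivity of t^r removes at least k from the sum of the
     F_q^r. *)
  pose F' q x := Num.max (F q x - kr x) 0.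
  have nF' q : nnfun (F' q).
    by apply: nnfun_pos; apply: measurable_funB; [case: (h1 q)|case: nkr].
  have F'F q x : F' q x <= F q x.
    by rewrite ge_max (h1 q).2 andbT gerBl nkr.2.
  have FF' q x : F q x <= F' q x + kr x by rewrite -lerBlDr le_max lexx.
  have lF' q : locint mu (F' q) by exact: (nnfun_locint_le (nF' q) (h1 q) (h2 q)).
  have F'r q x : F' q x `^ r <= F q x `^ r.
    by apply: le_powR2 => //; [exact: ltW|exact: (nF' q).2].
  have sF' x : \sum_(q <- s) F' q x `^ r <= u x.
    have [[q0 q0s F0]|hn] := pselect (exists2 q0, q0 \in s & 0 < F' q0 x); last first.
      rewrite big_seq big1 ?nu.2// => q qs.
      have -> : F' q x = 0; last by rewrite powR0.
      apply/eqP; rewrite eq_le (nF' q).2 andbT leNgt; apply/negP => h.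
      by apply: hn; exists q.
    have e : F q0 x = F' q0 x + kr x.
      move: F0; rewrite /F'; case: (leP (F q0 x - kr x) 0); first by rewrite ltxx.
      by move=> _ _; rewrite subrK.
    have h5 : F' q0 x `^ r + k x <= F q0 x `^ r.
      rewrite e -[X in _ + X <= _](powRVK rn (nk.2 x)).
      exact: (powR_superadd (ltW r1) (ltW F0) (nkr.2 x)).
    have h6 : \sum_(q <- s) F' q x `^ r + k x <= \sum_(q <- s) F q x `^ r.
      rewrite (big_rem q0)//= [leRHS](big_rem q0)//= addrAC; apply: lerD => //.
      by apply: ler_sum => q _.
    have h7 : g x - u x <= k x by rewrite le_max lexx.
    by have := h3 x; lra.
  have [Xu nu1] := hK hu.
  have S0 x : 0 <= \sum_(q <- s) F' q x `^ r by apply: sumr_ge0 => q _; exact: powR_ge0.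
  have nG' : nnfun (fun x => (\sum_(q <- s) F' q x `^ r) `^ r^-1).
    by apply: nnfun_pow; apply: (nnfun_sum _).1 => q _; apply: nnfun_pow; case: (nF' q).
  have [XG' nG'1] := bX_nnfun_le Xu nG' (fun x => le_powR2 (ltW ir0) (S0 x) (sF' x)).
  have [_ XH nH] := hC s F' us nF' XG'.
  have nHc : nrm Xs (fun x => (\sum_(q <- s) (mean mu q (F' q) * \1_(Qc q) x) `^ r) `^ r^-1) <= c.
    apply: le_trans nH _; apply: (@le_trans _ _ (C * K)); last by rewrite lerDl.
    by apply: ler_wpM2l => //; exact: le_trans nG'1 nu1.
  have hc : \sum_(q <- s) mean mu q (F' q) `^ r * om q <= c `^ r.
    have := pow_dual_scale nw hw XH nHc c0; rewrite mulr1.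
    rewrite (@itg_ext _ _ _ mu _ (fun x => \sum_(q <- s) mean mu q (F' q) `^ r * (\1_(Qc q) x * w x))).
      rewrite itg_sum; last first.
        by move=> q _; apply: nnfunZ; [exact: powR_ge0|exact: nnfun_indicM].
      rewrite (eq_bigr (fun q => (mean mu q (F' q) `^ r * om q)%:E)).
        by rewrite sumEFin lee_fin.
      by move=> q _; rewrite (itgZ mu (powR_ge0 _ _) (nnfun_indicM q nw)) omE.
    move=> x; rewrite (ger0_norm (powR_ge0 _ _)) powRVK//; last first.
      by apply: sumr_ge0 => q _; exact: powR_ge0.
    rewrite mulr_suml; apply: eq_bigr => q _; rewrite mulrA; congr (_ * _).
    rewrite indicE; case: (_ \in _) => /=; first by rewrite !mulr1.
    by rewrite !mulr0 powR0.
  (* The lowered family accounts for at most c^r of G / 2^r = c^r + 1; the averages of k^(1/r),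
     hence those of k, supply the rest. *)
  have hk : 1 <= \sum_(q <- s) mean mu q k * om q.
    rewrite -(ler_pM2l p20) mulr1 -(lerD2l (2 `^ r * c `^ r)).
    apply: (@le_trans _ _ G); first by rewrite /G mulrDr mulr1.
    apply: (le_trans h4); apply: (@le_trans _ _ (2 `^ r *
       (\sum_(q <- s) mean mu q (F' q) `^ r * om q + \sum_(q <- s) mean mu q k * om q))).
      rewrite -big_split/= mulr_sumr; apply: ler_sum => q _.
      rewrite -mulrDl mulrA; apply: ler_wpM2r => //.
      apply: (@le_trans _ _ ((mean mu q (F' q) + mean mu q kr) `^ r)).
        apply: le_powR2; [exact: ltW|exact: mean_ge0|].
        rewrite -(meanD q (nF' q) nkr (lF' q) lkr).
        apply: (le_mean (h1 q) (nnfunD (nF' q) nkr) (h2 q) (locintD (lF' q) lkr)) => x _.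
        exact: FF'.
      apply: (le_trans (powR_add_le r0 (mean_ge0 mu q (nF' q)) (mean_ge0 mu q nkr))).
      apply: ler_wpM2l; first exact: ltW.
      by rewrite lerD2l; exact: mean_root.
    by rewrite mulrDr lerD2r ler_pM2l.
  have hsum : \sum_(q <- s) mean mu q k * om q <= (tau * Om + ip mu k k / tau * Ov) / 2.
    rewrite /Om /Ov !mulr_sumr -big_split/= mulr_suml; apply: ler_sum => q _.
    apply: le_trans (ler_wpM2r (om0 q) (mean_sq_le q tau0 sk nk)) _.
    by rewrite le_eqVlt; apply/orP; left; apply/eqP; ring.
  have tO : tau * Om <= 1 by rewrite /tau mulrC ler_pdivrMr// mul1r lerDl.
  exact: (dist_lower_bound tau0 Ov0 (ip_ge0 mu k) tO (le_trans hk hsum)).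
have [GGn|GG0] := pselect (GG !=set0); last first.
  (* If [GG] is empty, every product <f>_Q^r w(Q) vanishes, since a positive one could be rescaled
     into [GG]; so the zero weight works. *)
  exists (fun=> 0); split; first exact: nnfun_cst.
    move=> f _ _; rewrite (@itg_ext _ _ _ mu _ (fun=> 0)) ?itg0 ?lee_fin//.
    by move=> x; rewrite mulr0.
  move=> q f b qs nf fb.
  have lf : locint mu f.
    by apply: (locint_bounded hmu nf.1 (b := b)) => x; rewrite (ger0_norm (nf.2 x)).
  rewrite omE -EFinM [leRHS](_ : _ = 0%E); last first.
    rewrite (@itg_ext _ _ _ mu _ (fun=> 0)) ?itg0 ?mule0//.
    by move=> x; rewrite !mulr0.
  rewrite lee_fin leNgt; apply/negP => z0; apply: GG0.
  by eexists; exact: (scaled_in_GG _ _ _ qs nf fb z0).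
have hE := exhaustion_centred_cube hmu.
have [||||||||W [nW W1 W2]] := @convex_separation _ _ _ mu _ hE (pow_hull Xs r) GG dist dist0.
- exact: pow_hull0.
- by move=> u [].
- by move=> u u'; exact: pow_hull_solid.
- by move=> f g t; exact: pow_hull_convex.
- exact: GGn.
- by move=> g [? ? _]; split.
- move=> g1 g2 t [n1 s1 [F1 [h1 h2 h3 h4]]] [n2 s2 [F2 [k1 k2 k3 k4]]] t01.
  move/andP: (t01) => [t0 t1]; have t1' : 0 <= 1 - t by rewrite subr_ge0.
  split; [exact: (nnfunD (nnfunZ t0 n1) (nnfunZ t1' n2))|exact: sqintD|].
  exists (fun q x => (t * F1 q x `^ r + (1 - t) * F2 q x `^ r) `^ r^-1); split.
  + by move=> q; have [] := mean_cvx q r1 t01 (h1 q) (k1 q) (h2 q) (k2 q).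
  + by move=> q; have [] := mean_cvx q r1 t01 (h1 q) (k1 q) (h2 q) (k2 q).
  + move=> x; rewrite (eq_bigr (fun q => t * F1 q x `^ r + (1 - t) * F2 q x `^ r)).
      by rewrite big_split/= -!mulr_sumr; apply: lerD; apply: ler_wpM2l.
    by move=> q _; rewrite powRVK// addr_ge0// mulr_ge0// powR_ge0.
  + apply: (@le_trans _ _ (t * (\sum_(q <- s) mean mu q (F1 q) `^ r * om q) +
       (1 - t) * (\sum_(q <- s) mean mu q (F2 q) `^ r * om q))).
      rewrite [leLHS](_ : _ = t * G + (1 - t) * G); last first.
        by rewrite -mulrDl addrC subrK mul1r.
      exact: (lerD (ler_wpM2l t0 h4) (ler_wpM2l t1' k4)).
    rewrite !mulr_sumr -big_split/=; apply: ler_sum => q _.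
    have [_ _ h] := mean_cvx q r1 t01 (h1 q) (k1 q) (h2 q) (k2 q).
    by have := ler_wpM2r (om0 q) h; rewrite mulrDl !mulrA.
- exact: distance_GG.
exists W; split=> //.
  by move=> f Xf f1; apply: W1; exact: pow_hull1.
move=> q f b qs nf fb; rewrite omE -EFinM.
have [z0|z0] := ltP 0 (mean mu q f `^ r * om q); last first.
  apply: (@le_trans _ _ 0%E); first by rewrite lee_fin.
  apply: mule_ge0; first by rewrite lee_fin ltW.
  by apply: itg_ge0; apply: nnfun_indicM; apply: nnfunM => //; apply: nnfun_pow; case: nf.
pose z := mean mu q f `^ r * om q; rewrite -/z in z0 *.
have nfp : nnfun (fun x => \1_(Qc q) x * (f x `^ r * W x)).
  by apply: nnfun_indicM; apply: nnfunM => //; apply: nnfun_pow; case: nf.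
have := W2 _ (scaled_in_GG _ _ _ qs nf fb z0); rewrite -/z.
rewrite (@itg_ext _ _ _ mu _ (fun x => G / z * (\1_(Qc q) x * (f x `^ r * W x)))); last first.
  by move=> x; rewrite !mulrA.
rewrite itgZ ?divr_ge0 ?(ltW G0) ?(ltW z0)//; set J := itg _ _ => hJ.
have -> : z%:E = (z%:E * 1)%E by rewrite mule1.
apply: (@le_trans _ _ (z%:E * ((G / z)%:E * J))%E).
  by apply: lee_wpmul2l; [rewrite lee_fin ltW|exact: ltW].
by rewrite muleA -EFinM mulrC divfK// gt_eqF.
Qed.

End weight_construction.

(** * Rubio de Francia iteration *)

Section weight_iteration.
Context {R : realType} {d : nat}.
Variables (mu : {measure set (d.-tuple R) -> \bar R}) (Xs : bfs mu).
Hypothesis hmu : is_lebesgue mu.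
Local Notation T := (d.-tuple R).
Local Notation Qi := (@Qidx d).
Local Notation Qc := (@Qcube R d).
Implicit Types (f g w : T -> R) (q : Qi) (s : seq Qi).
Variables (r K : R).
Hypothesis r1 : 1 < r.
Hypothesis hM : Mcal_bounded Xs r.
Hypothesis K0 : 0 <= K.
Hypothesis hK : forall u, pow_hull Xs r u ->
  bX Xs (fun x => u x `^ r^-1) /\ nrm Xs (fun x => u x `^ r^-1) <= K.

Lemma geometric_half_sum : (\sum_(0 <= n <oo) (2^-1 ^+ n)%:E)%E = 2%:E :> \bar R.
Proof.
have c : series (geometric (1 : R) 2^-1) @ \oo --> (1 * (1 - 2^-1)^-1 : R).
  by apply: cvg_geometric_series; rewrite ger0_norm; lra.
apply/cvg_lim => //; apply: (@cvg_trans _ ((EFin \o series (geometric (1 : R) 2^-1)) @ \oo)).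
  apply: near_eq_cvg; apply: nearW => n /=; rewrite /series/= sumEFin; congr EFin.
  by apply: eq_bigr => i _; rewrite mul1r.
rewrite (_ : 2%:E = (1 * (1 - 2^-1)^-1)%:E); last by congr EFin; field.
by apply: cvg_EFin => //; exact: nearW.
Qed.

(* Rubio de Francia iteration of weight_step. *)
Lemma ar_weight : exists2 G : R, 0 < G & forall s w, uniq s -> nnfun w ->
  pow_dual_le Xs r 1 w -> exists v, [/\ nnfun v, pow_dual_le Xs r 2 v,
    forall q, {ae mu, forall x, Qc q x -> w x <= v x} & ar_pair mu r G s v v].
Proof.
have r0 : 0 < r by exact: lt_trans r1.
have rn : r != 0 by rewrite gt_eqF.
have [G G0 step] := weight_step hmu r1 hM K0 hK.
exists (2 * G); first by rewrite mulr_gt0.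
move=> s w us nw hw.
(* With the hypotheses on w inside the chosen property, the step becomes a total map that can be
   iterated. *)
have /choice[st hst] : forall w, exists W, nnfun w /\ pow_dual_le Xs r 1 w ->
    [/\ nnfun W, pow_dual_le Xs r 1 W & ar_pair mu r G s w W].
  move=> w'; have [[n1 h1]|h] := pselect (nnfun w' /\ pow_dual_le Xs r 1 w').
    by have [W hW] := step s w' us n1 h1; exists W.
  by exists w' => /h.
pose wn n := iter n st w.
have hwn n : nnfun (wn n) /\ pow_dual_le Xs r 1 (wn n).
  elim: n => [|n [ih1 ih2]]; first by split.
  by have [] := hst (wn n) (conj ih1 ih2).
have harn n : ar_pair mu r G s (wn n) (wn n.+1).
  by have [] := hst (wn n) (hwn n).
have nwn n : nnfun (wn n) by case: (hwn n).
(* These coefficients sum to 2, the dual bound claimed for v. *)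
pose e n : R := 2^-1 ^+ n.
have e0 n : 0 <= e n by rewrite exprn_ge0.
have nen n : nnfun (fun x => e n * wn n x) by exact: nnfunZ.
pose vE x : \bar R := (\sum_(0 <= n <oo) (e n * wn n x)%:E)%E.
have vE0 x : (0 <= vE x)%E.
  by apply: nneseries_ge0 => n _ _; rewrite lee_fin; exact: (nen n).2.
(* v is 0 where the series diverges. Within each rational cube this is a null set: the indicator of
   the cube lies in X, so the series is integrable there. *)
pose v x := fine (vE x).
have mvE : measurable_fun setT vE.
  apply: ge0_emeasurable_sum => [n x _ _|n _]; first by rewrite lee_fin; exact: (nen n).2.
  by apply/measurable_EFinP; case: (nen n).
have nv : nnfun v.
  split=> [|x]; last exact: fine_ge0.
  exact: (measurableT_comp (fine_measurable measurableT) mvE).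
pose J g := (\int[mu]_x \sum_(0 <= n <oo) (g x * (e n * wn n x))%:E)%E.
have ng1 g n : nnfun g -> nnfun (fun x => g x * (e n * wn n x)) by move=> ng; exact: nnfunM.
have JE g : nnfun g -> J g = (\sum_(0 <= n <oo) ((e n)%:E * itg mu (fun x => g x * wn n x)%R))%E.
  move=> ng; rewrite /J integral_nneseries//.
  - apply: eq_eseriesr => n _; rewrite -itgZ//; last exact: nnfunM.
    by apply: itg_ext => x; rewrite mulrCA.
  - by move=> n; apply/measurable_EFinP; case: (ng1 g n ng).
  - by move=> n x _; rewrite lee_fin; exact: (ng1 g n ng).2.
have sumE g x : nnfun g -> vE x \is a fin_num ->
    (\sum_(0 <= n <oo) (g x * (e n * wn n x))%:E)%E = (g x * v x)%:E.
  move=> ng fx; rewrite EFinM /v fineK// -nneseriesZl//.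
  by move=> n _; rewrite lee_fin; exact: (nen n).2.
have mJ g : nnfun g -> measurable_fun setT (fun x => \sum_(0 <= n <oo) (g x * (e n * wn n x))%:E)%E.
  move=> ng; apply: ge0_emeasurable_sum => [n x _ _|n _].
    by rewrite lee_fin; exact: (ng1 g n ng).2.
  by apply/measurable_EFinP; case: (ng1 g n ng).
have J0 g x : nnfun g -> (0 <= \sum_(0 <= n <oo) (g x * (e n * wn n x))%:E)%E.
  by move=> ng; apply: nneseries_ge0 => n _ _; rewrite lee_fin; exact: (ng1 g n ng).2.
have leJ g : nnfun g -> (itg mu (fun x => g x * v x)%R <= J g)%E.
  move=> ng; have ngv : nnfun (fun x => g x * v x) by exact: nnfunM.
  apply: ge0_le_integral => //.
  - by move=> x _; rewrite lee_fin; exact: ngv.2.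
  - by apply/measurable_EFinP; case: ngv.
  - exact: mJ.
  - move=> x _; have [fx|fx] := boolP (vE x \is a fin_num); first by rewrite sumE.
    have -> : v x = 0 by rewrite /v; case: (vE x) fx.
    by rewrite mulr0; exact: J0.
have nfr f : bX Xs f -> nnfun (fun x => `|f x| `^ r).
  by move=> Xf; apply: nnfun_pow; exact: (nnfun_norm (X_meas Xf)).1.
have J2 f : bX Xs f -> nrm Xs f <= 1 -> (J (fun x => `|f x| `^ r)%R <= 2%:E)%E.
  move=> Xf f1; rewrite JE; last exact: nfr.
  rewrite -geometric_half_sum; apply: lee_nneseries => [n *|n *].
    by apply: mule_ge0; [rewrite lee_fin|apply: itg_ge0; apply: nnfunM => //; exact: nfr].
  rewrite -[leRHS]mule1; apply: lee_wpmul2l; first by rewrite lee_fin.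
  by have [_] := hwn n; apply.
have vfin q : {ae mu, forall x, Qc q x -> vE x \is a fin_num}.
  have XQ := bX_indic_Qcube hmu r1 hM q.
  pose c := (nrm Xs \1_(Qc q) + 1)^-1.
  have c1 : 0 < nrm Xs \1_(Qc q) + 1 by rewrite ltr_wpDl// nrm_ge0.
  have c0 : 0 < c by rewrite invr_gt0.
  have Xf := X_scale c XQ.
  have f1 : nrm Xs (fun x => c * \1_(Qc q) x) <= 1.
    by rewrite (nrm_scale_ge0 (ltW c0) XQ) mulrC ler_pdivrMr// mul1r lerDl.
  have ng := nfr _ Xf.
  have : mu.-integrable setT (fun x => \sum_(0 <= n <oo) (`|c * \1_(Qc q) x| `^ r * (e n * wn n x))%:E)%E.
    apply/integrableP; split; first exact: mJ ng.
    apply: le_lt_trans (le_trans (_ : _ <= J (fun x => `|c * \1_(Qc q) x| `^ r)%R)%E (J2 _ Xf f1)) (ltry _).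
    apply: ge0_le_integral => //; [exact: measurableT_comp (mJ _ ng)|exact: mJ ng|].
    by move=> x _; rewrite gee0_abs//; exact: J0 ng.
  move=> /(integrable_ae measurableT); apply: filterS => x /(_ I) fx qx.
  move: fx; rewrite indicE mem_set//= mulr1 (ger0_norm (ltW c0)).
  under eq_eseriesr do rewrite EFinM.
  rewrite nneseriesZl; last by move=> n _; rewrite lee_fin; exact: (nen n).2.
  rewrite -/(vE x) !ge0_fin_numE ?mule_ge0 ?lee_fin ?powR_ge0//.
  rewrite !ltey => h; apply/eqP => hy; move: h; rewrite hy gt0_muley ?eqxx//.
  by rewrite lte_fin powR_gt0.
exists v; split=> //.
- by move=> f Xf f1; apply: le_trans (leJ _ (nfr _ Xf)) (J2 _ Xf f1).
- move=> q; apply: filterS (vfin q) => x fx qx.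
  rewrite -lee_fin /v fineK ?fx//.
  apply: le_trans (nneseries_lim_ge 1 _); last by move=> k _ _; rewrite lee_fin; exact: (nen k).2.
  by rewrite big_nat1 /e expr0 mul1r.
- move=> q f b qs nf fb.
  have nf1 : nnfun (fun x => \1_(Qc q) x * f x `^ r).
    by apply: nnfun_indicM; apply: nnfun_pow; case: nf.
  have nQ : nnfun (\1_(Qc q) : T -> R) by apply: nnfun_indic; exact: measurable_Qcube.
  pose m := mean mu q f `^ r.
  have m0 : 0 <= m by exact: powR_ge0.
  have rhsE : itg mu (fun x => \1_(Qc q) x * (f x `^ r * v x)) = J (fun x => \1_(Qc q) x * f x `^ r).
    have nL : nnfun (fun x => \1_(Qc q) x * (f x `^ r * v x)).
      by apply: nnfun_indicM; apply: nnfunM => //; apply: nnfun_pow; case: nf.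
    apply: ge0_ae_eq_integral => //.
    - by apply/measurable_EFinP; case: nL.
    - exact: mJ.
    - by move=> x _; rewrite lee_fin; exact: nL.2.
    - by move=> x _; exact: (J0 _ x nf1).
    apply: filterS (vfin q) => x fx _ /=.
    have [qx|qx] := pselect (Qc q x).
      by rewrite (sumE _ _ nf1 (fx qx)) mulrA.
    rewrite indicE memNset//= mul0r eseries0// => n _ _.
    by rewrite !mul0r.
  rewrite rhsE JE//.
  apply: (@le_trans _ _ (m%:E * J \1_(Qc q))%E).
    by apply: lee_wpmul2l; [rewrite lee_fin|exact: leJ].
  rewrite JE// -nneseriesZl; last first.
    by move=> n _; apply: mule_ge0; [rewrite lee_fin|apply: itg_ge0; exact: nnfunM].
  rewrite -nneseriesZl; last first.
    by move=> n _; apply: mule_ge0; [rewrite lee_fin|apply: itg_ge0; exact: nnfunM].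
  (* As e n = 2 e (n + 1), bounding the term of wn n by that of wn (n + 1) shifts the series by one
     at the cost of a factor 2, whence 2 G; the omitted initial term is nonnegative. *)
  pose B n : \bar R := ((2 * G)%:E * ((e n)%:E * itg mu (fun x => (\1_(Qc q) x * f x `^ r) * wn n x)%R))%E.
  have B0 n : (0 <= B n)%E.
    apply: mule_ge0; first by rewrite lee_fin mulr_ge0// ltW.
    by apply: mule_ge0; [rewrite lee_fin|apply: itg_ge0; exact: nnfunM].
  apply: (@le_trans _ _ (\sum_(0 <= n <oo) B n.+1)%E).
    apply: lee_nneseries => [n *|n *].
      apply: mule_ge0; first by rewrite lee_fin.
      by apply: mule_ge0; [rewrite lee_fin|apply: itg_ge0; exact: nnfunM].
    rewrite muleCA.
    have -> : B n.+1 = ((e n)%:E * (G%:E * itg mu (fun x => (\1_(Qc q) x * (f x `^ r * wn n.+1 x)))%R))%E.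
      rewrite /B !muleA -!EFinM; congr (_%:E * _)%E; last by apply: itg_ext => x; rewrite mulrA.
      by rewrite /e exprS; field.
    by apply: lee_wpmul2l; [rewrite lee_fin|exact: (harn n q f b)].
  apply: lime_le; first by apply: is_cvg_nneseries => n _ _.
  apply: nearW => n; apply: le_trans (nneseries_lim_ge n.+1 (fun k _ _ => B0 k)).
  by rewrite big_nat_recl//= leeDr.
Qed.

End weight_iteration.

(** * Properties of a single A_r weight: conjugate weight, doubling, maximal bounds *)

Section ar_weights.
Context {R : realType} {d : nat}.
Variable mu : {measure set (d.-tuple R) -> \bar R}.
Hypothesis hmu : is_lebesgue mu.
Local Notation T := (d.-tuple R).
Local Notation Qi := (@Qidx d).
Local Notation Qc := (@Qcube R d).
Implicit Types (f g : T -> R) (q : Qi).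
Variables (r G : R) (v : T -> R) (s : seq Qi) (B : Qi).
Hypothesis r1 : 1 < r.
Hypothesis G0 : 0 < G.
Hypothesis nv : nnfun v.
Hypothesis hvfin : forall q, (itg mu (fun x => \1_(Qc q) x * v x)%R < +oo)%E.
Hypothesis hv : ar_pair mu r G s v v.
Hypothesis Bs : B \in s.
Hypothesis vB : (0 < itg mu (fun x => \1_(Qc B) x * v x)%R)%E.

(** The conjugate weight v^(1 - r') with r' = r / (r - 1); its exponent is nonzero, so it is 0 where
    v is 0. *)
Definition dual_weight x : R := v x `^ (- (r - 1)^-1).
Local Notation sigma := dual_weight.

Let rm : 0 < r - 1. Proof. by rewrite subr_gt0. Qed.
Let rmn : r - 1 != 0. Proof. by rewrite gt_eqF. Qed.
Let r0 : 0 < r. Proof. exact: lt_trans r1. Qed.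
Let rn : r != 0. Proof. by rewrite gt_eqF. Qed.

Lemma nnfun_dual_weight : nnfun sigma.
Proof. by apply: nnfun_pow; case: nv. Qed.

Lemma dual_weight_conj : conj_weights r v sigma.
Proof.
move=> x; have [v0|vn] := eqVneq (v x) 0.
  by left; split=> //; rewrite /dual_weight v0 powR0// oppr_eq0 invr_eq0.
have v0 : 0 < v x by rewrite lt_def vn nv.2.
right; split=> //; first exact: powR_gt0.
by rewrite /dual_weight -powRrM mulNr mulVf// powR_inv1 ?(ltW v0)// mulfV.
Qed.

(** Tested on the indicator of the zero set Z of v, the A_r inequality has right-hand side 0; as
    v(B) > 0, the average of \1_Z over B is 0. *)
Lemma ar_weight_gt0 : {ae mu, forall x, Qc B x -> 0 < v x}.
Proof.
pose Z := [set x | v x = 0].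
have mZ : measurable Z.
  have -> : Z = v @^-1` [set 0] by [].
  by rewrite -[_ @^-1` _]setTI; apply: nv.1 => //; exact: measurable_set1.
have nZ : nnfun (\1_Z : T -> R) by exact: nnfun_indic.
have Z1 x : \1_Z x <= 1 :> R by rewrite indicE; case: (_ \in _).
have lZ : locint mu \1_Z.
  by apply: (locint_bounded hmu nZ.1 (b := 1)) => x; rewrite (ger0_norm (nZ.2 x)).
have := hv Bs nZ Z1.
rewrite [X in (_ <= _ * X)%E](@itg_ext _ _ _ mu _ (fun=> 0)); last first.
  move=> x; rewrite [\1_Z x]indicE; case: (boolP (x \in Z)) => [/set_mem ->|_] /=; rewrite ?mulr0//.
  by rewrite powR0// mul0r mulr0.
rewrite itg0 mule0 => h.
have m0 : mean mu B \1_Z = 0.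
  apply/eqP; rewrite eq_le mean_ge0// andbT leNgt; apply/negP => mp; move: h.
  by rewrite leNgt mule_gt0// lte_fin powR_gt0.
have nBZ := nnfun_indicM B nZ.
have : itg mu (fun x => \1_(Qc B) x * \1_Z x) = 0%E by rewrite itg_mean// m0 mul0r.
move=> /(itg_eq0 nBZ); apply: filterS => x hx Bx; rewrite lt_def nv.2 andbT.
apply/negP => /eqP vx; move: hx; rewrite !indicE !mem_set//= mulr1 => h1.
have h2 : (1 : R) = 0 := h1.
by have := oner_neq0 R; rewrite h2 eqxx.
Qed.

Let V q : R := fine (itg mu (fun x => \1_(Qc q) x * v x)).
Let S q : R := fine (itg mu (fun x => \1_(Qc q) x * sigma x)).

Lemma weight_massE q : itg mu (fun x => \1_(Qc q) x * v x) = (V q)%:E.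
Proof. by rewrite /V fineK//; apply: itg_fin_num => //; exact: nnfun_indicM. Qed.

Lemma ae_pos_mass q f : nnfun f -> {ae mu, forall x, Qc q x -> 0 < f x} ->
  itg mu (fun x => \1_(Qc q) x * f x) <> 0%E.
Proof.
move=> nf fpos /(itg_eq0 (nnfun_indicM q nf)) h.
have : itg mu (\1_(Qc q) : T -> R) = 0%E.
  rewrite -(itg0 mu); apply: ae_eq_itg.
  - by apply: nnfun_indic; exact: measurable_Qcube.
  - exact: nnfun_cst.
  apply: filterS2 fpos h => x hx; rewrite indicE.
  case: (boolP (x \in Qc q)) => [/set_mem qx|_] //=; rewrite mul1r => fx.
  by have := hx qx; rewrite fx ltxx.
rewrite itg_indic; last exact: measurable_Qcube.
by rewrite mu_Qcube// => -[h']; have := vol_gt0 (R := R) q; rewrite h' ltxx.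
Qed.

Lemma weight_mass_gt0 q : Qc q `<=` Qc B -> 0 < V q.
Proof.
move=> qB; have V0 : 0 <= V q by rewrite -lee_fin -weight_massE; apply: itg_ge0; exact: nnfun_indicM.
rewrite lt_def V0 andbT; apply/negP => /eqP Vz.
apply: (@ae_pos_mass q v nv (filterS (fun x h qx => h (qB x qx)) ar_weight_gt0)).
by rewrite weight_massE Vz.
Qed.

(** The A_r inequality is tested on bounded truncations f of sigma. From f <= sigma follows f^r v <=
    f, hence <f>^(r-1) v(Q) <= G |Q|; this is uniform in the truncation, so it also shows that sigma
    has finite mass on Q. *)
Lemma dual_mass_le q : q \in s -> Qc q `<=` Qc B ->
  itg mu (fun x => \1_(Qc q) x * sigma x) = (S q)%:E /\
  V q * S q `^ (r - 1) <= G * vol q `^ r.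
Proof.
move=> qs qB; have V0 := weight_mass_gt0 qB; have v0 := vol_gt0 (R := R) q.
have ns := nnfun_dual_weight.
have hE := exhaustion_centred_cube hmu.
pose M := (G * vol q / V q) `^ (r - 1)^-1.
have M0 : 0 <= M by exact: powR_ge0.
have key : (itg mu (fun x => sigma x * \1_(Qc q) x)%R <= (M * vol q)%:E)%E.
  have nQ : nnfun (\1_(Qc q) : T -> R) by apply: nnfun_indic; exact: measurable_Qcube.
  apply: (itg_trunc_le hE ns nQ) => n.
  pose f := trunc (@centred_cube R d) n sigma.
  have nf : nnfun f by exact: (nnfun_trunc hE n ns).
  have fb x : f x <= n%:R.
    rewrite /f /trunc indicE; case: (_ \in _); rewrite ?mulr1 ?mulr0//.
    by rewrite ge_min lexx orbT.
  have lf : locint mu f.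
    by apply: (locint_bounded hmu nf.1 (b := n%:R)) => x; rewrite (ger0_norm (nf.2 x)).
  have fs x : f x <= sigma x by exact: trunc_le.
  have m0 := mean_ge0 mu q nf.
  have h1 : mean mu q f `^ r * V q <= G * (mean mu q f * vol q).
    have := hv qs nf fb; rewrite weight_massE -EFinM => h.
    rewrite -lee_fin; apply: le_trans h _; rewrite EFinM -itg_mean//.
    apply: lee_wpmul2l; first by rewrite lee_fin ltW.
    apply: le_itg => [||x].
    - by apply: nnfun_indicM; apply: nnfunM => //; apply: nnfun_pow; case: nf.
    - exact: nnfun_indicM.
    apply: ler_wpM2l; first by rewrite indicE.
    have f0 := nf.2 x; rewrite (powR_mul1B (ltW r1) f0) -mulrA ler_piMr//.
    case: (dual_weight_conj x) => [[-> _]|[vx sx e]]; first by rewrite mulr0.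
    rewrite -[leRHS]e mulrC.
    exact: (ler_wpM2l (ltW vx) (le_powR2 (ltW rm) f0 (fs x))).
  have h2 : mean mu q f <= M.
    rewrite /M (powR_le_root rm m0); last by rewrite divr_ge0 ?mulr_ge0 ?(ltW G0) ?(ltW v0) ?(ltW V0).
    rewrite ler_pdivlMr//; have [mz|mn] := eqVneq (mean mu q f) 0.
      by rewrite mz powR0// mul0r mulr_ge0 ?(ltW G0) ?(ltW v0).
    have mp : 0 < mean mu q f by rewrite lt_def mn.
    rewrite -(ler_pM2l mp) mulrA -(powR_mul1B (ltW r1) m0).
    by apply: le_trans h1 _; rewrite mulrCA.
  rewrite (@itg_ext _ _ _ mu _ (fun x => \1_(Qc q) x * f x)); last by move=> x; rewrite mulrC.
  by rewrite itg_mean// lee_fin; apply: ler_wpM2r => //; exact: ltW.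
have e : itg mu (fun x => sigma x * \1_(Qc q) x) = itg mu (fun x => \1_(Qc q) x * sigma x).
  by apply: itg_ext => x; rewrite mulrC.
rewrite e in key.
have SE : itg mu (fun x => \1_(Qc q) x * sigma x) = (S q)%:E.
  rewrite /S fineK//; apply: itg_fin_num; first exact: nnfun_indicM.
  exact: le_lt_trans key (ltry _).
split=> //; have S0 : 0 <= S q by rewrite -lee_fin -SE; apply: itg_ge0; exact: nnfun_indicM.
rewrite SE lee_fin in key.
have a0 : 0 <= G * vol q / V q by rewrite divr_ge0 ?mulr_ge0 ?(ltW G0) ?(ltW v0) ?(ltW V0).
apply: (@le_trans _ _ (V q * ((G * vol q / V q) * vol q `^ (r - 1)))).
  apply: ler_wpM2l; first exact: ltW.
  apply: (le_trans (le_powR2 (ltW rm) S0 key)).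
  by rewrite (powRM _ M0 (ltW v0)) /M (powRVK rmn a0).
rewrite (powR_mul1B (ltW r1) (ltW v0)) mulrA [V q * _]mulrC divfK ?gt_eqF//.
by rewrite mulrA.
Qed.

Lemma dual_mass_gt0 q : q \in s -> Qc q `<=` Qc B -> 0 < S q.
Proof.
move=> qs qB; have [SE _] := dual_mass_le qs qB; have ns := nnfun_dual_weight.
have S0 : 0 <= S q by rewrite -lee_fin -SE; apply: itg_ge0; exact: nnfun_indicM.
rewrite lt_def S0 andbT; apply/negP => /eqP Sz.
apply: (@ae_pos_mass q sigma ns (filterS (fun x h qx => powR_gt0 _ (h (qB x qx))) ar_weight_gt0)).
by rewrite SE Sz.
Qed.

(** Hölder's inequality for 1 = v^(1/r) sigma^(1 - 1/r); it complements the A_r bound from below. *)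
Lemma vol_le_masses q : q \in s -> Qc q `<=` Qc B -> vol q `^ r <= V q * S q `^ (r - 1).
Proof.
move=> qs qB; have [SE _] := dual_mass_le qs qB; have ns := nnfun_dual_weight.
have V0 := weight_mass_gt0 qB; have S0 := dual_mass_gt0 qs qB.
have nQ : nnfun (\1_(Qc q) : T -> R) by apply: nnfun_indic; exact: measurable_Qcube.
have h := @itg_holder _ _ _ mu r _ _ _ _ _ r1 nQ (nnfun_indicM q nv) (nnfun_indicM q ns)
  (weight_massE q) SE.
have {h} : vol q <= V q `^ r^-1 * S q `^ (1 - r^-1).
  rewrite -lee_fin -(mu_Qcube hmu) -itg_indic; last exact: measurable_Qcube.
  apply: h; apply: filterS ar_weight_gt0 => x hx; rewrite indicE.
  case: (boolP (x \in Qc q)) => [/set_mem /qB /hx vx|_] /=; last first.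
    by rewrite mulr_ge0// powR_ge0.
  rewrite !mul1r; case: (dual_weight_conj x) => [[v0 _]|[_ sx e]].
    by move: vx; rewrite v0 ltxx.
  apply: (@le_trans _ _ ((v x * sigma x `^ (r - 1)) `^ r^-1)).
    by rewrite e powR1.
  rewrite (powRM _ (ltW vx) (powR_ge0 _ _)) -[in leLHS]powRrM.
  by rewrite mulrBl mulfV// mul1r.
move=> /(le_powR2 (ltW r0) (ltW (vol_gt0 q))) /le_trans; apply.
rewrite (powRM _ (powR_ge0 _ _) (powR_ge0 _ _)) (powRVK rn (ltW V0)) -powRrM.
by rewrite mulrBl mulVf// mul1r.
Qed.

Let D : R := G * (3 ^+ d) `^ r.

(** The A_r bound on the triple is compared with [vol_le_masses] on the cube, where |3Q|^r = (3^d)^r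
    |Q|^r explains D. Monotonicity of one of the masses then isolates the other. *)
Lemma doubling_masses q : q \in s -> triple q \in s -> Qc (triple q) `<=` Qc B ->
  V (triple q) <= D * V q /\ S (triple q) <= D `^ (r - 1)^-1 * S q.
Proof.
move=> qs ts tB; have qB : Qc q `<=` Qc B by apply: subset_trans tB; exact: sub_triple.
have ns := nnfun_dual_weight.
have [SE _] := dual_mass_le qs qB; have [SEt h] := dual_mass_le ts tB.
have V0 := weight_mass_gt0 qB; have Vt := weight_mass_gt0 tB.
have S0 := dual_mass_gt0 qs qB; have St := dual_mass_gt0 ts tB.
have sub f : nnfun f -> (itg mu (fun x => \1_(Qc q) x * f x)%R <=
    itg mu (fun x => \1_(Qc (triple q)) x * f x)%R)%E.
  move=> nf; apply: le_itg => [||x]; try exact: nnfun_indicM.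
  apply: ler_wpM2r; first exact: nf.2.
  rewrite !indicE ler_nat; case: (boolP (x \in Qc q)) => // /set_mem qx.
  by rewrite mem_set//; exact: sub_triple.
have SS : S q <= S (triple q) by rewrite -lee_fin -SE -SEt; exact: sub.
have VV : V q <= V (triple q) by rewrite -lee_fin -!weight_massE; exact: sub.
have D0 : 0 <= D by apply: mulr_ge0; [exact: ltW|exact: powR_ge0].
have h' : V (triple q) * S (triple q) `^ (r - 1) <= D * (V q * S q `^ (r - 1)).
  apply: (le_trans h); rewrite vol_triple (powRM _ (exprn_ge0 _ (ler0n _ 3)) (ltW (vol_gt0 q))).
  rewrite mulrA; exact: (ler_wpM2l D0 (vol_le_masses qs qB)).
have Sp : 0 < S q `^ (r - 1) by exact: powR_gt0.
split.
  rewrite -(ler_pM2r Sp) -mulrA; apply: le_trans h'.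
  exact: (ler_wpM2l (ltW Vt) (le_powR2 (ltW rm) (ltW S0) SS)).
have h2 : S (triple q) `^ (r - 1) <= D * S q `^ (r - 1).
  rewrite -(ler_pM2l V0) mulrCA; apply: le_trans h'.
  exact: (ler_wpM2r (powR_ge0 _ _) VV).
rewrite -[leLHS](powRK rmn (ltW St)) -[X in _ * X](powRK rmn (ltW S0)).
rewrite -(powRM _ D0 (powR_ge0 _ _)); apply: (le_powR2 _ (powR_ge0 _ _) h2).
by rewrite invr_ge0; exact: ltW.
Qed.

Variable s1 : seq Qi.
Hypothesis hs1 : forall q, q \in s1 -> [/\ q \in s, triple q \in s & Qc (triple q) `<=` Qc B].

Let hs1' q : q \in s1 -> Qc q `<=` Qc B.
Proof. by move=> /hs1[_ _]; apply: subset_trans; exact: sub_triple. Qed.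

Lemma ar_maximal f : nnfun f -> locint mu f ->
  (itg mu (fun x => maxop mu s1 f x `^ r * v x)%R <=
   (G `^ (r / (r - 1)) * (D * r) `^ (r / (r - 1)) *
      (D `^ (r - 1)^-1 * (r / (r - 1))) `^ r)%:E
   * itg mu (fun x => f x `^ r * v x)%R)%E.
Proof.
move=> nf lf.
apply: (@muckenhoupt _ _ mu hmu r G D (D `^ (r - 1)^-1) v sigma s1 V S) => //.
- exact: ltW.
- by apply: mulr_ge0; [exact: ltW|exact: powR_ge0].
- exact: powR_ge0.
- exact: nnfun_dual_weight.
- exact: dual_weight_conj.
- move=> q qs1; have [qs ts tB] := hs1 qs1; have qB := hs1' qs1.
  have [SE hA] := dual_mass_le qs qB; have [h1 h2] := doubling_masses qs ts tB.
  split=> //; first exact: weight_massE.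
    by split; [exact: weight_mass_gt0|exact: dual_mass_gt0].
  by rewrite weight_massE lee_fin.
- move=> q qs1; have [qs ts tB] := hs1 qs1.
  by have [h1 h2] := doubling_masses qs ts tB; have [-> _] := dual_mass_le ts tB; rewrite lee_fin.
- by apply: filterS ar_weight_gt0 => x hx q qs1 qx; apply: hx; exact: hs1' qx.
Qed.

(** By symmetry sigma satisfies the A_r' condition with constant G^(1/(r-1)) and conjugate weight v,
    and the two doubling constants change places. *)
Lemma ar_maximal_dual f : nnfun f -> locint mu f ->
  (itg mu (fun x => maxop mu s1 f x `^ (r / (r - 1)) * sigma x)%R <=
   ((G `^ (r - 1)^-1) `^ r * (D `^ (r - 1)^-1 * (r / (r - 1))) `^ r *
      (D * r) `^ (r / (r - 1)))%:E
   * itg mu (fun x => f x `^ (r / (r - 1)) * sigma x)%R)%E.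
Proof.
move=> nf lf; set r' := r / (r - 1).
have r'1 : 1 < r' by exact: conj_exp_gt1.
have r'E : r' - 1 = (r - 1)^-1.
  by apply: (mulIf rmn); rewrite mulrBl divfK// mulVf// mul1r opprB addrC subrK.
have r'r : r' / (r' - 1) = r by rewrite r'E invrK divfK.
have := @muckenhoupt _ _ mu hmu r' (G `^ (r - 1)^-1) (D `^ (r - 1)^-1) D sigma v s1 S V f r'1.
rewrite r'r; apply => //.
- exact: powR_ge0.
- exact: powR_ge0.
- by apply: mulr_ge0; [exact: ltW|exact: powR_ge0].
- exact: nnfun_dual_weight.
- exact: (conj_weights_sym r1 dual_weight_conj).
- move=> q qs1; have [qs ts tB] := hs1 qs1; have qB := hs1' qs1.
  have [SE hA] := dual_mass_le qs qB; have [h1 h2] := doubling_masses qs ts tB.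
  have V0 := weight_mass_gt0 qB; have S0 := dual_mass_gt0 qs qB.
  split=> //; first exact: weight_massE.
    have ir : 0 <= (r - 1)^-1 by rewrite invr_ge0 ltW.
    have := le_powR2 ir (mulr_ge0 (ltW V0) (powR_ge0 _ _)) hA.
    rewrite (powRM _ (ltW V0) (powR_ge0 _ _)) (powRK rmn (ltW S0)).
    by rewrite (powRM _ (ltW G0) (powR_ge0 _ _)) -[(vol q `^ r) `^ _]powRrM r'E mulrC.
  by have [-> _] := dual_mass_le ts tB; rewrite lee_fin.
- move=> q qs1; have [qs ts tB] := hs1 qs1.
  by have [h1 h2] := doubling_masses qs ts tB; rewrite weight_massE lee_fin.
- apply: filterS ar_weight_gt0 => x hx q qs1 qx; apply: powR_gt0; apply: hx; exact: hs1' qx.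
Qed.

End ar_weights.

(** * Extrapolation from weighted bounds to X, and the finite maximal operators on X *)

Section vector_bound_implies_maximal_bounds.
Context {R : realType} {d : nat}.
Variables (mu : {measure set (d.-tuple R) -> \bar R}) (Xs : bfs mu).
Hypothesis hmu : is_lebesgue mu.
Hypothesis hF : fatou_prop Xs.
Local Notation T := (d.-tuple R).
Local Notation Qi := (@Qidx d).
Local Notation Qc := (@Qcube R d).
Implicit Types (f g w v : T -> R) (q : Qi).
Variables (r K G : R).
Hypothesis r1 : 1 < r.
Hypothesis hM : Mcal_bounded Xs r.
Hypothesis K0 : 0 <= K.
Hypothesis hK : forall u, pow_hull Xs r u ->
  bX Xs (fun x => u x `^ r^-1) /\ nrm Xs (fun x => u x `^ r^-1) <= K.
Hypothesis G0 : 0 < G.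
Hypothesis hG : forall s w, uniq s -> nnfun w ->
  pow_dual_le Xs r 1 w -> exists v, [/\ nnfun v, pow_dual_le Xs r 2 v,
    forall q, {ae mu, forall x, Qc q x -> w x <= v x} & ar_pair mu r G s v v].

Let r0 : 0 < r. Proof. exact: lt_trans r1. Qed.
Let rn : r != 0. Proof. by rewrite gt_eqF. Qed.
Let rm : 0 < r - 1. Proof. by rewrite subr_gt0. Qed.
Let rmn : r - 1 != 0. Proof. by rewrite gt_eqF. Qed.

(** The cubes on which the weight has to satisfy the A_r inequality: triples enter through doubling,
    B through positivity of v. Duplicates are removed because [hG] takes duplicate-free lists. *)
Definition family (B : Qi) (s : seq Qi) := undup (B :: s ++ map (@triple d) s).

(** Each w in the dual ball is replaced by an A_r weight v >= w on B, for which the weighted bound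
    holds and the integral of |f|^r v is at most 2; the duality lemma leads back to X. *)
Lemma extrapolation (s : seq Qi) (B : Qi) (H f : T -> R) (b C : R) :
  nnfun H -> (forall x, H x <= b * \1_(Qc B) x) ->
  bX Xs f -> nrm Xs f <= 1 -> 0 < C ->
  (forall v, nnfun v -> (forall q, (itg mu (fun x => \1_(Qc q) x * v x)%R < +oo)%E) ->
     ar_pair mu r G (family B s) v v ->
     (0 < itg mu (fun x => \1_(Qc B) x * v x)%R)%E ->
     (itg mu (fun x => H x `^ r * v x)%R <= C%:E * itg mu (fun x => `|f x| `^ r * v x)%R)%E) ->
  bX Xs H /\ nrm Xs H <= (C * 2) `^ r^-1 * K.
Proof.
move=> nH HB Xf f1 C0 hv.
have nHr : nnfun (fun x => H x `^ r) by apply: nnfun_pow; case: nH.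
have [n hn] := Qcube_centred (R := R) [:: B].
have b0 : 0 <= b.
  have := HB (map_tuple ratr (sval B).1); rewrite indicE mem_set; last exact: Qcube_corner.
  by rewrite mulr1; apply: le_trans; exact: nH.2.
have Hn x : H x <= b * \1_(centred_cube (R := R) (d := d) n) x.
  apply: (le_trans (HB x)); apply: (ler_wpM2l b0); rewrite !indicE ler_nat.
  case: (boolP (x \in Qc B)) => // /set_mem Bx.
  by rewrite mem_set//; apply: (hn B (mem_head _ _) x Bx).
apply: (lorentz_luxemburg hmu hF (ltW r1) (mulr_gt0 C0 (ltr0n R 2)) hK nH Hn) => w nw hw.
have [v [nv hv2 wv hA]] := hG (undup_uniq (B :: s ++ map (@triple d) s)) nw hw.
have nBv := nnfun_indicM B nv.
have Hwv : (itg mu (fun x => H x `^ r * w x)%R <= itg mu (fun x => H x `^ r * v x)%R)%E.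
  apply: ae_le_itg; [exact: nnfunM|exact: nnfunM|].
  apply: filterS (wv B) => x hx; have [Bx|Bx] := pselect (Qc B x).
    exact: (ler_wpM2l (powR_ge0 _ _) (hx Bx)).
  have -> : H x = 0.
    apply/eqP; rewrite eq_le nH.2 andbT; apply: le_trans (HB x) _.
    by rewrite indicE memNset// mulr0.
  by rewrite powR0// !mul0r.
(* If v(B) = 0 the A_r results do not apply, but then H^r v vanishes almost everywhere, since H
   lives on B. *)
have [vz|vn] := eqVneq (itg mu (fun x => \1_(Qc B) x * v x)) 0%E.
  apply: (le_trans Hwv); apply: (@le_trans _ _ 0%E); last by rewrite lee_fin mulr_ge0// ltW.
  apply: (@le_trans _ _ (itg mu (fun=> 0))); last by rewrite itg0.
  apply: ae_le_itg; [exact: nnfunM|exact: nnfun_cst|].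
  apply: filterS (itg_eq0 nBv vz) => x; rewrite indicE.
  case: (boolP (x \in Qc B)) => [_|Bx] /=; first by rewrite mul1r => ->; rewrite mulr0.
  have -> : H x = 0.
    apply/eqP; rewrite eq_le nH.2 andbT; apply: le_trans (HB x) _.
    by rewrite indicE (negbTE Bx) mulr0.
  by rewrite powR0// mul0r.
have vB : (0 < itg mu (fun x => \1_(Qc B) x * v x)%R)%E by rewrite lt_def vn itg_ge0.
apply: (le_trans Hwv); apply: (le_trans (hv v nv (fun q => pow_dual_Qcube hmu r1 hM q nv hv2) hA vB)).
by rewrite EFinM; apply: lee_wpmul2l; [rewrite lee_fin; exact: ltW|exact: hv2].
Qed.

Lemma enclosing_cube (s : seq Qi) : exists B, forall q, q \in s -> Qc (triple q) `<=` Qc B.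
Proof.
have [n hn] := Qcube_centred (R := R) (map (@triple d) s).
(* n may be 0, while a cube needs a positive side. *)
have l0 : 0 < 2 * n.+1%:R :> R by rewrite mulr_gt0.
have [B [hB _]] := Qcube_approx [tuple - n.+1%:R | _ < d] l0 (ltr1n R 2).
exists B => q qs x qx; apply: hB.
have [_ sub _ _] := exhaustion_centred_cube hmu; apply: sub.
exact: (hn _ (map_f _ qs)).
Qed.

Lemma family_sub (s : seq Qi) B : (forall q, q \in s -> Qc (triple q) `<=` Qc B) ->
  forall q, q \in s ->
  [/\ q \in family B s, triple q \in family B s & Qc (triple q) `<=` Qc B].
Proof.
move=> hB q qs; rewrite !mem_undup !inE !mem_cat qs map_f// !orbT.
by split=> //; exact: hB.
Qed.

Lemma family_head (s : seq Qi) B : B \in family B s.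
Proof. by rewrite mem_undup mem_head. Qed.

(** Scaling by the norm plus e, followed by e -> 0, also covers functions of norm 0. *)
Lemma homogeneous_bound (Op : (T -> R) -> T -> R) (C : R) : 0 <= C ->
  (forall (c : R) f, 0 < c -> bX Xs f -> Op (fun x => c * f x) = (fun x => c * Op f x)) ->
  (forall f, bX Xs f -> nrm Xs f <= 1 -> bX Xs (Op f) /\ nrm Xs (Op f) <= C) ->
  forall f, bX Xs f -> bX Xs (Op f) /\ nrm Xs (Op f) <= C * nrm Xs f.
Proof.
move=> C0 hom bnd f Xf; have n0 := nrm_ge0 Xf.
have key e : 0 < e -> bX Xs (Op f) /\ nrm Xs (Op f) <= C * (nrm Xs f + e).
  move=> e0; set c := nrm Xs f + e; have c0 : 0 < c by rewrite ltr_wpDl.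
  have ic0 : 0 < c^-1 by rewrite invr_gt0.
  have [|X1 X2] := bnd _ (X_scale c^-1 Xf).
    by rewrite (nrm_scale_ge0 (ltW ic0) Xf) mulrC ler_pdivrMr// mul1r lerDl ltW.
  rewrite (hom _ _ ic0 Xf) in X1 X2.
  have E : Op f = (fun x => c * (c^-1 * Op f x)).
    by apply/funext => x; rewrite mulrA mulfV ?mul1r// gt_eqF.
  rewrite {1 2}E; split; first exact: X_scale.
  by rewrite (nrm_scale_ge0 (ltW c0) X1) mulrC; apply: ler_wpM2r => //; exact: ltW.
split; first by case: (key 1 ltr01).
apply/ler_addgt0Pl => e e0; have e1 : 0 < e / (C + 1) by rewrite divr_gt0// ltr_wpDl.
have [_ /le_trans] := key _ e1; apply; rewrite mulrDr addrC lerD2r.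
by rewrite mulrA ler_pdivrMr ?ltr_wpDl// mulrC ler_wpM2l ?lerDl// ltW.
Qed.

Lemma bX_locint_norm f : bX Xs f -> locint mu (fun x => `|f x|) /\ nnfun (fun x => `|f x|).
Proof.
move=> Xf; split; first exact: locint_norm (bX_locint_vector hmu r1 hM Xf).
exact: nnfun_norm (X_meas Xf).
Qed.

Lemma maxop_norm s f : maxop mu s (fun x => `|f x|) = maxop mu s f.
Proof.
apply/funext => x; rewrite /maxop; apply: eq_bigr => q _; congr (mean mu q _ * _).
by apply/funext => y; rewrite normr_id.
Qed.

Lemma maxopZ s (c : R) f : 0 < c -> locint mu f ->
  maxop mu s (fun x => c * f x) = (fun x => c * maxop mu s f x).
Proof.
move=> c0 lf; have nf := nnfun_norm lf.1; have lnf := locint_norm lf.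
apply/funext => x; rewrite /maxop; elim: s => [|q s ih]; first by rewrite !big_nil mulr0.
rewrite !big_cons ih maxr_pMr; last exact: ltW.
congr (Num.max _ _); rewrite mulrA -(meanZ q (ltW c0) nf lnf); congr (mean mu q _ * _).
by apply/funext => y; rewrite normrM gtr0_norm.
Qed.

Lemma maxop_bounded : exists2 C : R, 0 <= C & forall s f, bX Xs f ->
  bX Xs (maxop mu s f) /\ nrm Xs (maxop mu s f) <= C * nrm Xs f.
Proof.
pose D : R := G * (3 ^+ d) `^ r.
pose C1 : R := G `^ (r / (r - 1)) * (D * r) `^ (r / (r - 1)) *
   (D `^ (r - 1)^-1 * (r / (r - 1))) `^ r.
have C10 : 0 <= C1 by apply: mulr_ge0; [apply: mulr_ge0|]; exact: powR_ge0.
have C0 : 0 < C1 + 1 by rewrite ltr_wpDl.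
exists (((C1 + 1) * 2) `^ r^-1 * K); first by rewrite mulr_ge0// powR_ge0.
move=> s; apply: homogeneous_bound.
- by rewrite mulr_ge0// powR_ge0.
- by move=> c f c0 Xf; apply: maxopZ => //; exact: (bX_locint_vector hmu r1 hM Xf).
move=> f Xf f1; have [lf nf] := bX_locint_norm Xf.
have [B hB] := enclosing_cube s.
have m0 q : 0 <= mean mu q (fun y => `|f y|) by exact: mean_ge0.
apply: (@extrapolation s B (maxop mu s f) f (\sum_(q <- s) mean mu q (fun y => `|f y|))) => //.
- exact: (nnfun_maxop mu s (X_meas Xf)).
- move=> x; have s0 : 0 <= \sum_(q <- s) mean mu q (fun y => `|f y|) by apply: sumr_ge0.
  apply: maxop_le; first by rewrite mulr_ge0// indicE.
  move=> q qs; apply: ler_pM; rewrite ?indicE//.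
    by rewrite (big_rem q)//= lerDl; apply: sumr_ge0.
  rewrite ler_nat; case: (boolP (x \in Qc q)) => // /set_mem qx.
  by rewrite mem_set//; apply: hB qs _ _; exact: sub_triple.
move=> v nv hvfin hA vB.
have nY : nnfun (fun x => `|f x| `^ r * v x).
  by apply: nnfunM => //; apply: nnfun_pow; case: nf.
have := ar_maximal hmu r1 G0 nv hvfin hA (family_head s B) vB (family_sub hB) nf lf.
rewrite maxop_norm -/D -/C1 => /le_trans; apply.
by apply: lee_wpmul2r; [exact: itg_ge0|rewrite lee_fin lerDl].
Qed.

(** Young's inequality for (l x v^(1/r)) (l^-1 y s^(1/r')), where r' = r / (r - 1) and v^(1/r)
    s^(1/r') = 1. A large l makes the second term small enough to be absorbed. *)
Lemma young_weights (l x y v s : R) : 0 < l -> 0 <= x -> 0 <= y -> 0 < v -> 0 < s ->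
  v * s `^ (r - 1) = 1 ->
  x * y <= l `^ r / r * (x `^ r * v)
           + (l `^ (r / (r - 1)))^-1 / (r / (r - 1)) * (y `^ (r / (r - 1)) * s).
Proof.
move=> l0 x0 y0 v0 s0 e; set r' := r / (r - 1).
have r'0 : 0 < r' by rewrite divr_gt0.
have rr' : r^-1 + r'^-1 = 1 by rewrite /r' invf_div mulrBl mulfV// mul1r addrC subrK.
have vs : v `^ r^-1 * s `^ r'^-1 = 1.
  have := powRM r^-1 (ltW v0) (powR_ge0 s (r - 1)); rewrite e powR1 => ->.
  by rewrite -powRrM /r' invf_div.
have := @conjugate_powR _ (l * x * v `^ r^-1) (l^-1 * y * s `^ r'^-1) r r'.
rewrite !mulr_ge0 ?powR_ge0 ?invr_ge0 ?(ltW l0)// r0 r'0 => /(_ isT isT isT isT rr').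
have -> : l * x * v `^ r^-1 * (l^-1 * y * s `^ r'^-1) = x * y.
  transitivity (l / l * (x * y) * (v `^ r^-1 * s `^ r'^-1)); first by ring.
  by rewrite vs mulfV ?gt_eqF// mul1r mulr1.
move=> /le_trans; apply.
have -> : (l * x * v `^ r^-1) `^ r = l `^ r * x `^ r * v.
  rewrite powRM ?powR_ge0 ?mulr_ge0 ?(ltW l0)// powRVK ?(ltW v0)//.
  by rewrite powRM ?(ltW l0).
have -> : (l^-1 * y * s `^ r'^-1) `^ r' = (l `^ r')^-1 * y `^ r' * s.
  rewrite powRM ?powR_ge0 ?mulr_ge0 ?invr_ge0 ?(ltW l0)// powRVK ?(ltW s0) ?gt_eqF//.
  rewrite powRM ?invr_ge0 ?(ltW l0)//; congr (_ * _ * _).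
  by rewrite -[l^-1]div1r powR_div// powR1 div1r.
by rewrite le_eqVlt; apply/orP; left; apply/eqP; ring.
Qed.

End vector_bound_implies_maximal_bounds.

(** * Linearized maximal operators and weighted bounds for their adjoints *)

Section dual_weighted_estimate.
Context {R : realType} {d : nat}.
Variable mu : {measure set (d.-tuple R) -> \bar R}.
Hypothesis hmu : is_lebesgue mu.
Local Notation T := (d.-tuple R).
Local Notation Qi := (@Qidx d).
Local Notation Qc := (@Qcube R d).
Implicit Types (f g w v : T -> R) (q : Qi).
Variables (r G : R).
Hypothesis r1 : 1 < r.
Hypothesis G0 : 0 < G.

Let r0 : 0 < r. Proof. exact: lt_trans r1. Qed.
Let rn : r != 0. Proof. by rewrite gt_eqF. Qed.
Let rm : 0 < r - 1. Proof. by rewrite subr_gt0. Qed.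
Let rmn : r - 1 != 0. Proof. by rewrite gt_eqF. Qed.

(** A measurable selection of a cube containing x, relaxed to a subpartition of unity; points in no
    cube of s get total weight 0. *)
Definition linearization (s : seq Qi) (e : Qi -> T -> R) :=
  [/\ forall q, nnfun (e q), forall q x, e q x <= \1_(Qc q) x
    & forall x, \sum_(q <- s) e q x <= 1].

Lemma linearization_le1 s e q x : linearization s e -> e q x <= 1.
Proof.
by move=> [_ h _]; apply: le_trans (h q x) _; rewrite indicE; case: (_ \in _).
Qed.

Lemma nnfun_locint_linearization s e f q : linearization s e -> nnfun f -> locint mu f ->
  nnfun (fun y => f y * e q y) /\ locint mu (fun y => f y * e q y).
Proof.
move=> he nf lf; have ne : nnfun (fun y => f y * e q y) by apply: nnfunM => //; case: he.
split=> //; apply: (nnfun_locint_le ne nf lf) => x.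
by apply: ler_piMr; [exact: nf.2|exact: linearization_le1 he].
Qed.

Definition lin_sum (s : seq Qi) (e : Qi -> T -> R) f x : R :=
  \sum_(q <- s) mean mu q (fun y => f y * e q y) * \1_(Qc q) x.

Lemma nnfun_lin_sum s e f : linearization s e -> nnfun f -> nnfun (lin_sum s e f).
Proof.
move=> he nf; apply: nnfun_sum => q _; apply: nnfunZ.
  by apply: mean_ge0; apply: nnfunM => //; case: he.
by apply: nnfun_indic; exact: measurable_Qcube.
Qed.

Lemma lin_sum_le s e f B x : linearization s e -> nnfun f ->
  (forall q, q \in s -> Qc q `<=` Qc B) ->
  lin_sum s e f x <= (\sum_(q <- s) mean mu q (fun y => f y * e q y)) * \1_(Qc B) x.
Proof.
move=> he nf hB; rewrite /lin_sum mulr_suml big_seq [leRHS]big_seq; apply: ler_sum => q qs.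
apply: ler_wpM2l; first by apply: mean_ge0; apply: nnfunM => //; case: he.
rewrite !indicE ler_nat; case: (boolP (x \in Qc q)) => // /set_mem qx.
by rewrite mem_set//; exact: hB qs _ qx.
Qed.

Lemma itg_lin_sum s e f g : linearization s e -> nnfun f -> nnfun g ->
  locint mu f -> locint mu g ->
  itg mu (fun x => lin_sum s e f x * g x) =
  itg mu (fun x => \sum_(q <- s) (f x * e q x) * (mean mu q g * \1_(Qc q) x)).
Proof.
move=> he nf ng lf lg.
have n1 q : nnfun (\1_(Qc q) : T -> R) by apply: nnfun_indic; exact: measurable_Qcube.
have nfe q := (nnfun_locint_linearization q he nf lf).1.
have lfe q := (nnfun_locint_linearization q he nf lf).2.
transitivity (itg mu (fun x =>
    \sum_(q <- s) (mean mu q (fun y => f y * e q y) * \1_(Qc q) x) * g x)).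
  by apply: itg_ext => x; rewrite /lin_sum mulr_suml.
rewrite itg_sum; last first.
  by move=> q _; apply: nnfunM => //; apply: nnfunZ => //; exact: mean_ge0.
rewrite itg_sum; last first.
  by move=> q _; apply: nnfunM => //; apply: nnfunZ => //; exact: mean_ge0.
by apply: eq_bigr => q _; exact: (itg_mean_swap q (nfe q) ng (lfe q) lg).
Qed.

Lemma itg_lin_sum_maxop s e f g : linearization s e -> nnfun f -> nnfun g ->
  locint mu f -> locint mu g ->
  (itg mu (fun x => lin_sum s e f x * g x)%R <= itg mu (fun x => f x * maxop mu s g x)%R)%E.
Proof.
move=> he nf ng lf lg; rewrite (itg_lin_sum he nf ng lf lg).
have n1 q : nnfun (\1_(Qc q) : T -> R) by apply: nnfun_indic; exact: measurable_Qcube.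
have nm := nnfun_maxop mu s ng.1.
apply: le_itg.
- apply: nnfun_sum => q _; apply: nnfunM; first by apply: nnfunM => //; case: he.
  by apply: nnfunZ => //; exact: mean_ge0.
- exact: nnfunM.
move=> x; have [ne _ e1] := he.
apply: (@le_trans _ _ (\sum_(q <- s) (f x * maxop mu s g x) * e q x)).
  rewrite !big_seq; apply: ler_sum => q qs.
  have E : (fun y => `|g y|) = g by apply/funext => y; rewrite ger0_norm// ng.2.
  have := @le_maxop R d mu s g q x qs; rewrite E => h.
  rewrite mulrAC; apply: ler_wpM2r; first exact: (ne q).2.
  by apply: ler_wpM2l h; exact: nf.2.
rewrite -mulr_sumr; apply: ler_piMr; last exact: e1.
by apply: mulr_ge0; [exact: nf.2|exact: nm.2].
Qed.

(** The norming function of duality: the r'-th power of h^(r-1) v0, taken against the conjugate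
    weight, returns h^r v0. *)
Lemma dual_powE (h v0 : R) : 0 <= h -> 0 <= v0 ->
  (h `^ (r - 1) * v0) `^ (r / (r - 1)) * v0 `^ (- (r - 1)^-1) <= h `^ r * v0.
Proof.
move=> h0 v00; have e : (r - 1) * (r / (r - 1)) = r by rewrite mulrC divfK.
rewrite powRM ?powR_ge0// -powRrM e -mulrA.
apply: ler_wpM2l; first exact: powR_ge0.
have [->|vn] := eqVneq v0 0.
  by rewrite powR0 ?mul0r// mulf_neq0// invr_eq0.
rewrite -powRD; last by rewrite vn implybT.
have -> : r / (r - 1) - (r - 1)^-1 = 1 by rewrite -{2}[(r - 1)^-1]mul1r -mulrBl mulfV.
by rewrite powRr1.
Qed.

(** With r' = r / (r - 1) one has 1 - 1/r' = 1/r; as k <= 1 and I is finite, moving the last term to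
    the left leaves at least I / r. *)
Lemma absorb (I A : \bar R) (c k : R) : (0 <= I)%E -> (I < +oo)%E -> (0 <= A)%E ->
  0 < c -> 0 <= k -> k <= 1 ->
  (I <= (c / r)%:E * A + (k / (r / (r - 1)))%:E * I)%E -> (I <= c%:E * A)%E.
Proof.
move=> I0 Ioo A0 c0 k0 k1.
have If : I \is a fin_num by rewrite ge0_fin_numE.
case: A A0 => [a| |] //= A0; last by move=> _; rewrite gt0_muley ?lte_fin// leey.
rewrite -(fineK If); set i := fine I.
rewrite -!EFinM -EFinD !lee_fin => h.
have i0 : 0 <= i by exact: fine_ge0.
have h2 : k / (r / (r - 1)) * i <= (1 - r^-1) * i.
  apply: ler_wpM2r => //; rewrite invf_div mulrA.
  have -> : 1 - r^-1 = (r - 1) / r by rewrite mulrBl mulfV// mul1r.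
  apply: ler_wpM2r; first by rewrite invr_ge0 ltW.
  by apply: ler_piMl => //; exact: ltW.
have h3 : i <= c / r * a + (1 - r^-1) * i by apply: (le_trans h); rewrite lerD2l.
have h4 : i / r <= c * a / r.
  have -> : i / r = i - (1 - r^-1) * i by rewrite mulrBl mul1r opprB addrCA subrr addr0 mulrC.
  by rewrite lerBlDr mulrAC.
by move: h4; rewrite ler_pM2r// invr_gt0.
Qed.

(** Let H be the adjoint sum and phi = H^(r-1) v. The integral of H^r v is at most that of f M phi;
    Young's inequality splits the latter, the bound on L^r'(sigma) returns a multiple of the
    integral of H^r v, and this is absorbed. It is finite because H is bounded and lives on B. *)
Lemma lin_sum_weighted : exists2 C : R, 0 < C & forall s e f v s' B,
  linearization s e -> nnfun f -> locint mu f -> nnfun v ->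
  (forall q, (itg mu (fun x => \1_(Qc q) x * v x)%R < +oo)%E) ->
  ar_pair mu r G s' v v -> B \in s' ->
  (0 < itg mu (fun x => \1_(Qc B) x * v x)%R)%E ->
  (forall q, q \in s -> [/\ q \in s', triple q \in s' & Qc (triple q) `<=` Qc B]) ->
  (itg mu (fun x => lin_sum s e f x `^ r * v x)%R <=
   C%:E * itg mu (fun x => f x `^ r * v x)%R)%E.
Proof.
pose D : R := G * (3 ^+ d) `^ r.
pose C2 : R := (G `^ (r - 1)^-1) `^ r * (D `^ (r - 1)^-1 * (r / (r - 1))) `^ r *
      (D * r) `^ (r / (r - 1)).
have C20 : 0 <= C2 by apply: mulr_ge0; [apply: mulr_ge0|]; exact: powR_ge0.
have C0 : 0 < C2 + 1 by rewrite ltr_wpDl.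
have r'0 : 0 < r / (r - 1) by rewrite divr_gt0.
(* Chosen with l^(r') = C2 + 1, so that the absorbed term has k = C2 / (C2 + 1) <= 1. *)
pose l := (C2 + 1) `^ (r / (r - 1))^-1.
have l0 : 0 < l by exact: powR_gt0.
have lE : l `^ (r / (r - 1)) = C2 + 1.
  by apply: powRVK; [rewrite gt_eqF|exact: ltW].
exists (l `^ r); first exact: powR_gt0.
move=> s e f v s' B he nf lf nv hvfin hA Bs vB hs.
have hB q : q \in s -> Qc q `<=` Qc B.
  by move=> qs; have [_ _ h] := hs q qs; apply: subset_trans h; exact: sub_triple.
pose H := lin_sum s e f; rewrite -/H.
have nH : nnfun H by exact: nnfun_lin_sum.
pose b := \sum_(q <- s) mean mu q (fun y => f y * e q y).
have b0 : 0 <= b.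
  by apply: sumr_ge0 => q _; apply: mean_ge0; apply: nnfunM => //; case: he.
have Hb x : H x <= b * \1_(Qc B) x by exact: lin_sum_le.
have Hb1 x : H x <= b.
  by apply: le_trans (Hb x) _; rewrite indicE; case: (_ \in _); rewrite ?mulr1 ?mulr0.
have nB : nnfun (\1_(Qc B) : T -> R) by apply: nnfun_indic; exact: measurable_Qcube.
pose phi x := H x `^ (r - 1) * v x.
have nphi : nnfun phi by apply: nnfunM => //; apply: nnfun_pow; case: nH.
have lv : locint mu v.
  split=> [|q]; first by case: nv.
  have -> : itg mu (fun x => \1_(Qc q) x * `|v x|) = itg mu (fun x => \1_(Qc q) x * v x).
    by apply: itg_ext => x; rewrite ger0_norm// nv.2.
  exact: hvfin.
have lphi : locint mu phi.
  apply: (nnfun_locint_le nphi (nnfunZ (powR_ge0 b (r - 1)) nv) (locintZ _ lv)) => x.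
  apply: ler_wpM2r; first exact: nv.2.
  by apply: le_powR2; [exact: ltW|exact: nH.2|exact: Hb1].
have nI : nnfun (fun x => H x `^ r * v x).
  by apply: nnfunM => //; apply: nnfun_pow; case: nH.
have Ioo : (itg mu (fun x => H x `^ r * v x)%R < +oo)%E.
  have nBv := nnfun_indicM B nv.
  apply: (@le_lt_trans _ _ (itg mu (fun x => b `^ r * (\1_(Qc B) x * v x)))%R).
    apply: le_itg => //; first by apply: nnfunZ => //; exact: powR_ge0.
    move=> x; rewrite mulrA; apply: ler_wpM2r; first exact: nv.2.
    have := Hb x; rewrite indicE; case: (_ \in _) => h.
      by rewrite mulr1; apply: le_powR2 => //; [exact: ltW|exact: nH.2].
    have -> : H x = 0 by apply/eqP; rewrite eq_le nH.2 andbT -[leRHS](mulr0 b).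
    by rewrite powR0// mulr0.
  rewrite itgZ//; last exact: powR_ge0.
  by rewrite lte_mul_pinfty// ?lee_fin ?powR_ge0.
have nM := nnfun_maxop mu s nphi.1.
have ns := nnfun_dual_weight r nv.
have nfr : nnfun (fun x => f x `^ r * v x).
  by apply: nnfunM => //; apply: nnfun_pow; case: nf.
have nMr : nnfun (fun x => maxop mu s phi x `^ (r / (r - 1)) * dual_weight r v x).
  by apply: nnfunM => //; apply: nnfun_pow; case: nM.
have k0 : 0 <= (C2 + 1)^-1 / (r / (r - 1)).
  by apply: mulr_ge0; rewrite invr_ge0 ltW.
have c0 : 0 <= l `^ r / r by rewrite divr_ge0 ?powR_ge0// ltW.
have S1 : (itg mu (fun x => H x `^ r * v x)%R <= itg mu (fun x => f x * maxop mu s phi x)%R)%E.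
  have := itg_lin_sum_maxop he nf nphi lf lphi; apply: le_trans.
  rewrite le_eqVlt; apply/orP; left; apply/eqP; apply: itg_ext => x.
  by rewrite (powR_mul1B (ltW r1) (nH.2 x)) mulrA.
have S2 : (itg mu (fun x => f x * maxop mu s phi x)%R <=
    (l `^ r / r)%:E * itg mu (fun x => f x `^ r * v x)%R +
    ((C2 + 1)^-1 / (r / (r - 1)))%:E *
      itg mu (fun x => maxop mu s phi x `^ (r / (r - 1)) * dual_weight r v x)%R)%E.
  rewrite -!itgZ// -itgD; [|exact: nnfunZ|exact: nnfunZ].
  apply: ae_le_itg; [exact: nnfunM|apply: nnfunD; exact: nnfunZ|].
  apply: filterS (ar_weight_gt0 hmu r1 nv hA Bs vB) => x hx.
  have [Bx|Bx] := pselect (Qc B x).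
    have := hx Bx => vx.
    case: (dual_weight_conj r1 nv x) => [[v0 _]|[_ sx ex]]; first by rewrite v0 ltxx in vx.
    have := young_weights r1 l0 (nf.2 x) (nM.2 x) vx sx ex; rewrite lE; exact.
  have -> : maxop mu s phi x = 0.
    apply/eqP; rewrite eq_le nM.2 andbT; apply: maxop_le => // q qs.
    by rewrite indicE memNset ?mulr0// => qx; apply: Bx; exact: hB qs _ qx.
  rewrite mulr0; apply: addr_ge0; apply: mulr_ge0 => //; first exact: nfr.2.
  by apply: mulr_ge0; [exact: powR_ge0|exact: ns.2].
have S3 : (itg mu (fun x => maxop mu s phi x `^ (r / (r - 1)) * dual_weight r v x)%R <=
    C2%:E * itg mu (fun x => H x `^ r * v x)%R)%E.
  apply: le_trans (ar_maximal_dual hmu r1 G0 nv hvfin hA Bs vB hs nphi lphi) _.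
  rewrite -/D -/C2; apply: lee_wpmul2l; first by rewrite lee_fin.
  apply: le_itg => //; first by apply: nnfunM => //; apply: nnfun_pow; case: nphi.
  by move=> x; exact: (dual_powE (nH.2 x) (nv.2 x)).
apply: (@absorb _ _ _ (C2 / (C2 + 1))).
- exact: itg_ge0.
- exact: Ioo.
- exact: itg_ge0.
- exact: powR_gt0.
- by rewrite divr_ge0// ltW.
- by rewrite ler_pdivrMr// mul1r lerDl.
apply: (le_trans S1); apply: (le_trans S2); apply: leeD2l.
have -> : C2 / (C2 + 1) / (r / (r - 1)) = (C2 + 1)^-1 / (r / (r - 1)) * C2.
  by rewrite [RHS]mulrC mulrA.
by rewrite (EFinM (_ / (r / (r - 1))) C2) -muleA; apply: lee_wpmul2l; [rewrite lee_fin|exact: S3].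
Qed.

(** Cubes are added one at a time: on the part A of the new cube where its value is at least the
    current maximum M, everything is assigned to it; elsewhere the earlier selection stays. *)
Lemma exists_linearization (s : seq Qi) (a : Qi -> R) : uniq s -> (forall q, 0 <= a q) ->
  exists e, linearization s e /\
    forall x, \big[Num.max/0]_(q <- s) (a q * \1_(Qc q) x) <= \sum_(q <- s) a q * e q x.
Proof.
move=> us a0; elim: s us => [|q s ih] /=.
  move=> _; exists (fun _ _ => 0); split; last by move=> x; rewrite !big_nil.
  split=> [q|q x|x]; [exact: nnfun_cst|by rewrite indicE|by rewrite big_nil].
case/andP => qs /ih [e [[ne ei e1] he]].
pose M x := \big[Num.max/0]_(p <- s) (a p * \1_(Qc p) x).
have n1 p : nnfun (\1_(Qc p) : T -> R) by apply: nnfun_indic; exact: measurable_Qcube.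
have nM : nnfun M by apply: nnfun_bigmax => p _; apply: nnfunZ.
pose A := Qc q `&` (M @^-1` [set` `]-oo, a q]]).
have mA : measurable A.
  apply: measurableI; first exact: measurable_Qcube.
  by rewrite -[X in measurable X]setTI; apply: nM.1 => //; exact: measurable_itv.
have nA : nnfun (\1_A : T -> R) by exact: nnfun_indic.
have nAc : nnfun (\1_(~` A) : T -> R) by apply: nnfun_indic; exact: measurableC.
pose e' p x : R := if p == q then \1_A x else e p x * \1_(~` A) x.
have Es F x : \sum_(p <- s) F p * e' p x = (\sum_(p <- s) F p * e p x) * \1_(~` A) x :> R.
  rewrite mulr_suml; apply: eq_big_seq => p ps; rewrite /e'.
  have -> : (p == q) = false by apply/negbTE; apply: contraNneq qs => <-.
  by rewrite mulrA.
have E1 x : \sum_(p <- s) e' p x = (\sum_(p <- s) e p x) * \1_(~` A) x.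
  have := Es (fun=> 1) x; under eq_bigr do rewrite mul1r.
  by move=> ->; under eq_bigr do rewrite mul1r.
exists e'; split; first split.
- by move=> p; rewrite /e'; case: eqP => _ //; exact: nnfunM.
- move=> p x; rewrite /e'; case: eqP => [->|_].
    rewrite !indicE ler_nat; case: (boolP (x \in A)) => // /set_mem [qx _].
    by rewrite mem_set.
  apply: le_trans (ei p x); apply: ler_piMr; first exact: (ne p).2.
  by rewrite indicE; case: (_ \in _).
- move=> x; rewrite big_cons E1 {1}/e' eqxx !indicE in_setC.
  by case: (x \in A) => /=; rewrite ?mulr0 ?addr0// mulr1 add0r.
move=> x; rewrite !big_cons Es {1}/e' eqxx -/(M x) !indicE in_setC.
case: (boolP (x \in A)) => [/set_mem[qx]|/negP xA] /=.
  by rewrite /= in_itv /= => hM; rewrite mem_set// mulr0 addr0 ge_max lexx mulr1.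
rewrite mulr0 mulr1 add0r ge_max he andbT; apply: le_trans (he x); rewrite -/(M x).
case: (boolP (x \in Qc q)) => [/set_mem qx|_]; last by rewrite mulr0; exact: nM.2.
rewrite mulr1; case: (leP (M x) (a q)) => [h|/ltW//].
by exfalso; apply: xA; apply: mem_set; split=> //=; rewrite in_itv.
Qed.

End dual_weighted_estimate.

(** * Boundedness of M on X and on X' *)

Section vector_bound_implies_dual_bound.
Context {R : realType} {d : nat}.
Variables (mu : {measure set (d.-tuple R) -> \bar R}) (Xs : bfs mu).
Hypothesis hmu : is_lebesgue mu.
Hypothesis hF : fatou_prop Xs.
Local Notation T := (d.-tuple R).
Local Notation Qi := (@Qidx d).
Local Notation Qc := (@Qcube R d).
Implicit Types (f g w v : T -> R) (q : Qi).
Variables (r K G : R).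
Hypothesis r1 : 1 < r.
Hypothesis hM : Mcal_bounded Xs r.
Hypothesis K0 : 0 <= K.
Hypothesis hK : forall u, pow_hull Xs r u ->
  bX Xs (fun x => u x `^ r^-1) /\ nrm Xs (fun x => u x `^ r^-1) <= K.
Hypothesis G0 : 0 < G.
Hypothesis hG : forall s w, uniq s -> nnfun w ->
  pow_dual_le Xs r 1 w -> exists v, [/\ nnfun v, pow_dual_le Xs r 2 v,
    forall q, {ae mu, forall x, Qc q x -> w x <= v x} & ar_pair mu r G s v v].

Lemma lin_sum_bounded : exists2 C : R, 0 <= C & forall s e, linearization s e ->
  forall f, bX Xs f -> bX Xs (lin_sum mu s e (fun y => `|f y|)) /\
    nrm Xs (lin_sum mu s e (fun y => `|f y|)) <= C * nrm Xs f.
Proof.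
have [C C0 hC] := lin_sum_weighted hmu r1 G0.
exists ((C * 2) `^ r^-1 * K); first by rewrite mulr_ge0// powR_ge0.
move=> s e he.
apply: (homogeneous_bound (Op := fun f => lin_sum mu s e (fun y => `|f y|))).
- by rewrite mulr_ge0// powR_ge0.
- move=> c f c0 Xf; have [lf nf] := bX_locint_norm hmu r1 hM Xf.
  apply/funext => x; rewrite /lin_sum mulr_sumr; apply: eq_bigr => q _.
  have [n1 l1] := nnfun_locint_linearization q he nf lf.
  rewrite mulrA -(meanZ q (ltW c0) n1 l1); congr (mean mu q _ * _).
  by apply/funext => y; rewrite normrM gtr0_norm// mulrA.
move=> f Xf f1; have [lf nf] := bX_locint_norm hmu r1 hM Xf.
have [B hB] := enclosing_cube hmu s.
have hB' q : q \in s -> Qc q `<=` Qc B.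
  by move=> qs; apply: subset_trans (hB q qs); exact: sub_triple.
have HB x := @lin_sum_le R d mu s e _ B x he nf hB'.
have := extrapolation hmu hF r1 hM hK hG (s := s) (nnfun_lin_sum mu he nf) HB Xf f1 C0.
apply.
move=> v nv hvfin hA vB.
exact: (hC s e _ v _ B he nf lf nv hvfin hA (family_head s B) vB (family_sub hB)).
Qed.

Lemma maximal_bounded : bounded_on mu (bX Xs) (nrm Xs) (HLmax mu).
Proof.
have [C C0 hC] := maxop_bounded hmu hF r1 hM K0 hK G0 hG.
exists C => f Xf; have lf := bX_locint_vector hmu r1 hM Xf.
apply: (fatou_ereal hF (u := fun n => maxop mu (@Qseq d n) f)).
- by move=> n; case: (hC (@Qseq d n) f Xf).
- by move=> x; exact: (nnfun_maxop mu _ lf.1).2.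
- by move=> x n; exact: maxop_nd.
- by move=> x; exact: maxop_cvg.
- by move=> n; case: (hC (@Qseq d n) f Xf).
Qed.

Lemma kdual_locint_vector g : kdual_set Xs g -> locint mu g.
Proof.
move=> hg; split=> [|q]; first by case: hg.
have := kdual_pairing hmu (bX_indic_Qcube hmu r1 hM q) hg => h.
apply: (le_lt_trans _ (ltry _)); apply: le_trans h.
rewrite le_eqVlt; apply/orP; left; apply/eqP; apply: itg_ext => x.
by have -> : `|\1_(Qc q) x| = \1_(Qc q) x :> R by rewrite indicE normr_nat.
Qed.

(** The maximum is dominated by a linearization, whose adjoint acts on |f| in X. The selection
    depends on g, which is why the bound for the adjoints has to be uniform in e. *)
Lemma maxop_pairing : exists2 C : R, 0 <= C & forall s f g, uniq s -> bX Xs f ->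
  kdual_set Xs g ->
  (itg mu (fun x => `|f x| * maxop mu s g x)%R <= (C * nrm Xs f * kdual_nrm Xs g)%:E)%E.
Proof.
have [C C0 hC] := lin_sum_bounded; exists C => // s f g us Xf hg.
have lg0 := kdual_locint_vector hg; have lg := locint_norm lg0.
have ng := nnfun_norm lg0.1.
have [lf nf] := bX_locint_norm hmu r1 hM Xf.
have a0 q : 0 <= mean mu q (fun y => `|g y|) by exact: mean_ge0.
have [e [he hmax]] := exists_linearization us a0.
have [XH nHb] := hC s e he f Xf.
have nH := nnfun_lin_sum mu he nf.
apply: (@le_trans _ _ (itg mu (fun x => lin_sum mu s e (fun y => `|f y|) x * `|g x|))).
  rewrite (itg_lin_sum he nf ng lf lg); have [ne ei _] := he.
  apply: le_itg.
  - by apply: nnfunM => //; exact: nnfun_maxop lg0.1.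
  - apply: nnfun_sum => q _; apply: nnfunM; first exact: nnfunM.
    by apply: nnfunZ => //; apply: nnfun_indic; exact: measurable_Qcube.
  move=> x; apply: (le_trans (ler_wpM2l (normr_ge0 (f x)) (hmax x))).
  rewrite mulr_sumr; apply: ler_sum => q _; rewrite -mulrA.
  apply: ler_wpM2l => //; rewrite mulrCA; apply: ler_wpM2l => //.
  have := ei q x; rewrite indicE; case: (x \in Qc q) => /= h; first by rewrite mulr1.
  by rewrite mulr0.
apply: (@le_trans _ _ (nrm Xs (lin_sum mu s e (fun y => `|f y|)) * kdual_nrm Xs g)%:E).
  apply: le_trans (kdual_pairing hmu XH hg).
  rewrite le_eqVlt; apply/orP; left; apply/eqP; apply: itg_ext => x.
  by rewrite (ger0_norm (nH.2 x)).
by rewrite lee_fin; apply: ler_wpM2r => //; exact: kdual_nrm_ge0.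
Qed.

(** For X' the limit is taken inside the pairings: monotone convergence passes the bound from finite
    families to [HLmax]. *)
Lemma dual_maximal_bounded : bounded_on mu (kdual_set Xs) (kdual_nrm Xs) (HLmax mu).
Proof.
have [C C0 hC] := maxop_pairing; exists C => g hg.
have lg := kdual_locint_vector hg.
pose u n x := maxop mu (@Qseq d n) g x.
have nu n : nnfun (u n) by exact: nnfun_maxop lg.1.
have ndu x n : u n x <= u n.+1 x by exact: maxop_nd.
pose F := HLmax mu g; rewrite -/F.
have uF x : (u n x)%:E @[n --> \oo] --> F x by exact: maxop_cvg.
have mF : measurable_fun setT F.
  by apply: emeasurable_fun_cvg => [n|x _]; [apply/measurable_EFinP; exact: (nu n).1|exact: uF].
have F0 x : (0 <= F x)%E.
  rewrite -(cvg_lim _ (uF x))//; apply: lime_ge; first by apply/cvg_ex; eexists; exact: uF.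
  by apply: nearW => n; rewrite lee_fin; exact: (nu n).2.
pose A := F @^-1` [set +oo%E].
have mA : measurable A by rewrite -[A]setTI; apply: mF => //; exact: measurable_set1.
have Ffin x : ~ A x -> F x \is a fin_num.
  by move=> Ax; rewrite ge0_fin_numE// ltey; apply/eqP.
(* Otherwise saturation gives P in A with \1_P in X; pairing \1_P with min(u_n, k) bounds k mu(P)
   independently of k, impossible for mu(P) > 0. *)
have A0 : mu A = 0%E.
  apply: contrapT => /eqP A0; have {}A0 : (0 < mu A)%E by rewrite lt_def A0 measure_ge0.
  have [P [mP PA P0 XP]] := X_saturation Xs mA A0.
  pose b := C * nrm Xs \1_P * kdual_nrm Xs g.
  have nP : nnfun (\1_P : T -> R) by exact: nnfun_indic.
  have hk (k : nat) : (k%:R%:E * mu P <= b%:E)%E.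
    rewrite -(itg_indic mu mP) -itgZ//.
    have nv n : nnfun (fun x => Num.min (u n x) k%:R * \1_P x).
      by apply: nnfunM => //; apply: nnfun_min => //; exact: nnfun_cst.
    apply: (itg_lim_le nv); first exact: nnfunZ.
    - move=> x n; apply: ler_wpM2r; first by rewrite indicE.
      by rewrite le_min !ge_min ndu lexx orbT.
    - move=> x; have [Px|Px] := pselect (P x); last first.
        rewrite indicE memNset//= mulr0; under eq_fun do rewrite mulr0.
        exact: cvg_cst.
      have := uF x; rewrite (PA _ Px) => /cvgeyPge /(_ k%:R) hx.
      apply: cvg_near_cst; apply: filterS hx => n; rewrite lee_fin => hx.
      by congr (_ * _); apply/min_idPr.
    - move=> n; apply: le_trans (hC _ _ _ (@Qseq_uniq d n) XP hg).
      apply: le_itg => //; first by apply: nnfunM; [exact: nnfun_norm nP.1|exact: nu].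
      move=> x; rewrite (ger0_norm (nP.2 x)) mulrC; apply: ler_wpM2l; first exact: nP.2.
      by rewrite ge_min lexx.
  have Pf : mu P \is a fin_num.
    rewrite ge0_fin_numE; last exact: measure_ge0.
    by apply: le_lt_trans (ltry b); have := hk 1%N; rewrite mul1e.
  move: P0 hk; rewrite -(fineK Pf) lte_fin => P0 hk.
  have := hk (Num.truncn (b / fine (mu P))).+1; rewrite -EFinM lee_fin leNgt -ltr_pdivrMr//.
  by rewrite truncnS_gt.
have mfF : measurable_fun setT (fine \o F) by apply: measurableT_comp.
have fF0 x : 0 <= fine (F x) by exact: fine_ge0.
have key : (kdual_sup Xs (fine \o F) <= (C * kdual_nrm Xs g)%:E)%E.
  apply: ge_ereal_sup => _ [f [Xf f1] <-].
  have mf := X_meas Xf.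
  have nf : nnfun (fun x => `|f x|) by exact: nnfun_norm.
  have nAc : nnfun (\1_(~` A) : T -> R) by apply: nnfun_indic; exact: measurableC.
  have -> : (\int[mu]_x (`|f x * (fine \o F) x|)%:E)%E = itg mu (fun x => `|f x| * fine (F x)).
    by apply: itg_ext => x; rewrite normrM (ger0_norm (fF0 x)).
  (* On A the value of [fine (F x)] is 0 while u n x tends to +oo, so the approximants are cut off
     there. *)
  have nv n : nnfun (fun x => `|f x| * (u n x * \1_(~` A) x)).
    by apply: nnfunM => //; exact: nnfunM.
  apply: (itg_lim_le nv); first by apply: nnfunM.
  - move=> x n; apply: ler_wpM2l => //; apply: ler_wpM2r; first exact: nAc.2.
    exact: ndu.
  - move=> x; rewrite indicE in_setC; apply: cvgM; first exact: cvg_cst.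
    case: (boolP (x \in A)) => [/set_mem Ax|/negP xA] /=.
      by rewrite Ax; under eq_fun do rewrite mulr0; exact: cvg_cst.
    under eq_fun do rewrite mulr1.
    have Fx : F x \is a fin_num by apply: Ffin => Ax; apply: xA; exact: mem_set.
    have h : (u n x)%:E @[n --> \oo] --> (fine (F x))%:E by rewrite fineK//; exact: uF.
    exact: (fine_cvg h).
  - move=> n; have := hC _ _ _ (@Qseq_uniq d n) Xf hg; rewrite f1 mulr1; apply: le_trans.
    apply: le_itg; [exact: (nv n)|exact: (nnfunM nf (nu n))|].
    move=> x; apply: ler_wpM2l => //; apply: ler_piMr; first exact: (nu n).2.
    by rewrite indicE; case: (_ \in _).
have sfin : (kdual_sup Xs (fine \o F) < +oo)%E by exact: le_lt_trans key (ltry _).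
split.
- exists A; split=> // x /= hx; apply: contrapT => Ax; apply: hx; exact: Ffin.
- by split.
- rewrite /kdual_nrm -lee_fin fineK ?ge0_fin_numE ?kdual_sup_ge0//.
Qed.

End vector_bound_implies_dual_bound.

Theorem theorem3p21 (R : realType) (d : nat) (hd : (0 < d)%N)
  (mu : {measure set (d.-tuple R) -> \bar R}) (hmu : is_lebesgue mu)
  (r0 : R) (hr0 : 1 < r0) (Xs : bfs mu)
  (hconv : rconvex Xs r0) (hfatou : fatou_prop Xs) :
  (bounded_on mu (bX Xs) (nrm Xs) (HLmax mu) /\
   bounded_on mu (kdual_set Xs) (kdual_nrm Xs) (HLmax mu))
  <-> (exists r : R, 1 < r <= r0 /\ Mcal_bounded Xs r).
Proof.
split=> [[hM hM']|[r [/andP[r1 rr0] hM]]].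
  exists r0; split; first by rewrite hr0 lexx.
  exact: (vector_maximal_bound hmu hfatou hr0 hconv hM hM').
have [K K0 hK] := rconvex_pow_hull hr0 hconv.
have rr : 1 <= r <= r0 by rewrite (ltW r1) rr0.
have [G G0 hG] := ar_weight hmu r1 hM K0 (hK r rr).
split; first exact: (maximal_bounded hmu hfatou r1 hM K0 (hK r rr) G0 hG).
exact: (dual_maximal_bounded hmu hfatou r1 hM K0 (hK r rr) G0 hG).
Qed.
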